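(* Consider an urn model with replacement matrix $R$ which is balanced (all row sums equal $1$), has all entries nonnegative, and is block upper triangular with blocks $\{Q_{ml}\}_{1\le m,l\le K+1}$, where each diagonal block $Q_k:=Q_{kk}$, $k=1,\dots,K+1$, is either irreducible or the scalar ($1\times1$) zero. Let $\mu_k$ be the character of $Q_k$, and let $C_N^{(k)}$ be the subvector of the color count vector $C_N$ corresponding to the $k$-th block. Define pairs $(\alpha_k,\beta_k)$, $k=1,\dots,K+1$, inductively as follows. For $k=1$, $\alpha_1=\mu_1$ and $\beta_1=0$. Having defined $(\alpha_1,\beta_1),\dots,(\alpha_{k-1},\beta_{k-1})$, let $(\alpha,\beta)$ be the lexicographically largest pair in the set $\{(\alpha_m,\beta_m): 1\le m\le k-1,\ Q_{mk}\neq 0\}$, and if this set is empty put $(\alpha,\beta)=(-\infty,0)$. Then set $$\alpha_k=\max\{\alpha,\mu_k\},\qquad \beta_k=\begin{cases}0,&\text{if }\mu_k>\alpha,\\ \beta+1,&\text{if }\mu_k=\alpha,\\ \beta,&\text{if }\mu_k<\alpha.\end{cases}$$ Then, for every $k=1,\dots,K+1$, $\alpha_k$ is a nonnegative real number, $\beta_k$ is a nonnegative integer, and $(\alpha_k,\beta_k)$ is the rate pair of the $k$-th block, that is, $$\frac{C_N^{(k)}}{N^{\alpha_k}\log^{\beta_k}N}$$ converges, as $N\to\infty$, almost surely as well as in $L^2$.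
   Context: Urn model: there are $D$ colors. The replacement matrix $R=((r_{ij}))$ is a non-random $D\times D$ matrix with nonnegative real entries which is balanced, i.e. each row sum equals $1$. The row vector of initial color counts $C_0$ is a (deterministic) probability vector with all components strictly positive. $C_N=(C_{N,1},\dots,C_{N,D})$ denotes the row vector of color counts after the $N$-th trial (counts need not be integers). At the $N$-th trial, $N\ge1$, given the past, color $i$ is selected with probability $C_{N-1,i}/N$; if color $i$ is selected then $C_{N,j}=C_{N-1,j}+r_{ij}$ for all $j=1,\dots,D$. Blocks: the colors are partitioned into $K+1$ consecutive blocks, the $k$-th containing $d_k$ colors, $d_1+\cdots+d_{K+1}=D$; $Q_{kl}$ is the corresponding $d_k\times d_l$ submatrix of $R$, and block upper triangular means $Q_{kl}=0$ for $k>l$. Irreducible: a square matrix $Q$ with nonnegative entries is irreducible if for all $i,j$ there exists $n=n(i,j)\ge1$ such that the $(i,j)$-th entry of $Q^n$ is strictly positive. Character: for a square nonnegative matrix $Q$ which is irreducible or zero, its character is its Perron-Frobenius eigenvalue if $Q$ is irreducible, and $0$ if $Q=0$. Lexicographic order: $(\alpha,\beta)$ is larger than $(\alpha',\beta')$ if $\alpha>\alpha'$, or $\alpha=\alpha'$ and $\beta>\beta'$. Here $\log^\beta N=(\log N)^\beta$. *)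

(* Defs.v *)
From HB Require Import structures.
From mathcomp Require Import all_boot all_order all_algebra.
From mathcomp Require Import all_classical all_reals all_analysis.
From mathcomp Require Import complex.

Set Implicit Arguments.
Unset Strict Implicit.
Unset Printing Implicit Defensive.

Import Order.TTheory GRing.Theory Num.Theory.
Import numFieldNormedType.Exports.

Local Open Scope classical_set_scope.
Local Open Scope ring_scope.

Definition irreducible_mx (R : realType) (n : nat) (Q : 'M[R]_n) : Prop :=
  forall i j : 'I_n, exists2 m : nat, (1 <= m)%N & 0 < (Q ^+ m) i j.

(* The real eigenvalue that dominates the modulus of every complex eigenvalue.
   It is unique when it exists, which for nonnegative irreducible matrices is
   the Perron-Frobenius theorem; 0 is only a junk value. *)
Definition perron_frobenius (R : realType) (n : nat) (Q : 'M[R]_n) : R :=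
  xget 0 [set mu : R | eigenvalue Q mu /\
    forall z : complex R, eigenvalue (map_mx (real_complex R) Q) z ->
      `|z| <= real_complex R mu].

Definition character (R : realType) (n : nat) (Q : 'M[R]_n) : R :=
  if `[< irreducible_mx Q >] then perron_frobenius Q else 0.

Section Rates.
Variables (R : realType) (K : nat) (d : 'I_K.+1 -> nat).
Variable A : 'M[R]_(\sum_k d k).

(* [Order.max] on this type is the maximum for the lexicographic order. *)
Definition rate_pairs := (\bar R *l int)%type.

(* The pair (-oo, 0) is both the value for an empty index set and, as every
   rate pair has a first component > -oo (see [rate_gtNy]), neutral for the
   lexicographic maximum of a nonempty one. *)
Definition previous_rate (f : 'I_K.+1 -> rate_pairs) (k : 'I_K.+1) :
    rate_pairs :=
  \big[Order.max/((-oo)%E, 0)]_(m < K.+1 | (m < k)%N && (submxblock A m k != 0))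
    f m.

Definition rate_step (f : 'I_K.+1 -> rate_pairs) (k : 'I_K.+1) : rate_pairs :=
  let: (a, b) := previous_rate f k in
  let mu := (character (submxblock A k k))%:E in
  (Order.max a mu,
   if (a < mu)%E then 0 else if mu == a then b + 1 else b).

Fixpoint rate_rec (n : nat) : 'I_K.+1 -> rate_pairs :=
  if n is n'.+1 then rate_step (rate_rec n') else fun=> ((-oo)%E, 0).

(* The pair (alpha_k, beta_k), defined by recursion on k: the k.+1 rounds
   suffice since [rate_step f k] only uses [f m] for m < k; see [rateE]. *)
Definition rate (k : 'I_K.+1) : rate_pairs := rate_rec k.+1 k.

Lemma rate_recE (n : nat) (k : 'I_K.+1) : (k < n)%N -> rate_rec n k = rate k.
Proof.
suff H p : forall n m (k : 'I_K.+1),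
    (k < p)%N -> (k < n)%N -> (k < m)%N -> rate_rec n k = rate_rec m k.
  by move=> kn; apply: (H K.+1).
elim: p => // p IH {}n m {}k kp; case: n => // n kn; case: m => // m km /=.
rewrite /rate_step; suff -> : previous_rate (rate_rec n) k =
  previous_rate (rate_rec m) k by [].
apply: eq_bigr => i /andP[ik _].
by apply: IH; apply: leq_trans ik _; rewrite -ltnS.
Qed.

Lemma rateE (k : 'I_K.+1) : rate k = rate_step rate k.
Proof.
rewrite {1}/rate /= /rate_step; suff -> : previous_rate (rate_rec k) k =
  previous_rate rate k by [].
by apply: eq_bigr => i /andP[ik _]; exact: rate_recE.
Qed.

Lemma rate_gtNy (k : 'I_K.+1) : (-oo < (rate k).1)%E.
Proof.
rewrite rateE /rate_step; case: previous_rate => a b /=.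
by rewrite lt_max ltNyr orbT.
Qed.

End Rates.

Section Urn.
Variables (R : realType) (D : nat) (C0 : 'rV[R]_D) (A : 'M[R]_D).
Variables (disp : measure_display) (Omega : measurableType disp).
Variables (P : probability Omega R) (sel : nat -> Omega -> 'I_D).

(* [sel N w] is the color selected at trial N.+1. *)
Fixpoint color_count (N : nat) (w : Omega) : 'rV[R]_D :=
  if N is N'.+1 then color_count N' w + row (sel N' w) A else C0.

(* The sigma-algebra generated by the outcomes of the first N trials; the
   counts up to time N are functions of these outcomes. *)
Definition past (N : nat) : set (set Omega) :=
  <<s [set E | exists n i, (n < N)%N /\ E = [set w | sel n w = i]] >>.

(* The second clause says that the conditional probability, given the past,
   that color i is selected at trial N.+1 is (color_count N)_i / N.+1. *)
Definition urn_process : Prop :=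
  (forall n i, measurable [set w | sel n w = i]) /\
  (forall N i E, past N E ->
     P (E `&` [set w | sel N w = i]) =
     (\int[P]_(w in E) (color_count N w 0 i / N.+1%:R)%:E)%E).

End Urn.

Section Convergence.
Variables (R : realType) (disp : measure_display) (Omega : measurableType disp).
Variables (P : probability Omega R) (n : nat).

(* The values of the normalized vector at N = 0 and N = 1, where ln N = 0, are
   irrelevant. *)
Definition is_rate_pair (C : nat -> Omega -> 'rV[R]_n) (a : R) (b : nat) :
    Prop :=
  let Y (N : nat) (j : 'I_n) (w : Omega) : R :=
    (C N w) 0 j / (N%:R `^ a * (ln N%:R) ^+ b) in
  exists X : 'I_n -> {RV P >-> R},
    [/\ {ae P, forall w, forall j, (Y N j w @[N --> \oo] --> X j w)},
        forall j, (X j : Omega -> R) \in Lfun P 2%:E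
      & forall j, (Lnorm P 2%:E (fun w => (Y N j w - X j w)%:E)
                    @[N --> \oo] --> 0)%E].

End Convergence.

(* Main.v *)
Require Import Defs.
From HB Require Import structures.
From mathcomp Require Import all_boot all_order all_algebra.
From mathcomp Require Import all_classical all_reals all_analysis.
From mathcomp Require Import measurable_realfun complex ring lra.

Set Implicit Arguments.
Unset Strict Implicit.
Unset Printing Implicit Defensive.

Import Order.TTheory GRing.Theory Num.Theory.
Import numFieldNormedType.Exports.

Local Open Scope classical_set_scope.
Local Open Scope ring_scope.

(** With [theta N = 1 / (N + 1)], one trial of the urn changes the counts by
    [C N.+1 = C N + theta N *: (C N *m A) + xi N], where [xi N] is a
    martingale difference. Randomness enters through [xi] alone, and the proof
    separates it from the dynamics.

    Dynamics. Block [k] obeys [x N.+1 = x N + theta N *: (x N *m Q + g N) + xi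
    N] with [Q] its diagonal block and [g] the inflow from earlier blocks. If
    [u] and [v] are the positive right and left eigenvectors of [Q] for its
    Perron-Frobenius eigenvalue [mu], then [mu - Q] is dissipative for the
    square norm [\sum_j (u j / v j) * x j ^+ 2]: the defect is a Dirichlet
    form, and irreducibility makes it vanish on multiples of [v] only. Hence
    after division by the norming the equation contracts at the speed [theta
    N], except along [v] when the exponent of the norming is [mu]; there the
    scalar [x *m u] is handled by hand. If the inflow is of smaller order than
    [N ^ mu], that scalar is a convergent series; if it is of the same order,
    it gains one logarithm; if it is of larger order, [v] is contracted too,
    and the block follows its inflow. By induction on the blocks, whenever the
    sums of the normalised noises converge, so do the normalised blocks
    ([block_dynamics_cvg]), and they are bounded by a constant, the same for
    all trajectories, times a bound on the noise sums
    ([block_dynamics_bound]).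

    Noise. The mean square of the noise of a block is at most [theta N] times
    the mean inflow into it, the inflow from itself included. The mean counts
    satisfy the same recursion without noise, so [block_dynamics_bound]
    estimates them, and the variances of the normalised noises are summable
    ([variance_summable]). Doob's maximal inequality then makes the noise sums
    converge almost surely and dominates them by a square integrable variable
    ([martingale_cvg], [martingale_maximal]).

    The almost sure limits follow along almost every trajectory, and the bound
    of the dynamics turns the maximal function of the noise into a square
    integrable majorant of the normalised counts, so that dominated
    convergence gives the limits in L2 ([l2_dominated_limit],
    [urn_rate_pair]).

    The normings are products of [\prod_j (1 + a * theta j)] and of powers of
    [1 + \sum_j theta j], for which the recursions hold exactly; they are
    compared with [N ^ a * (ln N) ^ b] only at the very end
    ([norming_asymptotics]). *)

(** * Scalar recursions *)

Section ScalarRecursions.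
Variable R : realType.
Implicit Types (a e f : nat -> R).

(** Above the level [E / k] the contraction beats the forcing. *)
Lemma contraction_bound a f (k E : R) (N0 : nat) :
    0 < k -> (forall N, (N0 <= N)%N -> 0 <= k * f N <= 1) ->
    (forall N, (N0 <= N)%N -> 0 <= a N) -> 0 <= E ->
    (forall N, (N0 <= N)%N -> a N.+1 <= (1 - k * f N) * a N + f N * E) ->
  forall N, (N0 <= N)%N -> a N <= a N0 + E / k.
Proof.
move=> k0 kf a0 E0 aS N N0N.
rewrite -(subnKC N0N); elim: (N - N0)%N => [|n IH].
  by rewrite addn0 lerDl divr_ge0// ltW.
rewrite addnS; apply: (le_trans (aS _ (leq_addr _ _))).
have /andP[kf0 kf1] := kf _ (leq_addr n N0).
set A := a N0 + E / k in IH *.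
have -> : f (N0 + n)%N * E = k * f (N0 + n)%N * (E / k) by field; rewrite gt_eqF.
apply: (@le_trans _ _ ((1 - k * f (N0 + n)%N) * A + k * f (N0 + n)%N * A)).
  apply: lerD; first by rewrite ler_wpM2l// subr_ge0.
  by rewrite ler_wpM2l// lerDr a0.
by rewrite -mulrDl subrK mul1r.
Qed.

(** For every [eps], the excess of [a] over [eps] is eventually bounded by a
    multiple of the reciprocal of [1 + k * \sum_j f j]. *)
Lemma contraction_cvg0 a e f (k : R) (N0 : nat) :
    0 < k -> (forall N, (N0 <= N)%N -> 0 <= k * f N <= 1) ->
    (forall N, (N0 <= N)%N -> 0 <= a N) ->
    (forall N, (N0 <= N)%N -> a N.+1 <= (1 - k * f N) * a N + f N * e N) ->
    e N @[N --> \oo] --> 0 ->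
    \sum_(j < n) f j @[n --> \oo] --> +oo ->
  a N @[N --> \oo] --> 0.
Proof.
move=> k0 kf a0 aS e0 fy.
apply/cvgrPdist_le => eps eps0.
have eps2 : 0 < eps / 2 by rewrite divr_gt0.
have keps : 0 < k * (eps / 2) by rewrite mulr_gt0.
have /cvgrPdist_le/(_ _ keps) [N1 _ N1P] := e0.
pose M := maxn N0 N1.
pose F n := \sum_(j < n) f j.
pose p N := Num.max (a N - eps / 2) 0.
have p0 N : 0 <= p N by rewrite le_max lexx orbT.
have MN0 n : (N0 <= M + n)%N by exact: leq_trans (leq_maxl N0 N1) (leq_addr _ _).
have pS n : p (M + n).+1 <= (1 - k * f (M + n)%N) * p (M + n)%N.
  have /andP[kf0 kf1] := kf _ (MN0 n).
  rewrite ge_max; apply/andP; split; last by rewrite mulr_ge0// subr_ge0.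
  have eb : e (M + n)%N <= k * (eps / 2).
    have N1M : (N1 <= M + n)%N by exact: leq_trans (leq_maxr N0 N1) (leq_addr _ _).
    by have := N1P _ N1M; rewrite /= sub0r normrN => /(le_trans (ler_norm _)).
  have f0 : 0 <= f (M + n)%N by rewrite -(pmulr_rge0 _ k0).
  have h1 := aS _ (MN0 n).
  have h2 : f (M + n)%N * e (M + n)%N <= f (M + n)%N * (k * (eps / 2)).
    by rewrite ler_wpM2l.
  have h3 : (1 - k * f (M + n)%N) * (a (M + n)%N - eps / 2) <=
            (1 - k * f (M + n)%N) * p (M + n)%N.
    by rewrite ler_wpM2l ?subr_ge0// le_max lexx.
  apply: le_trans h3; nra.
have pF n : p (M + n)%N * (1 + k * (F (M + n)%N - F M)) <= p M.
  elim: n => [|n IH]; first by rewrite addn0 subrr mulr0 addr0 mulr1.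
  apply: le_trans IH.
  have /andP[kf0 kf1] := kf _ (MN0 n).
  have FS : F (M + n).+1 = F (M + n)%N + f (M + n)%N.
    by rewrite /F big_ord_recr.
  rewrite addnS FS.
  have Fn0 : 0 <= k * (F (M + n)%N - F M).
    elim: n {kf0 kf1 FS} => [|n IH]; first by rewrite addn0 subrr mulr0.
    have /andP[kf0 kf1] := kf _ (MN0 n).
    rewrite addnS /F big_ord_recr /= -/(F (M + n)%N) -addrA [f _ + _]addrC addrA.
    by rewrite mulrDr addr_ge0.
  set t := k * (F (M + n)%N - F M) in Fn0 *.
  have -> : k * (F (M + n)%N + f (M + n)%N - F M) = t + k * f (M + n)%N.
    by rewrite /t; ring.
  have h : 0 <= 1 + (t + k * f (M + n)%N) by lra.
  apply: (le_trans (ler_wpM2r h (pS n))).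
  have := p0 (M + n)%N; set x := k * f _ in kf0 kf1 h *; set q := p _ => q0.
  have : (1 - x) * (1 + (t + x)) <= 1 + t by nra.
  by move=> /(ler_wpM2l q0); lra.
have /cvgryPge/(_ (F M + (2 * p M / eps) / k)) [N2 _ N2P] := fy.
exists (maxn M N2) => // N /= MN.
have MN1 : (M <= N)%N by rewrite (leq_trans (leq_maxl _ _) MN).
have := N2P N (leq_trans (leq_maxr _ _) MN) => /=.
have := pF (N - M)%N; rewrite subnKC// -/(F N) => h1 h2.
rewrite sub0r normrN ger0_norm ?a0//; last first.
  by rewrite (leq_trans _ MN1)// leq_maxl.
have h3 : 2 * p M / eps <= k * (F N - F M).
  rewrite -ler_pdivrMl//; lra.
have h4 : p N * (2 * p M / eps + 1) <= p M.
  apply: le_trans h1; rewrite ler_wpM2l// addrC lerD2l//.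
have h5 : p N <= eps / 2.
  have [->|pM0] := eqVneq (p N) 0; first exact: ltW.
  have pN0 : 0 < p N by rewrite lt_neqAle eq_sym pM0 p0.
  have h6 : p N * p M * 2 <= p M * eps.
    have : p N * (2 * p M / eps) <= p M.
      by apply: le_trans h4; rewrite ler_wpM2l// lerDl.
    rewrite !mulrA ler_pdivrMr//; lra.
  have pMp : 0 < p M.
    by apply: lt_le_trans h4; rewrite mulr_gt0// ltr_wpDl// divr_ge0 ?mulr_ge0// ltW.
  rewrite -(ler_pM2l pMp); lra.
have : a N - eps / 2 <= p N by rewrite le_max lexx.
lra.
Qed.

End ScalarRecursions.

(** * Norming sequences *)

Section Norming.
Variable R : realType.
Implicit Types (a : R) (b N : nat).

Definition step N : R := N.+1%:R^-1.

Lemma step_gt0 N : 0 < step N.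
Proof. by rewrite invr_gt0 ltr0n. Qed.

Lemma step_le1 N : step N <= 1.
Proof. by rewrite invf_le1 ?ltr0n// ler1n. Qed.

Lemma cvg_step : step N @[N --> \oo] --> 0.
Proof. exact: cvg_harmonic. Qed.

(** The solution of [x N.+1 = (1 + a * step N) * x N]; it stands for [N ^ a]. *)
Definition growth a N : R := \prod_(j < N) (1 + a * step j).

(** It stands for [ln N], without vanishing at [N = 1]. *)
Definition harm N : R := 1 + \sum_(j < N) step j.

Definition norming a b N : R := growth a N * harm N ^+ b.

Definition harm_ratio b N : R := (harm N / harm N.+1) ^+ b.

Lemma growthS a N : growth a N.+1 = growth a N * (1 + a * step N).
Proof. by rewrite /growth big_ord_recr. Qed.

Lemma harmS N : harm N.+1 = harm N + step N.
Proof. by rewrite /harm big_ord_recr /= addrA. Qed.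

Lemma harm_ge1 N : 1 <= harm N.
Proof. by rewrite lerDl sumr_ge0// => j _; exact/ltW/step_gt0. Qed.

Lemma harm_gt0 N : 0 < harm N.
Proof. exact: lt_le_trans ltr01 (harm_ge1 N). Qed.

Lemma growth_factor_gt0 a N : 0 <= a -> 0 < 1 + a * step N.
Proof. by move=> a0; rewrite ltr_wpDr// mulr_ge0// ltW// step_gt0. Qed.

Lemma growth_gt0 a N : 0 <= a -> 0 < growth a N.
Proof. by move=> a0; apply: prodr_gt0 => j _; exact: growth_factor_gt0. Qed.

Lemma norming_gt0 a b N : 0 <= a -> 0 < norming a b N.
Proof. by move=> a0; rewrite mulr_gt0 ?growth_gt0// exprn_gt0// harm_gt0. Qed.

Lemma norming0 a b : norming a b 0 = 1.
Proof. by rewrite /norming /growth /harm !big_ord0 addr0 expr1n mulr1. Qed.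

Lemma harm_ratio_gt0 b N : 0 < harm_ratio b N.
Proof. by rewrite exprn_gt0// divr_gt0 ?harm_gt0. Qed.

Lemma harm_ratio_le1 b N : harm_ratio b N <= 1.
Proof.
rewrite exprn_ile1// ?divr_ge0 ?(ltW (harm_gt0 _))//.
by rewrite ler_pdivrMr ?harm_gt0// mul1r harmS lerDl ltW// step_gt0.
Qed.

(** An instance of Bernoulli's inequality. *)
Lemma harm_ratio_ge b N : 1 - b%:R * (step N / harm N) <= harm_ratio b N.
Proof.
have H0 := harm_gt0 N; have s0 := step_gt0 N.
have r0 : 0 <= harm N / harm N.+1 by rewrite divr_ge0 ?(ltW (harm_gt0 _)).
have t0 : 0 <= step N / harm N by rewrite divr_ge0 ?ltW.
have h : 1 - step N / harm N <= harm N / harm N.+1.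
  rewrite ler_pdivlMr ?harm_gt0// harmS.
  have e : step N / harm N * harm N = step N by rewrite divfK// gt_eqF.
  have : 0 <= step N / harm N * step N by rewrite mulr_ge0// ltW.
  by move: e; set t := step N / harm N => e; lra.
elim: b => [|b IH]; first by rewrite mul0r subr0 /harm_ratio expr0.
rewrite /harm_ratio exprS -/(harm_ratio b N).
have h1 : harm N / harm N.+1 <= 1 by have := harm_ratio_le1 1 N; rewrite /harm_ratio expr1.
have q0 := harm_ratio_gt0 b N; have q1 := harm_ratio_le1 b N.
rewrite -natr1; set t := step N / harm N in t0 h IH *.
set r := harm N / harm N.+1 in r0 h h1 *; set q := harm_ratio b N in IH q0 q1 *.
nra.
Qed.

Lemma normingS a b N : 0 <= a ->
  norming a b N.+1 = norming a b N * (1 + a * step N) / harm_ratio b N.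
Proof.
move=> a0; rewrite /norming /harm_ratio growthS expr_div_n.
have H0 : harm N ^+ b != 0 by rewrite gt_eqF// exprn_gt0 ?harm_gt0.
have H1 : harm N.+1 ^+ b != 0 by rewrite gt_eqF// exprn_gt0 ?harm_gt0.
by field; rewrite H0 H1.
Qed.


Lemma harm_ge_ln N : ln (N.+1%:R : R) <= harm N.
Proof.
elim: N => [|N IH]; first by rewrite ln1 ltW// harm_gt0.
rewrite harmS.
have -> : N.+2%:R = N.+1%:R * (1 + step N) :> R.
  by rewrite mulrDr mulr1 divff ?pnatr_eq0// natr1.
have s0 : 0 < 1 + step N by have := step_gt0 N; lra.
rewrite lnM ?posrE ?ltr0n//.
by apply: lerD => //; rewrite le_ln1Dx// (lt_trans _ (step_gt0 N))// ltrN10.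
Qed.


Lemma cvg_ln_pinfty (u : nat -> R) :
  u N @[N --> \oo] --> +oo -> ln (u N) @[N --> \oo] --> +oo.
Proof.
move=> uy; apply/cvgryPge => A.
have /cvgryPge/(_ (expR A)) := uy; apply: filterS => N AN.
by rewrite -[A]expRK ler_ln ?posrE ?expR_gt0// (lt_le_trans _ AN)// expR_gt0.
Qed.

Lemma cvg_harm : harm N @[N --> \oo] --> +oo.
Proof.
apply: (@ger_cvgy _ _ _ _ (fun N => ln (N.+1%:R : R))).
  by apply: nearW => N; exact: harm_ge_ln.
apply: cvg_ln_pinfty; apply/cvgryPge => A.
have /cvgryPge/(_ A) := @cvgr_idn R.
by apply: filterS => N AN; rewrite (le_trans AN)// ler_nat.
Qed.

Lemma sum_stepE n : \sum_(j < n) step j = harm n - 1.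
Proof. by rewrite /harm addrAC subrr add0r. Qed.

Lemma cvg_sum_step : \sum_(j < n) step j @[n --> \oo] --> +oo.
Proof.
apply/cvgryPge => A; have /cvgryPge/(_ (A + 1)) := cvg_harm.
by apply: filterS => N AN; rewrite sum_stepE lerBrDr.
Qed.

Lemma cvg_sum_damped_step a : 0 <= a ->
  \sum_(j < n) (step j / (1 + a * step j)) @[n --> \oo] --> +oo.
Proof.
move=> a0; have a1 : 0 < 1 + a by lra.
apply: (@ger_cvgy _ _ _ _ (fun n => \sum_(j < n) step j * (1 + a)^-1)).
  apply: nearW => n; apply: ler_sum => j _.
  rewrite ler_pM2l ?step_gt0// lef_pV2 ?posrE ?growth_factor_gt0//.
  by rewrite lerD2l ler_piMr// step_le1.
apply/cvgryPge => A; have /cvgryPge/(_ (A * (1 + a))) := cvg_sum_step.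
by apply: filterS => N AN; rewrite -mulr_suml ler_pdivlMr.
Qed.

(** These are the steps of the time scale [ln (harm N)], an iterated logarithm. *)
Lemma cvg_sum_log_step :
  \sum_(j < n) (step j / harm j) @[n --> \oo] --> +oo.
Proof.
apply: (@ger_cvgy _ _ _ _ (fun n => ln (harm n))); last first.
  exact/cvg_ln_pinfty/cvg_harm.
apply: nearW; elim => [|n IH].
  by rewrite big_ord0 /harm big_ord0 addr0 ln1.
have t0 : 0 < step n / harm n by rewrite divr_gt0 ?step_gt0 ?harm_gt0.
rewrite big_ord_recr /=.
have -> : harm n.+1 = harm n * (1 + step n / harm n).
  by rewrite harmS mulrDr mulr1 mulrCA divff ?mulr1// gt_eqF// harm_gt0.
rewrite lnM ?posrE ?harm_gt0// ?addr_gt0//.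
by apply: lerD => //; rewrite le_ln1Dx// (lt_trans _ t0)// ltrN10.
Qed.

Lemma cvg_harmV : (harm N)^-1 @[N --> \oo] --> 0.
Proof. by apply/gtr0_cvgV0; [exact: nearW harm_gt0 | exact: cvg_harm]. Qed.

Lemma cvg_log_step : step N / harm N @[N --> \oo] --> 0.
Proof. by rewrite -[0](mulr0 0); apply: cvgM; [exact: cvg_step | exact: cvg_harmV]. Qed.

(** The decrements of [w] bound [c * step N * w N], so the sum telescopes. *)
Lemma decay_summable (w : nat -> R) (c : R) (N0 : nat) :
    (forall N, 0 <= w N) -> 0 < c ->
    (forall N, (N0 <= N)%N -> w N.+1 <= (1 - c * step N) * w N) ->
  exists C, forall n, \sum_(N < n) step N * w N <= C.
Proof.
move=> w0 c0 wS.
have s0 n : 0 <= step n * w n by rewrite mulr_ge0// ltW// step_gt0.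
exists (\sum_(N < N0) step N * w N + w N0 / c) => n.
apply: (@le_trans _ _ (\sum_(N < N0 + n) step N * w N)).
  have -> : (N0 + n = n + N0)%N by rewrite addnC.
  by rewrite big_split_ord /= lerDl sumr_ge0.
rewrite big_split_ord /= lerD2l.
suff : \sum_(i < n) step (N0 + i) * w (N0 + i)%N <= (w N0 - w (N0 + n)%N) / c.
  by move=> /le_trans; apply; rewrite ler_pM2r ?invr_gt0// gerBl.
elim: n => [|n IH]; first by rewrite big_ord0 addn0 subrr mul0r.
rewrite big_ord_recr /=; apply: (le_trans (lerD IH (lexx _))).
have := wS _ (leq_addr n N0); rewrite addnS.
rewrite -lerBrDl -mulrBl ler_pdivlMr//; lra.
Qed.

Lemma decay_cvg0 (w : nat -> R) (c : R) (N0 : nat) :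
    (forall N, 0 <= w N) -> 0 < c <= 1 ->
    (forall N, (N0 <= N)%N -> w N.+1 <= (1 - c * step N) * w N) ->
  w N @[N --> \oo] --> 0.
Proof.
move=> w0 /andP[c0 c1] wS.
apply: (@contraction_cvg0 _ w (fun=> 0) step c N0) => //.
- move=> N _; rewrite mulr_ge0 ?(ltW c0) ?(ltW (step_gt0 N))//=.
  by rewrite mulr_ile1 ?step_le1// ltW// step_gt0.
- by move=> N /wS; rewrite mulr0 addr0.
- exact: cvg_cst.
- exact: cvg_sum_step.
Qed.

(** The log factors cannot compensate a gap between the exponents, because
    [harm] grows slower than any power. *)
Lemma norming_ratio_decay (a a' : R) (b b' : nat) : 0 <= a' -> a' < a ->
  exists2 c, 0 < c <= 1 & exists N0, forall N, (N0 <= N)%N ->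
    norming a' b' N.+1 / norming a b N.+1 <=
    (1 - c * step N) * (norming a' b' N / norming a b N).
Proof.
move=> a'0 aa; have a0 : 0 <= a by lra.
pose e := (a - a') / (1 + a).
have e01 : 0 < e <= 1.
  by rewrite divr_gt0 ?subr_gt0//=; [rewrite ler_pdivrMr; lra | lra].
case/andP: e01 => e0 e1.
exists (e / 2); first by apply/andP; split; lra.
have b1 : 0 < b'%:R + 1 :> R by rewrite ltr_wpDl.
have /cvgryPge/(_ ((b'%:R + 1) * 2 / e)) [N0 _ N0P] := cvg_harm.
exists N0 => N N0N.
have Hb := N0P _ N0N.
have s0 := step_gt0 N; have s1 := step_le1 N.
have p0 := norming_gt0 b N a0; have p'0 := norming_gt0 b' N a'0.
have r0 := harm_ratio_gt0 b N; have r'0 := harm_ratio_gt0 b' N.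
have r1 := harm_ratio_le1 b N; have r'1 := harm_ratio_ge b' N.
have f0 := growth_factor_gt0 N a0; have f'0 := growth_factor_gt0 N a'0.
rewrite !normingS//.
have -> : norming a' b' N * (1 + a' * step N) / harm_ratio b' N /
   (norming a b N * (1 + a * step N) / harm_ratio b N) =
   (norming a' b' N / norming a b N) *
   ((1 + a' * step N) / (1 + a * step N) * (harm_ratio b N / harm_ratio b' N)).
  by field; rewrite !gt_eqF.
rewrite mulrC ler_pM2r ?divr_gt0//.
rewrite mulrA ler_pdivrMr// .
set s := step N in s0 s1 f0 f'0 r'1 *.
have h1 : (1 + a' * s) / (1 + a * s) <= 1 - e * s.
  rewrite ler_pdivrMr//.
  have : e * (1 + a * s) <= a - a'.
    rewrite /e mulrAC ler_pdivrMr; last lra.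
    by apply: ler_wpM2l; [lra | rewrite lerD2l ler_piMr].
  by move=> /(ler_wpM2r (ltW s0)); lra.
have h2 : b'%:R * (s / harm N) <= e / 2 * s.
  rewrite mulrCA [leRHS]mulrC ler_pM2l// ler_pdivrMr ?harm_gt0//.
  move: Hb; rewrite ler_pdivrMr//; lra.
apply: (@le_trans _ _ ((1 - e * s) * 1)).
  by apply: ler_pM => //; rewrite ltW// divr_gt0.
have es1 : e * s <= 1 by rewrite mulr_ile1// ltW.
have es0 : 0 <= (e * s) ^+ 2 by exact: sqr_ge0.
rewrite mulr1; apply: (@le_trans _ _ ((1 - e / 2 * s) * (1 - e / 2 * s))); first by lra.
by rewrite ler_wpM2l//; [lra | apply: le_trans r'1; lra].
Qed.

Lemma norming_ratio_cvg (a a' : R) (b b' : nat) : 0 <= a' ->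
    (a' < a) || ((a' == a) && (b' <= b)%N) ->
  exists l : R, norming a' b' N / norming a b N @[N --> \oo] --> l.
Proof.
move=> a'0 /orP[aa|/andP[/eqP <-{a} bb]].
  have [c c01 [N0 N0P]] := norming_ratio_decay b b' a'0 aa.
  exists 0; apply: (decay_cvg0 _ c01 N0P) => N.
  by rewrite divr_ge0// ltW// norming_gt0//; lra.
rewrite -(subnK bb); elim: (b - b')%N => [|n [l IH]].
  exists 1; apply: cvg_near_cst; apply: nearW => N.
  by rewrite add0n divff// gt_eqF// norming_gt0.
exists (l * 0).
have -> : (fun N => norming a' b' N / norming a' (n.+1 + b') N) =
    (fun N => norming a' b' N / norming a' (n + b') N * (harm N)^-1).
  apply/funext => N; rewrite /norming addSn exprSr invfM [in RHS]invfM.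
  rewrite -!mulrA; congr (_ * _); congr (_ * _).
  by rewrite invfM !mulrA.
by apply: cvgM => //; exact: cvg_harmV.
Qed.

End Norming.

(** * Contractions of row vectors *)

Lemma cvg_sumr (R : realType) (I : Type) (r : seq I) (Q : pred I)
    (f : I -> nat -> R) (l : I -> R) :
    (forall i, Q i -> f i N @[N --> \oo] --> l i) ->
  \sum_(i <- r | Q i) f i N @[N --> \oo] --> \sum_(i <- r | Q i) l i.
Proof. by move=> fl; apply: cvg_big => //; exact: add_continuous. Qed.

Section WeightedSquare.
Variables (R : realType) (n : nat) (w : 'I_n -> R).
Hypothesis w_gt0 : forall j, 0 < w j.
Implicit Types (x y : 'rV[R]_n) (B : 'M[R]_n).

Definition wsq x : R := \sum_j w j * x 0 j ^+ 2.

Definition wform x B : R := \sum_j w j * (x *m B) 0 j * x 0 j.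

Lemma wsq_ge0 x : 0 <= wsq x.
Proof. by apply: sumr_ge0 => j _; rewrite mulr_ge0 ?sqr_ge0// ltW. Qed.

Lemma wsqZ a x : wsq (a *: x) = a ^+ 2 * wsq x.
Proof. by rewrite /wsq mulr_sumr; apply: eq_bigr => j _; rewrite mxE; ring. Qed.

(** Young's inequality stands in for the triangle inequality. *)
Lemma wsqD_young (h : R) x y : 0 < h ->
  wsq (x + y) <= (1 + h) * wsq x + (1 + h^-1) * wsq y.
Proof.
move=> h0; rewrite /wsq !mulr_sumr -big_split /=; apply: ler_sum => j _.
rewrite mxE; set a := x 0 j; set b := y 0 j.
have -> : (1 + h) * (w j * a ^+ 2) + (1 + h^-1) * (w j * b ^+ 2) =
          w j * (a + b) ^+ 2 + w j * (h^-1 * (h * a - b) ^+ 2).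
  by field; rewrite gt_eqF.
by rewrite lerDl mulr_ge0 ?(ltW (w_gt0 j))// mulr_ge0 ?sqr_ge0// invr_ge0 ltW.
Qed.

Lemma wsqD x y : wsq (x + y) <= 2 * wsq x + 2 * wsq y.
Proof. by have := @wsqD_young 1 x y ltr01; rewrite invr1. Qed.

Lemma wsq_coord x j : x 0 j ^+ 2 <= wsq x / w j.
Proof.
rewrite ler_pdivlMr// mulrC /wsq (bigD1 j)//= lerDl sumr_ge0// => i _.
by rewrite mulr_ge0 ?sqr_ge0// ltW.
Qed.

Lemma wsq_le_sup x (M : R) : (forall j, `|x 0 j| <= M) ->
  wsq x <= (\sum_j w j) * M ^+ 2.
Proof.
move=> xM; rewrite mulr_suml; apply: ler_sum => j _.
rewrite ler_pM2l// -[leLHS]real_normK ?num_real//.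
by rewrite lerXn2r ?nnegrE// (le_trans _ (xM j)).
Qed.

Lemma wsq_mulmx B : exists2 C : R, 0 <= C & forall x, wsq (x *m B) <= C * wsq x.
Proof.
pose s (j : 'I_n) := \sum_i `|B i j| / Num.sqrt (w i).
exists (\sum_j w j * s j ^+ 2).
  by apply: sumr_ge0 => j _; rewrite mulr_ge0 ?sqr_ge0// ltW.
move=> x; rewrite mulr_suml {1}/wsq; apply: ler_sum => j _.
rewrite -mulrA ler_pM2l//.
have V0 := wsq_ge0 x.
rewrite -[wsq x]sqr_sqrtr// -exprMn -[leLHS]real_normK ?num_real//.
rewrite lerXn2r ?nnegrE//.
  by rewrite mulr_ge0 ?sqrtr_ge0// sumr_ge0// => i _; rewrite divr_ge0 ?sqrtr_ge0.
rewrite mxE (le_trans (ler_norm_sum _ _ _))// /s mulr_suml.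
apply: ler_sum => i _; rewrite normrM mulrC -mulrA ler_wpM2l//.
rewrite mulrC -sqrtrV; last exact: ltW.
rewrite -sqrtrM//.
by rewrite -sqrtr_sqr ler_sqrt ?mulr_ge0 ?invr_ge0 ?(ltW (w_gt0 i))// wsq_coord.
Qed.

Lemma wsqB_scale x B (s : R) :
  wsq (x - s *: (x *m B)) = wsq x - 2 * s * wform x B + s ^+ 2 * wsq (x *m B).
Proof.
rewrite /wsq /wform !mulr_sumr -sumrB -big_split /=; apply: eq_bigr => j _.
by move: (x *m B) => y; rewrite !mxE; ring.
Qed.

Lemma wsq_cvg0P (x : nat -> 'rV[R]_n) :
  wsq (x N) @[N --> \oo] --> 0 <-> forall j, x N 0 j @[N --> \oo] --> 0.
Proof.
split=> [xV j|xj].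
  have h : Num.sqrt (wsq (x N) / w j) @[N --> \oo] --> 0.
    rewrite -[0 in X in _ --> X]sqrtr0; apply: continuous_cvg.
      exact: sqrt_continuous.
    by rewrite -(mul0r (w j)^-1); apply: cvgMr_tmp.
  apply: norm_cvg0; apply: (squeeze_cvgr _ (cvg_cst 0) h).
  apply: nearW => N; rewrite normr_ge0 /= -sqrtr_sqr ler_sqrt ?wsq_coord//.
  by rewrite divr_ge0 ?wsq_ge0// ltW.
have -> : 0 = \sum_(j < n) w j * (0 * 0).
  by rewrite big1// => j _; rewrite !mulr0.
apply: cvg_sumr => j _.
by apply: cvgM; [exact: cvg_cst|apply: cvgM].
Qed.

Lemma wsq_cvg0_bound (x : nat -> 'rV[R]_n) (u : nat -> R) :
  (forall N, wsq (x N) <= u N) -> u N @[N --> \oo] --> 0 ->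
  wsq (x N) @[N --> \oo] --> 0.
Proof.
move=> xu u0; apply: (squeeze_cvgr _ (cvg_cst 0) u0).
by apply: nearW => N; rewrite wsq_ge0 xu.
Qed.

End WeightedSquare.

(** Recursions [z N.+1 = z N *m T N + f N *: e N + zeta N] whose linear part
    contracts at speed [f N].  The forcing [e] is weighted by the time step, while
    for the noise [zeta] only the partial sums are controlled. *)
Section VectorContraction.
Variables (R : realType) (n : nat) (w : 'I_n -> R).
Hypothesis w_gt0 : forall j, 0 < w j.
Variables (T : nat -> 'M[R]_n) (f : nat -> R) (k K : R) (N0 : nat).
Hypotheses (k_gt0 : 0 < k) (K_ge0 : 0 <= K) (f01 : forall N, 0 < f N <= 1).
Hypothesis kf_le1 : forall N, (N0 <= N)%N -> k * f N <= 1.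
Hypothesis T_contracts : forall N x, (N0 <= N)%N ->
  wsq w (x *m T N) <= (1 - 2 * k * f N) * wsq w x.
Hypothesis T_near_id : forall N x,
  wsq w (x *m T N - x) <= K * f N ^+ 2 * wsq w x.
Hypothesis f_sum : \sum_(j < N) f j @[N --> \oo] --> +oo.

Implicit Types (z e zeta : nat -> 'rV[R]_n).

Let V := wsq w.
Let C1 := 2 * (1 + K) * (1 + k^-1).

Let C1_ge0 : 0 <= C1.
Proof. by rewrite !mulr_ge0 ?addr_ge0 ?invr_ge0 ?(ltW k_gt0). Qed.

(* Recentring by the partial noise sums turns the noise into a perturbation of
   size [f N], since [T N] is within O([f N]) of the identity. *)
Let recentred N (z e s r : 'rV[R]_n) :
  z *m T N + f N *: e - s + r =
  (z - s + r) *m T N + ((s - r) *m T N - (s - r) + f N *: e).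
Proof.
rewrite !(mulmxDl, mulNmx).
move: (z *m T N) (s *m T N) (r *m T N) (f N *: e) => a b c g.
by apply/rowP => j; rewrite !mxE; ring.
Qed.

Let perturbation N (e u : 'rV[R]_n) :
  V (u *m T N - u + f N *: e) <= 2 * (1 + K) * f N ^+ 2 * (V e + V u).
Proof.
apply: (le_trans (wsqD w_gt0 _ _)); rewrite wsqZ -/V.
have := T_near_id N u; rewrite -/V.
have V0 := wsq_ge0 w_gt0 u; have V1 := wsq_ge0 w_gt0 e; rewrite -/V in V0 V1.
have f2 : 0 <= f N ^+ 2 by exact: sqr_ge0.
have := mulr_ge0 f2 V0; have := mulr_ge0 f2 V1.
have := mulr_ge0 K_ge0 (mulr_ge0 f2 V1); have := mulr_ge0 K_ge0 (mulr_ge0 f2 V0).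
lra.
Qed.

Let late_step N (z e s r : 'rV[R]_n) : (N0 <= N)%N ->
  V (z *m T N + f N *: e - s + r) <=
  (1 - k * f N) * V (z - s + r) + f N * (C1 * (V e + V (s - r))).
Proof.
move=> N0N; rewrite recentred; have /andP[f0 f1] := f01 N.
have kf0 : 0 < k * f N by rewrite mulr_gt0.
apply: (le_trans (wsqD_young w_gt0 _ _ kf0)); rewrite -/V.
have Vq := wsq_ge0 w_gt0 (z - s + r); rewrite -/V in Vq.
apply: lerD.
  have := T_contracts (z - s + r) N0N; rewrite -/V.
  set q := V (z - s + r) in Vq *.
  have k1 : 0 <= 1 + k * f N by lra.
  move=> /(ler_wpM2l k1) /le_trans; apply.
  have := mulr_ge0 (sqr_ge0 (k * f N)) Vq; lra.
have := perturbation N e (s - r).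
have k1 : 0 <= 1 + (k * f N)^-1 by rewrite addr_ge0// invr_ge0 ltW.
move=> /(ler_wpM2l k1) /le_trans; apply.
set W := V e + V (s - r).
have W0 : 0 <= W by rewrite addr_ge0// wsq_ge0.
have -> : (1 + (k * f N)^-1) * (2 * (1 + K) * f N ^+ 2 * W) =
   f N * (2 * (1 + K) * (f N + k^-1) * W) by field; rewrite !gt_eqF.
rewrite ler_pM2l// ler_wpM2r// /C1 ler_wpM2l ?lerD2r//.
by rewrite mulr_ge0// addr_ge0.
Qed.

Let any_step N (z e s r : 'rV[R]_n) :
  V (z *m T N + f N *: e - s + r) <=
  4 * (1 + K) * (V (z - s + r) + (V e + V (s - r))).
Proof.
have VT x : V (x *m T N) <= 2 * (1 + K) * V x.
  have -> : x *m T N = x + (x *m T N - x) by rewrite addrC subrK.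
  apply: (le_trans (wsqD w_gt0 _ _)); rewrite -/V.
  have := T_near_id N x; rewrite -/V.
  have /andP[f0 f1] := f01 N.
  have f2 : K * f N ^+ 2 <= K by rewrite ler_piMr// exprn_ile1// ltW.
  have := wsq_ge0 w_gt0 x; rewrite -/V => V0.
  have := ler_wpM2r V0 f2; lra.
rewrite recentred; apply: (le_trans (wsqD w_gt0 _ _)); rewrite -/V.
have := VT (z - s + r); have := perturbation N e (s - r).
have V0 := wsq_ge0 w_gt0 (s - r); have V1 := wsq_ge0 w_gt0 e.
have V2 := wsq_ge0 w_gt0 (z - s + r).
rewrite -/V in V0 V1 V2.
have /andP[f0 f1] := f01 N.
have f2 : 2 * (1 + K) * f N ^+ 2 <= 2 * (1 + K).
  by rewrite ler_piMr ?mulr_ge0 ?addr_ge0// exprn_ile1// ltW.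
have := ler_wpM2r (addr_ge0 V1 V0) f2; lra.
Qed.

Definition noise_sum zeta N : 'rV[R]_n := \sum_(i < N) zeta i.

Let recS z e zeta (r : 'rV[R]_n) : (forall N, z N.+1 = z N *m T N + f N *: e N + zeta N) ->
  forall N, z N.+1 - noise_sum zeta N.+1 + r =
    z N *m T N + f N *: e N - noise_sum zeta N + r.
Proof.
move=> zS N; rewrite zS /noise_sum big_ord_recr /= opprD.
by rewrite [- _ - _]addrC addrA addrK.
Qed.

(** The constant depends on [T] and [f] alone: for random inputs this bound is the
    source of integrable majorants. *)
Lemma vector_contraction_bound : exists2 C : R, 0 <= C & forall z e zeta M,
    (forall N, z N.+1 = z N *m T N + f N *: e N + zeta N) ->
    V (z 0) <= M -> (forall N, V (e N) <= M) ->
    (forall N, V (noise_sum zeta N) <= M) ->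
  forall N, V (z N) <= C * M.
Proof.
have [C C0 Cearly] : exists2 C : R, 0 <= C & forall z e zeta M,
    (forall N, z N.+1 = z N *m T N + f N *: e N + zeta N) ->
    V (z 0) <= M -> (forall N, V (e N) <= M) ->
    (forall N, V (noise_sum zeta N) <= M) ->
  forall N, (N <= N0)%N -> V (z N - noise_sum zeta N + 0) <= C * M.
  elim: {+}N0 => [|N1 [C C0 IH]].
    exists 1 => // z e zeta M zS z0M eM SM [|//] _.
    by rewrite /noise_sum big_ord0 subr0 addr0 mul1r.
  exists (C + 4 * (1 + K) * (C + 2)).
    by rewrite addr_ge0// mulr_ge0 ?mulr_ge0 ?addr_ge0.
  move=> z e zeta M zS z0M eM SM N.
  have M0 : 0 <= M by rewrite (le_trans _ z0M)// wsq_ge0.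
  have K4 : 0 <= 4 * (1 + K) by rewrite mulr_ge0 ?addr_ge0.
  rewrite leq_eqVlt => /orP[/eqP ->|].
    rewrite (recS _ zS); apply: (le_trans (any_step _ _ _ _ _)).
    rewrite [leRHS]mulrDl ler_wpDl ?mulr_ge0//.
    rewrite -[leRHS]mulrA; apply: ler_wpM2l => //.
    rewrite mulrDl; apply: lerD; first exact: (IH _ _ _ _ zS).
    by rewrite subr0 mulrDl mul1r lerD.
  rewrite ltnS => NN1; apply: (le_trans (IH _ _ _ _ zS z0M eM SM _ NN1)).
  by rewrite ler_wpM2r// lerDl mulr_ge0 ?addr_ge0.
have kM : 0 <= C1 * 2 / k by apply: divr_ge0; [apply: mulr_ge0 | exact: ltW].
exists (2 * (C + C1 * 2 / k) + 2); first lra.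
move=> z e zeta M zS z0M eM SM N.
have M0 : 0 <= M by rewrite (le_trans _ z0M)// wsq_ge0.
have E0 := Cearly _ _ _ _ zS z0M eM SM.
have bound : V (z N - noise_sum zeta N + 0) <= (C + C1 * 2 / k) * M.
  have [NN0|N0N] := leqP N N0.
    by apply: (le_trans (E0 _ NN0)); rewrite ler_wpM2r// lerDl.
  apply: (@le_trans _ _ (V (z N0 - noise_sum zeta N0 + 0) + (C1 * (2 * M)) / k)).
    apply: (@contraction_bound _ (fun N => V (z N - noise_sum zeta N + 0))
      f k _ N0 k_gt0) => //.
    - by move=> m Nm; rewrite kf_le1// andbT; have /andP[fm _] := f01 m; rewrite ltW// mulr_gt0.
    - by move=> m _; exact: wsq_ge0.
    - by rewrite mulr_ge0// mulr_ge0.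
    - move=> m Nm; rewrite (recS _ zS); apply: (le_trans (late_step _ _ _ _ Nm)).
      rewrite lerD2l; have /andP[fm _] := f01 m; rewrite ler_pM2l// ler_wpM2l//.
      by rewrite subr0 mulrDl mul1r lerD.
    - exact: ltnW.
  have := E0 N0 (leqnn _); lra.
have -> : z N = (z N - noise_sum zeta N + 0) + noise_sum zeta N.
  by rewrite addr0 subrK.
apply: (le_trans (wsqD w_gt0 _ _)); rewrite -/V.
have := SM N; lra.
Qed.

(** The noise sums need only converge, possibly conditionally: recentring [z] at
    the remainder of the noise leaves a forcing that tends to zero. *)
Lemma vector_contraction_cvg0 z e zeta (r : 'rV[R]_n) :
    (forall N, z N.+1 = z N *m T N + f N *: e N + zeta N) ->
    V (e N) @[N --> \oo] --> 0 ->
    (forall j, noise_sum zeta N 0 j @[N --> \oo] --> r 0 j) ->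
  forall j, z N 0 j @[N --> \oo] --> 0.
Proof.
move=> zS e0 Sr; apply/(wsq_cvg0P w_gt0).
have Sr0 : V (noise_sum zeta N - r) @[N --> \oo] --> 0.
  apply/(wsq_cvg0P w_gt0) => j; under eq_fun do rewrite !mxE.
  by rewrite -(subrr (r 0 j)); apply: cvgB => //; exact: cvg_cst.
have q0 : V (z N - noise_sum zeta N + r) @[N --> \oo] --> 0.
  apply: (@contraction_cvg0 _ _ (fun N => C1 * (V (e N) + V (noise_sum zeta N - r)))
    f k N0 k_gt0) => //.
  - by move=> m Nm; rewrite kf_le1// andbT; have /andP[fm _] := f01 m; rewrite ltW// mulr_gt0.
  - by move=> m _; exact: wsq_ge0.
  - by move=> m Nm; rewrite (recS _ zS); exact: late_step.
  - by rewrite -(mulr0 C1) -(addr0 0); apply: cvgMl_tmp; apply: cvgD.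
apply: (@wsq_cvg0_bound _ _ _ w_gt0 _ (fun N => 2 * V (z N - noise_sum zeta N + r) +
   2 * V (noise_sum zeta N - r))).
  move=> N; have {1}-> : z N = (z N - noise_sum zeta N + r) + (noise_sum zeta N - r).
    by rewrite addrACA subrr addr0 subrK.
  exact: wsqD.
by rewrite -(addr0 0) -{1 2}(mulr0 2); apply: cvgD; apply: cvgMl_tmp.
Qed.

End VectorContraction.

(** * Limits and bounds of row vectors *)

Section RowLimits.
Variable R : realType.

Lemma cvg_abs_bound (x : nat -> R) (l : R) : x N @[N --> \oo] --> l ->
  exists2 D, 0 <= D & forall N, `|x N| <= D.
Proof.
move=> xl; have /cvg_seq_bounded[D [_ DP]] : cvgn x by apply/cvg_ex; exists l.
have xD N : `|x N| <= D + 1 by apply: DP => //; rewrite ltrDl.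
by exists (D + 1) => //; exact: le_trans (normr_ge0 _) (xD 0%N).
Qed.

Definition row_cvg n (x : nat -> 'rV[R]_n) (l : 'rV[R]_n) : Prop :=
  forall j, x N 0 j @[N --> \oo] --> l 0 j.

Lemma row_cvgD n (x y : nat -> 'rV[R]_n) l m :
  row_cvg x l -> row_cvg y m -> row_cvg (fun N => x N + y N) (l + m).
Proof. by move=> xl ym j; rewrite mxE; under eq_fun do rewrite mxE; exact: cvgD. Qed.

Lemma row_cvgZ n (s : nat -> R) (x : nat -> 'rV[R]_n) (a : R) l :
  s N @[N --> \oo] --> a -> row_cvg x l ->
  row_cvg (fun N => s N *: x N) (a *: l).
Proof. by move=> sa xl j; rewrite mxE; under eq_fun do rewrite mxE; exact: cvgM. Qed.

Lemma row_cvg_cst n (l : 'rV[R]_n) : row_cvg (fun=> l) l.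
Proof. by move=> j; exact: cvg_cst. Qed.

Lemma row_cvg_mulmx n p (x : nat -> 'rV[R]_n) l (B : 'M[R]_(n, p)) :
  row_cvg x l -> row_cvg (fun N => x N *m B) (l *m B).
Proof.
move=> xl j; rewrite mxE; under eq_fun do rewrite mxE.
by apply: cvg_sumr => i _; apply: cvgMr_tmp.
Qed.

Lemma row_cvg_wsq n (w : 'I_n -> R) (x : nat -> 'rV[R]_n) l :
  (forall j, 0 < w j) -> row_cvg x l ->
  wsq w (x N - l) @[N --> \oo] --> 0.
Proof.
move=> w0 xl; apply/(wsq_cvg0P w0) => j; under eq_fun do rewrite !mxE.
by rewrite -(subrr (l 0 j)); apply: cvgB => //; exact: cvg_cst.
Qed.

Definition row_bound n (M : R) (x : 'rV[R]_n) : Prop := forall j, `|x 0 j| <= M.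

Lemma row_boundD n M M' (x y : 'rV[R]_n) :
  row_bound M x -> row_bound M' y -> row_bound (M + M') (x + y).
Proof. by move=> xM yM j; rewrite mxE (le_trans (ler_normD _ _))// lerD. Qed.

Lemma row_boundZ n s M (x : 'rV[R]_n) :
  row_bound M x -> row_bound (`|s| * M) (s *: x).
Proof. by move=> xM j; rewrite mxE normrM ler_wpM2l. Qed.

Lemma row_bound_le n M M' (x : 'rV[R]_n) :
  M <= M' -> row_bound M x -> row_bound M' x.
Proof. by move=> MM xM j; exact: le_trans MM. Qed.

Definition entry_sum n p (B : 'M[R]_(n, p)) : R := \sum_i \sum_j `|B i j|.

Lemma entry_sum_ge0 n p (B : 'M[R]_(n, p)) : 0 <= entry_sum B.
Proof. by apply: sumr_ge0 => i _; exact: sumr_ge0. Qed.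

Lemma row_bound_mulmx n p M (x : 'rV[R]_n) (B : 'M[R]_(n, p)) :
  0 <= M -> row_bound M x -> row_bound (entry_sum B * M) (x *m B).
Proof.
move=> M0 xM j; rewrite mxE (le_trans (ler_norm_sum _ _ _))//.
rewrite mulr_suml; apply: ler_sum => i _.
rewrite normrM mulrC; apply: ler_pM => //.
by rewrite (bigD1 j)//= lerDl sumr_ge0.
Qed.

Lemma row_bound_wsq n (w : 'I_n -> R) (C : R) : (forall j, 0 < w j) -> 0 <= C ->
  exists2 D, 0 <= D & forall (x : 'rV[R]_n) M, 0 <= M ->
    wsq w x <= C * M ^+ 2 -> row_bound (D * M) x.
Proof.
move=> w0 C0; exists (\sum_j Num.sqrt (C / w j)); first exact: sumr_ge0.
move=> x M M0 xM j.
apply: (@le_trans _ _ (Num.sqrt (C / w j) * M)); last first.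
  by rewrite ler_wpM2r// (bigD1 j)//= lerDl sumr_ge0.
rewrite -sqrtr_sqr -[X in _ <= _ * X]ger0_norm// -sqrtr_sqr -sqrtrM; last first.
  by rewrite divr_ge0// ltW.
rewrite ler_sqrt ?mulr_ge0 ?sqr_ge0 ?invr_ge0 ?(ltW (w0 _))//.
apply: (le_trans (wsq_coord w0 x j)).
by rewrite mulrAC ler_pM2r// invr_gt0.
Qed.

End RowLimits.

(** * Relaxation towards an equilibrium *)

Section Relaxation.
Variables (R : realType) (n : nat) (w : 'I_n -> R).
Hypothesis w_gt0 : forall j, 0 < w j.
Variables (B : 'M[R]_n) (c : R).
Hypothesis c_gt0 : 0 < c.
Hypothesis coercive : forall x, c * wsq w x <= wform w x B.

(** Dividing [x + step N *: (x *m Q)] by [1 + a * step N] leaves exactly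
    [x - damped a N *: (x *m (a%:M - Q))]. *)
Definition damped (a : R) N : R := step R N / (1 + a * step R N).

Variables (a : R) (b : nat).
Hypothesis a_ge0 : 0 <= a.

Implicit Types x : 'rV[R]_n.

Definition relax N : 'M[R]_n := harm_ratio R b N *: (1%:M - damped a N *: B).

Lemma damped_gt0 N : 0 < damped a N.
Proof. by rewrite divr_gt0 ?step_gt0 ?growth_factor_gt0. Qed.

Lemma damped_le_step N : damped a N <= step R N.
Proof.
rewrite ler_pdivrMr ?growth_factor_gt0// ler_peMr ?(ltW (step_gt0 _ _))//.
by rewrite lerDl mulr_ge0// ltW// step_gt0.
Qed.

Lemma step_le_damped N : step R N <= (1 + a) * damped a N.
Proof.
rewrite /damped mulrA ler_pdivlMr ?growth_factor_gt0// mulrC.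
by rewrite ler_pM2r ?step_gt0// lerD2l ler_piMr// step_le1.
Qed.

Lemma damped01 N : 0 < damped a N <= 1.
Proof. by rewrite damped_gt0 (le_trans (damped_le_step N))// step_le1. Qed.

Lemma cvg_damped : damped a N @[N --> \oo] --> 0.
Proof.
apply: (squeeze_cvgr _ (cvg_cst 0) (@cvg_step R)).
by apply: nearW => N; rewrite (ltW (damped_gt0 N)) damped_le_step.
Qed.

Lemma mulmx_relax N x : x *m relax N =
  harm_ratio R b N *: (x - damped a N *: (x *m B)).
Proof. by rewrite /relax -scalemxAr mulmxBr mulmx1 -scalemxAr. Qed.

Lemma harm_ratio_defect N :
  0 <= 1 - harm_ratio R b N <= b%:R * (1 + a) * (damped a N / harm R N).
Proof.
rewrite subr_ge0 harm_ratio_le1 /=.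
have := harm_ratio_ge R b N => h.
have : step R N / harm R N <= (1 + a) * (damped a N / harm R N).
  by rewrite mulrA ler_pM2r ?invr_gt0 ?harm_gt0// step_le_damped.
move=> /(ler_wpM2l (ler0n R b)); rewrite mulrA => h2; lra.
Qed.

(** The first order term [2 * d * wform w x B], with [d = damped a N], dominates
    the second order term [d ^+ 2 * wsq w (x *m B)] once [d] is small. *)
Lemma relax_contracts : exists N0, (forall N, (N0 <= N)%N -> c / 2 * damped a N <= 1) /\
  forall N x, (N0 <= N)%N ->
  wsq w (x *m relax N) <= (1 - 2 * (c / 2) * damped a N) * wsq w x.
Proof.
have [K K0 KP] := wsq_mulmx w_gt0 B.
pose e := c / (K + c ^+ 2 + 1).
have D0 : 0 < K + c ^+ 2 + 1 by have := sqr_ge0 c; lra.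
have e0 : 0 < e by rewrite divr_gt0.
have /cvgrPdist_le/(_ _ e0) [N0 _ N0P] := cvg_damped.
have small N : (N0 <= N)%N -> (K + c ^+ 2 + 1) * damped a N <= c.
  move=> /N0P; rewrite /= sub0r normrN gtr0_norm ?damped_gt0// /e.
  by rewrite ler_pdivlMr// mulrC.
exists N0; split=> [N /small h|N x /small h].
  have d0 := damped_gt0 N.
  have : c * (c * damped a N) <= c * 1.
    have := mulr_ge0 K0 (ltW d0); lra.
  rewrite ler_pM2l//; lra.
rewrite mulmx_relax wsqZ; have d0 := damped_gt0 N.
set d := damped a N in h d0 *.
have V0 := wsq_ge0 w_gt0 x.
apply: (@le_trans _ _ (wsq w (x - d *: (x *m B)))).
  rewrite ler_piMl ?wsq_ge0// exprn_ile1 ?harm_ratio_le1//.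
  by rewrite ltW// harm_ratio_gt0.
rewrite wsqB_scale.
have h1 : d * (c * wsq w x) <= d * wform w x B by rewrite ler_pM2l.
have h2 : d ^+ 2 * wsq w (x *m B) <= d ^+ 2 * (K * wsq w x).
  by rewrite ler_wpM2l ?sqr_ge0.
have h3 : K * d <= c by have := mulr_ge0 (sqr_ge0 c) (ltW d0); lra.
have : K * d * (d * wsq w x) <= c * (d * wsq w x).
  by rewrite ler_wpM2r// mulr_ge0// ltW.
lra.
Qed.

Lemma relax_near_id : exists2 K, 0 <= K & forall N x,
  wsq w (x *m relax N - x) <= K * damped a N ^+ 2 * wsq w x.
Proof.
have [K K0 KP] := wsq_mulmx w_gt0 B.
exists (2 * (b%:R * (1 + a)) ^+ 2 + 2 * K).
  by have := sqr_ge0 (b%:R * (1 + a)); lra.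
move=> N x; have -> : x *m relax N - x =
    (harm_ratio R b N - 1) *: x + (- (harm_ratio R b N * damped a N)) *: (x *m B).
  rewrite mulmx_relax; move: (x *m B) => y.
  by apply/rowP => j; rewrite !mxE; ring.
apply: (le_trans (wsqD w_gt0 _ _)); rewrite !wsqZ sqrrN.
have V0 := wsq_ge0 w_gt0 x.
have /andP[r0 r1] := harm_ratio_defect N.
have d0 := damped_gt0 N; set d := damped a N in r1 d0 *.
have h1 : (harm_ratio R b N - 1) ^+ 2 <= (b%:R * (1 + a) * d) ^+ 2.
  have ba0 : 0 <= b%:R * (1 + a) by rewrite mulr_ge0// addr_ge0.
  rewrite -sqrrN opprB lerXn2r ?nnegrE//; first by rewrite mulr_ge0// ltW.
  apply: (le_trans r1); rewrite ler_wpM2l//.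
  by rewrite ler_pdivrMr ?harm_gt0// ler_peMr ?harm_ge1// ltW.
have h2 : (harm_ratio R b N * d) ^+ 2 <= d ^+ 2.
  rewrite lerXn2r ?nnegrE ?(ltW d0)//.
    by rewrite mulr_ge0 ?(ltW d0)// ltW// harm_ratio_gt0.
  by rewrite ler_piMl ?(ltW d0)// harm_ratio_le1.
have h3 := KP x.
have h4 := ler_wpM2r V0 h1.
have h5 : (harm_ratio R b N * d) ^+ 2 * wsq w (x *m B) <= d ^+ 2 * (K * wsq w x).
  by apply: ler_pM => //; rewrite ?sqr_ge0 ?wsq_ge0.
lra.
Qed.

Implicit Types (y G zeta : nat -> 'rV[R]_n).

Definition relaxation y G zeta := forall N,
  y N.+1 = harm_ratio R b N *: (y N - damped a N *: (y N *m B) + damped a N *: G N)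
           + zeta N.

Lemma relaxation_bound : exists2 C : R, 0 <= C & forall y G zeta M, 0 <= M ->
    relaxation y G zeta -> row_bound M (y 0) -> (forall N, row_bound M (G N)) ->
    (forall N, row_bound M (noise_sum zeta N)) ->
  forall N, row_bound (C * M) (y N).
Proof.
have [N0 [N0k N0P]] := relax_contracts.
have [K K0 KP] := relax_near_id.
have c20 : 0 < c / 2 by rewrite divr_gt0.
have [C C0 CP] := vector_contraction_bound w_gt0 c20 K0 damped01 N0k N0P KP.
pose W := \sum_j w j.
have W0 : 0 <= W by apply: sumr_ge0 => j _; exact: ltW.
have [D D0 DP] := row_bound_wsq w_gt0 (mulr_ge0 C0 W0).
exists D => // y G zeta M M0 yS y0M GM SM N; apply: DP => //.
rewrite -mulrA; apply: (CP y (fun N => harm_ratio R b N *: G N) zeta).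
- move=> m; rewrite yS mulmx_relax; congr (_ + _).
  by rewrite scalerDr !scalerA [X in X *: G m]mulrC.
- exact: wsq_le_sup.
- move=> m; rewrite wsqZ; apply: (@le_trans _ _ (wsq w (G m))).
    rewrite ler_piMl ?wsq_ge0// exprn_ile1 ?harm_ratio_le1//.
    by rewrite ltW// harm_ratio_gt0.
  exact: (wsq_le_sup w_gt0 (GM m)).
- by move=> m; exact: (wsq_le_sup w_gt0 (SM m)).
Qed.

(** The limit is the equilibrium of the forcing: the difference [y - L] solves the
    same recursion with the forcing [G - L *m B], which tends to zero, and a
    correction due to [harm_ratio], which is small compared with the step. *)
Lemma relaxation_cvg y G zeta (L r : 'rV[R]_n) :
    relaxation y G zeta -> row_cvg G (L *m B) ->
    row_cvg (noise_sum zeta) r ->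
  row_cvg y L.
Proof.
move=> yS GL Sr.
have [N0 [N0k N0P]] := relax_contracts.
have [K K0 KP] := relax_near_id.
have c20 : 0 < c / 2 by rewrite divr_gt0.
pose q N := (harm_ratio R b N - 1) / damped a N.
pose z N := y N - L.
pose e N := q N *: L + harm_ratio R b N *: (G N - L *m B).
have zS N : z N.+1 = z N *m relax N + damped a N *: e N + zeta N.
  rewrite /z /e yS mulmx_relax /q mulmxBl.
  have d0 : damped a N != 0 by rewrite gt_eqF// damped_gt0.
  move: (y N *m B) (L *m B) => yB LB.
  by apply/rowP => j; rewrite !mxE; field.
suff z0 : forall j, z N 0 j @[N --> \oo] --> 0.
  move=> j; rewrite -[L 0 j]add0r.
  have -> : (fun N => y N 0 j) = (fun N => z N 0 j + L 0 j).
    by apply/funext => N; rewrite /z !mxE subrK.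
  by apply: cvgD => //; exact: cvg_cst.
apply: (vector_contraction_cvg0 w_gt0 c20 K0 damped01 N0k N0P KP _ zS _ Sr).
  exact: cvg_sum_damped_step.
have q0 : q N @[N --> \oo] --> 0.
  have h : b%:R * (1 + a) * (harm R N)^-1 @[N --> \oo] --> 0.
    by rewrite -(mulr0 (b%:R * (1 + a))); apply: cvgMl_tmp; exact: cvg_harmV.
  apply: norm_cvg0; apply: (squeeze_cvgr _ (cvg_cst 0) h).
  apply: nearW => N; rewrite normr_ge0 /= /q normrM normfV.
  have /andP[r0 r1] := harm_ratio_defect N.
  have d0 := damped_gt0 N.
  rewrite distrC ger0_norm// gtr0_norm// ler_pdivrMr//.
  by apply: (le_trans r1); rewrite [damped a N / _]mulrC !mulrA.
apply: (@wsq_cvg0_bound _ _ _ w_gt0 _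
  (fun N => 2 * (q N ^+ 2 * wsq w L) + 2 * wsq w (G N - L *m B))).
  move=> N; apply: (le_trans (wsqD w_gt0 _ _)); rewrite !wsqZ lerD2l ler_pM2l//.
  rewrite ler_piMl ?wsq_ge0// exprn_ile1 ?harm_ratio_le1//.
  by rewrite ltW// harm_ratio_gt0.
rewrite -[0]addr0 -{1 2}(mulr0 2); apply: cvgD; apply: cvgMl_tmp.
  rewrite -(mul0r (wsq w L)); apply: cvgMr_tmp.
  by rewrite -(mulr0 0); exact: cvgM.
exact: row_cvg_wsq.
Qed.

End Relaxation.

(** * Dynamics of one block *)

Section Block.
Variables (R : realType) (n : nat) (Q : 'M[R]_n) (mu : R).
Variables (u : 'cV[R]_n) (v : 'rV[R]_n).

(** For [x j = v j * f j] the weighted square of [x] is [\sum_j u j * v j * f j ^+ 2].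
    If [mu > 0] this is the square norm of [f] under the invariant law of the
    Markov chain with transition probabilities [Q i j * u j / (mu * u i)]. *)
Definition perron_weight j : R := u j 0 / v 0 j.

(** What the dynamics needs to know of a diagonal block.  Both the irreducible
    blocks and the zero block of size one have such a pair, so the dynamics does
    not distinguish them. *)
Record perron_pair : Prop := PerronPair {
  perron_u_gt0 : forall j, 0 < u j 0;
  perron_v_gt0 : forall j, 0 < v 0 j;
  perron_right : Q *m u = mu *: u;
  perron_left : v *m Q = mu *: v;
  perron_vu : v *m u = 1%:M;
  perron_dissipative : forall x, 0 <= wform perron_weight x (mu%:M - Q);
  perron_gap : exists2 C, 0 <= C & forall x, wsq perron_weight x <=
    C * wform perron_weight x (mu%:M - Q) + ((x *m u) 0 0) ^+ 2 }.

Hypothesis PQ : perron_pair.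
Hypothesis mu_ge0 : 0 <= mu.

Let w := perron_weight.
Let w_gt0 j : 0 < w j.
Proof. by rewrite divr_gt0 ?(perron_u_gt0 PQ) ?(perron_v_gt0 PQ). Qed.

Lemma wformD x (B B' : 'M[R]_n) : wform w x (B + B') = wform w x B + wform w x B'.
Proof.
rewrite /wform -big_split /=; apply: eq_bigr => j _.
by rewrite mulmxDr mxE; ring.
Qed.

Lemma wform_scalar x (a : R) : wform w x a%:M = a * wsq w x.
Proof.
rewrite /wform /wsq mulr_sumr; apply: eq_bigr => j _.
by rewrite mul_mx_scalar mxE; ring.
Qed.

Lemma wform_proj x : wform w x (u *m v) = ((x *m u) 0 0) ^+ 2.
Proof.
rewrite /wform expr2 {2}mxE mulr_sumr; apply: eq_bigr => j _.
rewrite mulmxA; set t := x *m u; rewrite [(t *m v) 0 j]mxE big_ord1 /w /perron_weight.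
by have := perron_v_gt0 PQ j => v0; field; rewrite gt_eqF.
Qed.

Let Bt := mu%:M - Q + u *m v.

(** Adding [u *m v] repairs the degenerate direction of [mu%:M - Q], and does not
    change the image of the rows [x] such that [x *m u = 0]. *)
Lemma block_coercive : exists2 c, 0 < c & forall x, c * wsq w x <= wform w x Bt.
Proof.
have [C C0 CP] := perron_gap PQ.
exists (C + 1)^-1; first by rewrite invr_gt0 ltr_wpDl.
move=> x; rewrite mulrC ler_pdivrMr ?ltr_wpDl//.
apply: (le_trans (CP x)); rewrite /Bt wformD wform_proj.
have := perron_dissipative PQ x; have := sqr_ge0 ((x *m u) 0 0).
set q := _ ^+ 2; rewrite -/w; set E := wform _ _ _ => q0 E0.
have := mulr_ge0 C0 q0; lra.
Qed.

Implicit Types (x g xi : nat -> 'rV[R]_n) (a : R) (b : nat).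

Definition block_rec x g xi := forall N,
  x N.+1 = x N + step R N *: (x N *m Q + g N) + xi N.

Definition normed a b x N : 'rV[R]_n := (norming a b N)^-1 *: x N.

Definition normed_noise a b xi N : 'rV[R]_n := (norming a b N.+1)^-1 *: xi N.

Lemma normed_rec a b x g xi : 0 <= a -> block_rec x g xi ->
  relaxation (a%:M - Q) a b (normed a b x) (normed a b g) (normed_noise a b xi).
Proof.
move=> a0 xS N; rewrite {1}/normed xS scalerDr; congr (_ + _).
rewrite /normed normingS// -scalemxAl mulmxBr mul_mx_scalar.
have n0 : norming a b N != 0 by rewrite gt_eqF// norming_gt0.
have r0 : harm_ratio R b N != 0 by rewrite gt_eqF// harm_ratio_gt0.
have s0 : 1 + a * step R N != 0 by rewrite gt_eqF// growth_factor_gt0.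
move: (x N *m Q) => xQ; apply/rowP => j; rewrite !mxE /damped.
by field; rewrite n0 r0 s0.
Qed.

Lemma normed0 a b x : normed a b x 0 = x 0.
Proof. by rewrite /normed norming0 invr1 scale1r. Qed.

(** A block whose inflow grows at rate [a > mu] is driven by it: it follows
    the equilibrium [G (a - Q)^-1] of the normalised inflow [G]. *)
Lemma block_driven_bound a b : mu < a -> exists2 C : R, 0 <= C &
  forall x g xi M, 0 <= M -> block_rec x g xi -> row_bound M (x 0) ->
    (forall N, row_bound M (normed a b g N)) ->
    (forall N, row_bound M (noise_sum (normed_noise a b xi) N)) ->
  forall N, row_bound (C * M) (normed a b x N).
Proof.
move=> mua; have a0 : 0 <= a by exact: le_trans mu_ge0 (ltW mua).
have am : 0 < a - mu by rewrite subr_gt0.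
have co y : (a - mu) * wsq w y <= wform w y (a%:M - Q).
  have -> : a%:M - Q = (a - mu)%:M + (mu%:M - Q).
    by rewrite raddfB /= addrA subrK.
  by rewrite wformD wform_scalar lerDl perron_dissipative.
have [C C0 CP] := relaxation_bound w_gt0 am co b a0.
exists C => // x g xi M M0 xS x0M gM SM; apply: CP SM => //.
- exact: normed_rec.
- by rewrite normed0.
Qed.

Lemma block_driven_cvg a b x g xi G r : mu < a -> block_rec x g xi ->
    row_cvg (normed a b g) G -> row_cvg (noise_sum (normed_noise a b xi)) r ->
  exists l, row_cvg (normed a b x) l.
Proof.
move=> mua xS gG Sr; have a0 : 0 <= a by exact: le_trans mu_ge0 (ltW mua).
have am : 0 < a - mu by rewrite subr_gt0.
have co y : (a - mu) * wsq w y <= wform w y (a%:M - Q).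
  have -> : a%:M - Q = (a - mu)%:M + (mu%:M - Q).
    by rewrite raddfB /= addrA subrK.
  by rewrite wformD wform_scalar lerDl perron_dissipative.
have uB : a%:M - Q \in unitmx.
  rewrite -row_free_unit -kermx_eq0; apply/eqP/row_matrixP => i.
  rewrite row0; set y := row i _.
  have yB : y *m (a%:M - Q) = 0 by rewrite /y -row_mul mulmx_ker row0.
  have : wsq w y <= 0.
    have := co y; rewrite /wform yB big1 => [|j _]; last by rewrite mxE mulr0 mul0r.
    by rewrite pmulr_rle0.
  move=> y0; apply/rowP => j; rewrite [RHS]mxE; apply/eqP.
  rewrite -sqrf_eq0 eq_le sqr_ge0 andbT (le_trans (wsq_coord w_gt0 y j))//.
  by rewrite pmulr_lle0// invr_gt0.
exists (G *m invmx (a%:M - Q)).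
apply: (relaxation_cvg w_gt0 am co a0 (normed_rec b a0 xS) _ Sr).
by rewrite mulmxKV.
Qed.

(* At the norming rate [mu] the normalised block splits into its component along
   [v], measured by [mass], and the component [proj], which is contracted. *)
Let proj x N : 'rV[R]_n := x N *m (1%:M - u *m v).

Let Q_proj : (mu%:M - Q) *m (1%:M - u *m v) = mu%:M - Q.
Proof.
rewrite mulmxBr mulmx1 mulmxA mulmxBl (perron_right PQ) mul_scalar_mx.
by rewrite subrr mul0mx subr0.
Qed.

Let proj_Bt : (1%:M - u *m v) *m Bt = mu%:M - Q.
Proof.
rewrite /Bt mulmxBl mul1mx mulmxDr mulmxBr -!mulmxA (perron_left PQ).
rewrite mul_mx_scalar -scalemxAr subrr add0r [v *m _]mulmxA (perron_vu PQ).
by rewrite mul1mx addrK.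
Qed.

Let noise_sumM p (zeta : nat -> 'rV[R]_n) (B : 'M[R]_(n, p)) :
  noise_sum (fun N => zeta N *m B) = fun N => noise_sum zeta N *m B.
Proof. by apply/funext => N; rewrite /noise_sum mulmx_suml. Qed.

Let proj_rec b x g xi : block_rec x g xi ->
  relaxation Bt mu b (proj (normed mu b x)) (proj (normed mu b g))
    (proj (normed_noise mu b xi)).
Proof.
move=> xS N; rewrite {1}/proj (normed_rec b mu_ge0 xS) mulmxDl; congr (_ + _).
rewrite -scalemxAl mulmxDl mulmxBl -!scalemxAl /proj -!mulmxA Q_proj.
by rewrite proj_Bt /normed -!scalemxAl.
Qed.

Let proj_bound b : exists2 C : R, 0 <= C &
  forall x g xi M, 0 <= M -> block_rec x g xi -> row_bound M (x 0) ->
    (forall N, row_bound M (normed mu b g N)) ->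
    (forall N, row_bound M (noise_sum (normed_noise mu b xi) N)) ->
  forall N, row_bound (C * M) (proj (normed mu b x) N).
Proof.
have [c c0 co] := block_coercive.
have [C C0 CP] := relaxation_bound w_gt0 c0 co b mu_ge0.
pose D := entry_sum (1%:M - u *m v).
have D0 : 0 <= D by exact: entry_sum_ge0.
exists (C * D); first exact: mulr_ge0.
move=> x g xi M M0 xS x0M gM SM N; rewrite -mulrA.
apply: (CP _ _ _ (D * M) (mulr_ge0 D0 M0) (proj_rec b xS)).
- by rewrite /proj normed0; exact: row_bound_mulmx.
- by move=> m; exact: row_bound_mulmx.
- by move=> m; rewrite noise_sumM; exact: row_bound_mulmx.
Qed.

Let proj_cvg b x g xi r : block_rec x g xi ->
    row_cvg (normed mu b g) 0 -> row_cvg (noise_sum (normed_noise mu b xi)) r ->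
  row_cvg (proj (normed mu b x)) 0.
Proof.
move=> xS g0 Sr; have [c c0 co] := block_coercive.
apply: (@relaxation_cvg _ _ _ w_gt0 _ _ c0 co _ b mu_ge0 _ _ _ _
  (r *m (1%:M - u *m v)) (proj_rec b xS)).
  by rewrite mul0mx -(mul0mx _ (1%:M - u *m v)); exact: row_cvg_mulmx.
by rewrite noise_sumM; exact: row_cvg_mulmx.
Qed.

Let mass b x N : 'rV[R]_1 := normed mu b x N *m u.

Let mass_rec b x g xi : block_rec x g xi -> forall N,
  mass b x N.+1 = harm_ratio R b N *:
    (mass b x N + damped mu N *: (normed mu b g N *m u))
    + normed_noise mu b xi N *m u.
Proof.
have Qu : (mu%:M - Q) *m u = 0.
  by rewrite mulmxBl (perron_right PQ) mul_scalar_mx subrr.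
move=> xS N; rewrite /mass (normed_rec b mu_ge0 xS) mulmxDl; congr (_ + _).
rewrite -scalemxAl mulmxDl mulmxBl /normed -!scalemxAl -!mulmxA Qu.
by rewrite mulmx0 !scaler0 subr0.
Qed.

Let normed_split b x N :
  normed mu b x N = mass b x N *m v + proj (normed mu b x) N.
Proof. by rewrite /proj /mass mulmxBr mulmx1 mulmxA addrC subrK. Qed.

Let split_bound b C D x M : 0 <= M -> 0 <= D ->
    (forall N, row_bound (D * M) (mass b x N)) ->
    (forall N, row_bound (C * M) (proj (normed mu b x) N)) ->
  forall N, row_bound ((entry_sum v * D + C) * M) (normed mu b x N).
Proof.
move=> M0 D0 xm xp N; rewrite normed_split mulrDl -mulrA.
by apply: row_boundD => //; apply: row_bound_mulmx => //; exact: mulr_ge0.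
Qed.

Let split_cvg b x l : row_cvg (mass b x) l -> row_cvg (proj (normed mu b x)) 0 ->
  row_cvg (normed mu b x) (l *m v + 0).
Proof.
move=> xm xp; rewrite (_ : normed _ _ _ = fun N => mass b x N *m v + proj (normed mu b x) N).
  by apply: row_cvgD => //; exact: row_cvg_mulmx.
by apply/funext => N; exact: normed_split.
Qed.

Lemma normedS b x N : normed mu b.+1 x N = (harm R N)^-1 *: normed mu b x N.
Proof.
by rewrite /normed scalerA /norming exprSr mulrA [in LHS]invfM mulrC.
Qed.

(** When the inflow is summable on the scale of the block, the Perron mass
    [x u] is a convergent series and everything else is damped. *)
Section Autonomous.
Variables (r : nat -> R) (Cr : R).
Hypotheses (r_ge0 : forall N, 0 <= r N) (r_cvg : r N @[N --> \oo] --> 0).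
Hypothesis r_sum : forall m, \sum_(N < m) step R N * r N <= Cr.

Let Cr_ge0 : 0 <= Cr.
Proof. by have := r_sum 0; rewrite big_ord0. Qed.

Let mass_sum x g xi : block_rec x g xi -> forall N, mass 0 x N =
  x 0%N *m u + (\sum_(i < N) damped mu i *: (normed mu 0 g i *m u)
              + noise_sum (normed_noise mu 0 xi) N *m u).
Proof.
move=> xS; elim=> [|N IH].
  by rewrite /mass normed0 /noise_sum !big_ord0 mul0mx !addr0.
rewrite (mass_rec 0 xS) /harm_ratio expr0 scale1r IH /noise_sum !big_ord_recr /=.
by rewrite mulmxDl -!addrA; congr (_ + (_ + _)); rewrite addrCA.
Qed.

Let damped_le N : `|damped mu N| <= step R N.
Proof. by rewrite ger0_norm ?damped_le_step// ltW// damped_gt0. Qed.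

Let r_le : exists2 D, 0 <= D & forall N, r N <= D.
Proof.
have [D D0 DP] := cvg_abs_bound r_cvg.
by exists D => // N; exact: le_trans (ler_norm _) (DP N).
Qed.

Lemma block_autonomous_bound : exists2 C : R, 0 <= C &
  forall x g xi M, 0 <= M -> block_rec x g xi -> row_bound M (x 0) ->
    (forall N, row_bound (M * r N) (normed mu 0 g N)) ->
    (forall N, row_bound M (noise_sum (normed_noise mu 0 xi) N)) ->
  forall N, row_bound (C * M) (normed mu 0 x N).
Proof.
have [C C0 CP] := proj_bound 0; have [E E0 EP] := r_le.
pose D := entry_sum u.
have D0 : 0 <= D by exact: entry_sum_ge0.
have DC0 : 0 <= D * (1 + (Cr + 1)).
  by rewrite mulr_ge0// addr_ge0// addr_ge0.
exists (entry_sum v * (D * (1 + (Cr + 1))) + C * (1 + E)).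
  by rewrite addr_ge0 ?mulr_ge0 ?entry_sum_ge0 ?addr_ge0.
move=> x g xi M M0 xS x0M gM SM; apply: split_bound => // N.
  rewrite (mass_sum xS) -mulrA !mulrDl !mul1r !mulrDr.
  apply: row_boundD; first exact: row_bound_mulmx.
  apply: row_boundD; last exact: row_bound_mulmx.
  move=> j; rewrite summxE (le_trans (ler_norm_sum _ _ _))//.
  rewrite [Cr * M]mulrC mulrA.
  apply: (@le_trans _ _ (D * M * \sum_(i < N) step R i * r i)); last first.
    by rewrite ler_wpM2l// mulr_ge0.
  rewrite mulr_sumr; apply: ler_sum => i _; rewrite mxE normrM mulrCA.
  apply: ler_pM => //; rewrite -mulrA.
  by apply: row_bound_mulmx; rewrite ?mulr_ge0.
rewrite -mulrA; apply: (CP x g xi) => //.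
- by rewrite mulr_ge0// addr_ge0.
- by apply: row_bound_le x0M; rewrite ler_peMl// lerDl.
- move=> m; apply: row_bound_le (gM m); rewrite mulrC ler_wpM2r//.
  by rewrite (le_trans (EP m))// lerDr.
- by move=> m; apply: row_bound_le (SM m); rewrite ler_peMl// lerDl.
Qed.

Lemma block_autonomous_cvg x g xi M s : 0 <= M -> block_rec x g xi ->
    (forall N, row_bound (M * r N) (normed mu 0 g N)) ->
    row_cvg (noise_sum (normed_noise mu 0 xi)) s ->
  exists l, row_cvg (normed mu 0 x) l.
Proof.
move=> M0 xS gM Ss; pose D := entry_sum u.
have D0 : 0 <= D by exact: entry_sum_ge0.
pose f i : 'rV[R]_1 := damped mu i *: (normed mu 0 g i *m u).
have f_cvg : exists l : 'rV[R]_1, row_cvg (fun N => \sum_(i < N) f i) l.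
  have /cvg_ex[l lP] : cvgn (series (fun i => f i 0 0)).
    apply: normed_cvg; apply: nondecreasing_is_cvgn.
      by apply: nondecreasing_series => i _ _; exact: normr_ge0.
    exists (D * M * Cr) => _ [m _ <-]. rewrite /normed_series_of seriesEord /=.
    apply: (@le_trans _ _ (D * M * \sum_(i < m) step R i * r i)); last first.
      by rewrite ler_wpM2l// mulr_ge0.
    rewrite mulr_sumr; apply: ler_sum => i _; rewrite /f mxE normrM mulrCA.
    apply: ler_pM => //; rewrite -mulrA.
    by apply: row_bound_mulmx; rewrite ?mulr_ge0.
  exists (const_mx l) => j; rewrite mxE ord1.
  under eq_fun do rewrite summxE -(big_mkord xpredT (fun i => f i 0 0)).
  exact: lP.
have [l lP] := f_cvg.
eexists; apply: (@split_cvg 0 x (x 0%N *m u + (l + s *m u))).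
  rewrite (_ : mass 0 x = fun N => x 0%N *m u + (\sum_(i < N) f i
              + noise_sum (normed_noise mu 0 xi) N *m u)); last first.
    by apply/funext => N; exact: mass_sum.
  apply: row_cvgD; first exact: row_cvg_cst.
  by apply: row_cvgD => //; exact: row_cvg_mulmx.
apply: (proj_cvg xS _ Ss) => j; rewrite mxE; apply: norm_cvg0.
have h : M * r N @[N --> \oo] --> 0 by rewrite -(mulr0 M); apply: cvgMl_tmp.
apply: (squeeze_cvgr _ (cvg_cst 0) h).
by apply: nearW => N; rewrite normr_ge0 /= gM.
Qed.

End Autonomous.

(** The derivative of [- (1 + h) ^- b] at zero. *)
Lemma harm_ratio_slope b :
  (1 - harm_ratio R b N) / (step R N / harm R N) @[N --> \oo] --> (b%:R : R).
Proof.
have q1 : harm R N / harm R N.+1 @[N --> \oo] --> (1 : R).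
  have h : 1 - step R N / harm R N @[N --> \oo] --> (1 : R).
    by rewrite -[X in _ --> X]subr0; apply: cvgB; [exact: cvg_cst | exact: cvg_log_step].
  apply: (squeeze_cvgr _ h (cvg_cst (1 : R))); apply: nearW => N.
  have := harm_ratio_ge R 1 N; have := harm_ratio_le1 R 1 N.
  by rewrite /harm_ratio expr1 mul1r => -> ->.
elim: b => [|b IH].
  rewrite (_ : (fun N => _) = fun=> 0); first exact: cvg_cst.
  by apply/funext => N; rewrite /harm_ratio expr0 subrr mul0r.
rewrite (_ : (fun N => _) = fun N => (1 - harm_ratio R b N) / (step R N / harm R N) +
    (harm R N / harm R N.+1) ^+ b * (harm R N / harm R N.+1)); last first.
  apply/funext => N; have s0 := step_gt0 R N; have H0 := harm_gt0 R N.
  have H1 := harm_gt0 R N.+1; rewrite /harm_ratio exprSr.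
  set q := (_ / _) ^+ b; rewrite harmS in H1 *.
  by field; rewrite !gt_eqF.
rewrite -natr1; apply: cvgD => //; rewrite -[X in _ --> X]mulr1 -[X in X * _](expr1n _ b).
apply: cvgM => //.
elim: b {IH} => [|b IH]; first exact: cvg_cst.
by under eq_fun do rewrite exprS; rewrite exprS; exact: cvgM.
Qed.

(** At resonance, inflow of the order of the block's own growth is amplified by
    one logarithm: the Perron mass solves a scalar relaxation in the time scale
    of [step N / harm N]. *)
Section Resonant.
Variable b : nat.

Let f N : R := step R N / harm R N.
Let w1 (j : 'I_1) : R := 1.
Let T N : 'M[R]_1 := (harm_ratio R b.+1 N)%:M.

Let w1_gt0 j : 0 < w1 j. Proof. exact: ltr01. Qed.

Let f01 N : 0 < f N <= 1.
Proof.
rewrite divr_gt0 ?step_gt0 ?harm_gt0//= ler_pdivrMr ?harm_gt0// mul1r.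
exact: le_trans (step_le1 _ _) (harm_ge1 _ _).
Qed.

Let kf_le1 N : (0 <= N)%N -> 1 / 4 * f N <= 1.
Proof. by move=> _; have /andP[f0 f1] := f01 N; lra. Qed.

Let T_contracts N (x : 'rV[R]_1) : (0 <= N)%N ->
  wsq w1 (x *m T N) <= (1 - 2 * (1 / 4) * f N) * wsq w1 x.
Proof.
move=> _; rewrite mul_mx_scalar wsqZ ler_wpM2r ?wsq_ge0//.
have /andP[f0 f1] := f01 N.
have r0 := harm_ratio_gt0 R b N; have r1 := harm_ratio_le1 R b N.
have -> : harm_ratio R b.+1 N = harm_ratio R b N / (1 + f N).
  rewrite {1}/harm_ratio exprSr -/(harm_ratio R b N); congr (_ * _).
  rewrite harmS /f; have H0 := harm_gt0 R N; have s0 := step_gt0 R N.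
  have Hs : 0 < harm R N + step R N by exact: addr_gt0.
  by field; rewrite !gt_eqF.
set q := harm_ratio R b N / _; have f10 : 0 < 1 + f N by lra.
have q0 : 0 <= q by rewrite divr_ge0// ltW.
have q1 : q <= 1 - f N / 2.
  rewrite /q ler_pdivrMr//; apply: (le_trans r1).
  have g0 : 0 <= 1 - f N by lra.
  have := mulr_ge0 (ltW f0) g0; lra.
have : q * q <= q * 1 by rewrite ler_wpM2l//; lra.
rewrite expr2; lra.
Qed.

Let T_near_id N (x : 'rV[R]_1) :
  wsq w1 (x *m T N - x) <= b.+1%:R ^+ 2 * f N ^+ 2 * wsq w1 x.
Proof.
rewrite mul_mx_scalar -{2}(scale1r x) -scalerBl wsqZ -exprMn.
rewrite ler_wpM2r ?wsq_ge0// -sqrrN opprB.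
have := harm_ratio_le1 R b.+1 N; have := harm_ratio_ge R b.+1 N; rewrite -/(f N).
have /andP[f0 f1] := f01 N => h1 h2.
rewrite lerXn2r ?nnegrE ?subr_ge0//; first by rewrite mulr_ge0// ltW.
lra.
Qed.

Let k0 : 0 < 1 / 4 :> R. Proof. by lra. Qed.

Let mass_recS x g xi (L : 'rV[R]_1) : block_rec x g xi -> forall N,
  mass b.+1 x N.+1 - L = (mass b.+1 x N - L) *m T N +
   f N *: (((harm_ratio R b.+1 N - 1) / f N) *: L +
           (harm_ratio R b.+1 N / (1 + mu * step R N)) *: (normed mu b g N *m u))
   + normed_noise mu b.+1 xi N *m u.
Proof.
move=> xS N; rewrite (mass_rec _ xS) mul_mx_scalar normedS -scalemxAl.
move: (normed mu b g N *m u) (normed_noise _ _ _ _ *m u) => G z.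
have f0 : f N != 0 by have /andP[f0 _] := f01 N; rewrite gt_eqF.
have H0 : harm R N != 0 by rewrite gt_eqF// harm_gt0.
have s0 : step R N != 0 by rewrite gt_eqF// step_gt0.
have d0 : 1 + mu * step R N != 0 by rewrite gt_eqF// growth_factor_gt0.
apply/rowP => j; rewrite !mxE /damped; rewrite /f in f0 *.
by field; rewrite d0 H0 s0.
Qed.

Let coef_le N : `|harm_ratio R b.+1 N / (1 + mu * step R N)| <= 1.
Proof.
have d0 := growth_factor_gt0 N mu_ge0.
rewrite ger0_norm; last by rewrite divr_ge0 ?(ltW d0)// ltW// harm_ratio_gt0.
rewrite ler_pdivrMr// mul1r (le_trans (harm_ratio_le1 _ _ _))// lerDl mulr_ge0//.
by rewrite ltW// step_gt0.
Qed.

Lemma block_resonant_bound : exists2 C : R, 0 <= C &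
  forall x g xi M, 0 <= M -> block_rec x g xi -> row_bound M (x 0) ->
    (forall N, row_bound M (normed mu b g N)) ->
    (forall N, row_bound M (noise_sum (normed_noise mu b.+1 xi) N)) ->
  forall N, row_bound (C * M) (normed mu b.+1 x N).
Proof.
have K0 : 0 <= (b.+1%:R : R) ^+ 2 by exact: sqr_ge0.
have [C C0 CP] := vector_contraction_bound w1_gt0 k0 K0 f01 kf_le1 T_contracts T_near_id.
have [C' C'0 C'P] := proj_bound b.+1.
pose W : R := \sum_j w1 j; pose U := entry_sum u.
have W0 : 0 <= W by rewrite sumr_ge0// => j _; exact: ltW.
have U0 : 0 <= U by exact: entry_sum_ge0.
have [D D0 DP] := row_bound_wsq w1_gt0 (mulr_ge0 C0 W0).
exists (entry_sum v * (D * U) + C').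
  by rewrite addr_ge0 ?mulr_ge0 ?entry_sum_ge0// mulr_ge0.
move=> x g xi M M0 xS x0M gM SM; apply: split_bound => //.
- exact: mulr_ge0.
- move=> N; rewrite -mulrA; apply: DP; first exact: mulr_ge0.
  rewrite -mulrA; apply: (CP (mass b.+1 x)
    (fun m => (harm_ratio R b.+1 m / (1 + mu * step R m)) *: (normed mu b g m *m u))
    (fun m => normed_noise mu b.+1 xi m *m u) (W * (U * M) ^+ 2)).
  + by move=> m; have := mass_recS 0 xS m; rewrite scaler0 add0r !subr0.
  + by apply: wsq_le_sup => //; rewrite /mass normed0; exact: row_bound_mulmx.
  + move=> m; apply: wsq_le_sup => //.
    apply: (@row_bound_le _ _ (`|harm_ratio R b.+1 m / (1 + mu * step R m)| * (U * M))).
      by rewrite ler_piMl ?coef_le// mulr_ge0.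
    by apply: row_boundZ; exact: row_bound_mulmx.
  + move=> m; apply: wsq_le_sup => //; rewrite noise_sumM.
    exact: row_bound_mulmx.
- apply: (C'P x g xi) => // N; rewrite normedS.
  apply: (@row_bound_le _ _ (`|(harm R N)^-1| * M)); last exact: row_boundZ.
  rewrite ler_piMl// ger0_norm ?invr_ge0 ?(ltW (harm_gt0 _ _))//.
  by rewrite invf_le1 ?harm_gt0// harm_ge1.
Qed.

Lemma block_resonant_cvg x g xi G r : block_rec x g xi ->
    row_cvg (normed mu b g) G -> row_cvg (noise_sum (normed_noise mu b.+1 xi)) r ->
  exists l, row_cvg (normed mu b.+1 x) l.
Proof.
move=> xS gG Sr.
have K0 : 0 <= (b.+1%:R : R) ^+ 2 by exact: sqr_ge0.
pose L : 'rV[R]_1 := b.+1%:R^-1 *: (G *m u).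
exists (L *m v + 0); apply: split_cvg; last first.
  apply: (proj_cvg xS _ Sr).
  rewrite -(scale0r G); rewrite (_ : normed _ _ _ = fun N => (harm R N)^-1 *: normed mu b g N).
    by apply: row_cvgZ => //; exact: cvg_harmV.
  by apply/funext => N; exact: normedS.
suff z0 : row_cvg (fun N => mass b.+1 x N - L) 0.
  rewrite (_ : mass b.+1 x = fun N => (mass b.+1 x N - L) + L).
    by rewrite -[X in row_cvg _ X]add0r; apply: row_cvgD => //; exact: row_cvg_cst.
  by apply/funext => N; rewrite subrK.
move=> j; rewrite mxE.
apply: (vector_contraction_cvg0 w1_gt0 k0 K0 f01 kf_le1 T_contracts T_near_id
  (@cvg_sum_log_step R) (mass_recS L xS) (r := r *m u)); last first.
  by rewrite noise_sumM; exact: row_cvg_mulmx.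
rewrite (_ : (fun N => _) = fun N => wsq w1 ((((harm_ratio R b.+1 N - 1) / f N) *: L +
  (harm_ratio R b.+1 N / (1 + mu * step R N)) *: (normed mu b g N *m u)) - 0)); last first.
  by apply/funext => N; rewrite subr0.
apply: row_cvg_wsq => //.
have -> : 0 = (- b.+1%:R) *: L + 1 *: (G *m u) :> 'rV[R]_1.
  by rewrite /L scalerA mulNr divff ?pnatr_eq0// scaleN1r scale1r addNr.
apply: row_cvgD; apply: row_cvgZ; [|exact: row_cvg_cst| |exact: row_cvg_mulmx].
  rewrite (_ : (fun N => _) = fun N => - ((1 - harm_ratio R b.+1 N) / f N)).
    by apply: cvgN; exact: harm_ratio_slope.
  by apply/funext => N; rewrite -mulNr opprB.
rewrite -[X in _ --> X]mulr1 -[X in _ * X]invr1; apply: cvgM.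
  have h : 1 - b.+1%:R * (step R N / harm R N) @[N --> \oo] --> (1 : R).
    rewrite -[X in _ --> X]subr0 -(mulr0 b.+1%:R).
    by apply: cvgB; [exact: cvg_cst | apply: cvgMl_tmp; exact: cvg_log_step].
  apply: (squeeze_cvgr _ h (cvg_cst (1 : R))); apply: nearW => N.
  by rewrite harm_ratio_ge harm_ratio_le1.
apply: cvgV; first exact: oner_neq0.
rewrite -[X in _ --> X]addr0 -(mulr0 mu); apply: cvgD; first exact: cvg_cst.
by apply: cvgMl_tmp; exact: cvg_step.
Qed.

End Resonant.

End Block.

(** * The Perron-Frobenius theorem *)

Section NonnegativeMatrices.
Variables (R : realType) (n : nat).
Implicit Types (Q Z : 'M[R]_n) (x y : 'rV[R]_n).

Lemma mxpow_ge0 Q m : (forall i j, 0 <= Q i j) -> forall i j, 0 <= (Q ^+ m) i j.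
Proof.
move=> Q0; elim: m => [|m IH] i j.
  by rewrite expr0 mxE ler0n.
rewrite exprS mxE sumr_ge0// => l _; exact: mulr_ge0.
Qed.

Lemma irreducible_mx_tr Q : irreducible_mx Q -> irreducible_mx Q^T.
Proof.
move=> irr i j; have [m m1 Qm] := irr j i; exists m => //.
suff -> : Q^T ^+ m = (Q ^+ m)^T by rewrite mxE.
elim: m {m1 Qm} => [|m IH]; first by rewrite !expr0 trmx1.
by rewrite exprSr exprS IH; exact: (esym (trmx_mul Q (Q ^+ m))).
Qed.

Lemma left_eigen_pow Q x (a : R) m : x *m Q = a *: x -> x *m Q ^+ m = a ^+ m *: x.
Proof.
move=> xQ; elim: m => [|m IH]; first by rewrite !expr0 mulmx1 scale1r.
by rewrite exprS [_ * _]/(_ *m _) mulmxA xQ -scalemxAl IH scalerA exprS.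
Qed.

(** One power of [Q] for each pair of indices; their sum is a polynomial in [Q]
    without constant term, so it commutes with [Q] and acts on eigenvectors by
    scalars. *)
Lemma irreducible_mx_positive Q : (forall i j, 0 <= Q i j) -> irreducible_mx Q ->
  exists Z, [/\ forall i j, 0 < Z i j, Z *m Q = Q *m Z &
    forall x a, x *m Q = a *: x -> exists2 p, x *m Z = p *: x & a = 0 -> p = 0].
Proof.
move=> Q0 irr.
have /choice[m mP] : forall ij : 'I_n * 'I_n,
    exists m, (1 <= m)%N /\ 0 < (Q ^+ m) ij.1 ij.2.
  by move=> [i j]; have [m] := irr i j; exists m.
exists (\sum_ij Q ^+ m ij); split.
- move=> i j; rewrite summxE (bigD1 (i, j))//=; apply: ltr_wpDr.
    by apply: sumr_ge0 => ij _; exact: mxpow_ge0.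
  by have [] := mP (i, j).
- rewrite mulmx_suml mulmx_sumr; apply: eq_bigr => ij _.
  by rewrite -[LHS]/(_ * _) -[RHS]/(_ * _) -exprS -exprSr.
- move=> x a xQ; exists (\sum_ij a ^+ m ij).
    rewrite mulmx_sumr scaler_suml; apply: eq_bigr => ij _.
    exact: left_eigen_pow.
  move=> ->; apply: big1 => ij _; have [m1 _] := mP ij.
  by rewrite expr0n gtn_eqF.
Qed.

Lemma mulmx_gt0 x Z : (forall i j, 0 < Z i j) -> (forall j, 0 <= x 0 j) ->
  x != 0 -> forall j, 0 < (x *m Z) 0 j.
Proof.
move=> Z0 x0 xn0 j; rewrite mxE lt_neqAle sumr_ge0 ?andbT; last first.
  by move=> i _; rewrite mulr_ge0// ltW.
apply: contraNneq xn0 => /esym/eqP.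
rewrite psumr_eq0 => [/allP h|i _]; last by rewrite mulr_ge0// ltW.
apply/eqP/rowP => i; rewrite mxE; apply/eqP.
have := h i (mem_index_enum _); rewrite mulf_eq0 => /orP[//|].
by rewrite gt_eqF.
Qed.

(** Maximising [t] over the pairs [(x, t)] such that [x *m Q >= t *: x] is a
    maximisation of a continuous function over a compact set, whereas the
    Collatz-Wielandt quotient as a function of [x] is not continuous on the
    boundary of the simplex. *)
Lemma perron_maximizer Q : (0 < n)%N -> (forall i j, 0 <= Q i j) ->
  exists x t, [/\ forall j, 0 <= x 0 j, \sum_j x 0 j = 1,
    forall j, t * x 0 j <= (x *m Q) 0 j, 0 <= t
    & forall y s, (forall j, 0 <= y 0 j) -> \sum_j y 0 j = 1 ->
        (forall j, s * y 0 j <= (y *m Q) 0 j) -> s <= t].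
Proof.
move=> n0 Q0.
pose L : R := \sum_i \sum_j Q i j.
have bound y s : (forall j, 0 <= y 0 j) -> \sum_j y 0 j = 1 ->
        (forall j, s * y 0 j <= (y *m Q) 0 j) -> s <= L.
  move=> y0 y1 ys; rewrite -[s]mulr1 -y1 mulr_sumr.
  apply: (@le_trans _ _ (\sum_j \sum_i y 0 i * Q i j)).
    by apply: ler_sum => j _; apply: le_trans (ys j) _; rewrite mxE.
  rewrite exchange_big /=; apply: ler_sum => i _; rewrite -mulr_sumr.
  rewrite ler_piMl ?sumr_ge0// -y1 (bigD1 i)//= lerDl sumr_ge0//.
pose F : set ('rV[R]_n * R) := [set p : 'rV[R]_n * R | [/\ forall j, 0 <= p.1 0 j,
  \sum_j p.1 0 j = 1, forall j, p.2 * p.1 0 j <= (p.1 *m Q) 0 j & 0 <= p.2]].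
pose box := [set x : 'rV[R]_n | forall j, `[0, 1]%classic (x ord0 j)] `*` `[0, L]%classic.
have c1 (j : 'I_n) : continuous (fun p : 'rV[R]_n * R => p.1 0 j).
  move=> p; apply: (@continuous_comp _ _ _ fst (fun x : 'rV[R]_n => x 0 j)).
    exact: cvg_fst.
  exact: coord_continuous.
have c2 : continuous (fun p : 'rV[R]_n * R => p.2) by move=> p; exact: cvg_snd.
have Fbox : F `<=` box.
  move=> [x t] [/= x0 x1 xt t0]; split=> /=; last first.
    by rewrite in_itv/= t0 (bound x).
  move=> j; rewrite /= in_itv/= x0/= -x1 (bigD1 j)//= lerDl sumr_ge0//.
have Fclosed : closed F.
  have -> : F = (\bigcap_(j in [set: 'I_n]) [set p : 'rV[R]_n * R | 0 <= p.1 0 j])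
     `&` [set p : 'rV[R]_n * R | \sum_j p.1 0 j = 1]
     `&` (\bigcap_(j in [set: 'I_n]) [set p : 'rV[R]_n * R | 0 <= (p.1 *m Q) 0 j - p.2 * p.1 0 j])
     `&` [set p : 'rV[R]_n * R | 0 <= p.2].
    apply/seteqP; split=> p.
      case=> h1 h2 h3 h4; split=> //; split; last first.
        by move=> j _ /=; rewrite subr_ge0; exact: h3.
      by split=> // j _; exact: h1.
    case=> -[[h1 h2] h3] h4; split => // j; first exact: h1.
    by rewrite -subr_ge0; exact: h3.
  apply: closedI; last first.
    by apply: (@closed_comp _ _ _ [set x : R | 0 <= x]); [move=> p _; exact: c2 | exact: closed_ge].
  apply: closedI; last first.
    apply: closed_bigI => j _.
    apply: (@closed_comp _ _ (fun p : 'rV[R]_n * R => (p.1 *m Q) 0 j - p.2 * p.1 0 j)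
      [set x : R | 0 <= x]); last exact: closed_ge.
    move=> p _; apply: cvgB; last by apply: cvgM; [exact: c2 | exact: c1].
    rewrite mxE; under eq_fun do rewrite mxE.
    apply: (cvg_big add_continuous) => i _; apply: cvgM; [exact: c1 | exact: cvg_cst].
  apply: closedI.
    apply: closed_bigI => j _.
    by apply: (@closed_comp _ _ (fun p : 'rV[R]_n * R => p.1 0 j) [set x : R | 0 <= x]);
      [move=> p _; exact: c1 | exact: closed_ge].
  apply: (@closed_comp _ _ (fun p : 'rV[R]_n * R => \sum_j p.1 0 j) [set x : R | x = 1]).
    by move=> p _; apply: (cvg_big add_continuous) => i _; exact: c1.
  exact: closed_eq.
have Fcompact : compact F.
  apply: (subclosed_compact Fclosed _ Fbox); apply: compact_setX.
    by apply: (@rV_compact R n (fun=> `[0, 1]%classic)) => j; exact: segment_compact.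
  exact: segment_compact.
have F0 : F !=set0.
  have nn0 : n%:R != 0 :> R by rewrite pnatr_eq0 -lt0n.
  exists (const_mx n%:R^-1, 0); split => /=.
  - by move=> j; rewrite mxE invr_ge0.
  - under eq_bigr do rewrite mxE.
    by rewrite sumr_const card_ord -[_ *+ n]mulr_natr mulVf.
  - move=> j; rewrite mul0r mxE sumr_ge0// => i _; by rewrite mxE mulr_ge0 ?invr_ge0.
  - exact: lexx.
have [[x t] /= FX maxt] := compact_EVT_max F0 Fcompact (continuous_subspaceT c2).
have [x0 x1 xt t0] : F (x, t) by rewrite inE in FX.
exists x, t; split => // y s y0 y1 ys.
have [s0|/ltW s0] := leP 0 s; last exact: le_trans t0.
by apply: (maxt (y, s)); rewrite inE.
Qed.

(** At a maximiser the inequality [x Q >= t x] is an equality: otherwise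
    smoothing [x] by a positive matrix commuting with [Q] makes it strict in
    every coordinate, and [t] could be increased. *)
Lemma perron_eigenvector Q : (0 < n)%N -> (forall i j, 0 <= Q i j) ->
  irreducible_mx Q ->
  exists (x : 'rV[R]_n) (t : R), [/\ forall j, 0 < x 0 j, 0 < t & x *m Q = t *: x].
Proof.
move=> n0 Q0 irr.
have [Z [Z0 ZQ ZP]] := irreducible_mx_positive Q0 irr.
have [x [t [x0 x1 xt t0 maxt]]] := perron_maximizer n0 Q0.
have xn0 : x != 0.
  apply: contra_eqN x1 => /eqP ->.
  by rewrite big1 1?eq_sym ?oner_neq0// => j _; rewrite mxE.
have xZ0 := mulmx_gt0 Z0 x0 xn0.
have xQ : x *m Q = t *: x.
  apply/eqP; rewrite -subr_eq0; apply/negPn/negP => yn0.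
  pose y := x *m Q - t *: x.
  have y0 j : 0 <= y 0 j by rewrite /y !mxE subr_ge0; have := xt j; rewrite mxE.
  have yZ0 := mulmx_gt0 Z0 y0 yn0.
  pose x' := x *m Z; pose y' := y *m Z.
  have x'Q : x' *m Q = t *: x' + y'.
    by rewrite /y' /y mulmxBl -scalemxAl -!mulmxA ZQ addrC subrK.
  pose q i := x' 0 i / y' 0 i.
  have q0 i : 0 < q i by rewrite divr_gt0// ?xZ0 ?yZ0.
  pose i0 := Ordinal n0.
  have sq0 : 0 < \sum_i q i.
    by rewrite (bigD1 i0)//= ltr_pwDl// sumr_ge0// => i _; exact: ltW.
  pose s := \sum_i x' 0 i.
  have s0 : 0 < s.
    by rewrite /s (bigD1 i0)//= ltr_pwDl ?xZ0// sumr_ge0// => i _; exact/ltW/xZ0.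
  suff : t + (\sum_i q i)^-1 <= t by rewrite gerDl invr_le0 leNgt sq0.
  apply: (maxt (s^-1 *: x')).
  - by move=> j; rewrite mxE mulr_ge0 ?invr_ge0 ?ltW// xZ0.
  - under eq_bigr do rewrite mxE.
    by rewrite -mulr_sumr mulVf// gt_eqF.
  - move=> j; rewrite -scalemxAl x'Q.
    have qj : x' 0 j / y' 0 j <= \sum_i q i.
      by rewrite (bigD1 j)//= lerDl sumr_ge0// => i _; exact: ltW.
    have y'j : 0 < y' 0 j by exact: yZ0.
    move: (x') (y') qj y'j => z1 z2 qj y'j; rewrite !mxE mulrCA.
    rewrite ler_pM2l ?invr_gt0// mulrDl lerD2l mulrC ler_pdivrMr// mulrC.
    by rewrite -ler_pdivrMr.
have [p xZ t0p] := ZP _ _ xQ.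
have px0 j : 0 < p * x 0 j by have := xZ0 j; rewrite xZ mxE.
have xj j : 0 < x 0 j.
  rewrite lt_neqAle x0 andbT eq_sym; apply/eqP => xj0.
  by have := px0 j; rewrite xj0 mulr0 ltxx.
exists x, t; split => //; rewrite lt_neqAle t0 andbT eq_sym.
apply/eqP => /t0p p0; have := px0 (Ordinal n0).
by rewrite p0 mul0r ltxx.
Qed.

Lemma eigenvalue_real_complex Q (t : R) : eigenvalue Q t ->
  eigenvalue (map_mx (real_complex R) Q) (real_complex R t).
Proof.
move=> /eigenvalueP[x xQ xn0]; apply/eigenvalueP.
exists (map_mx (real_complex R) x); first by rewrite -map_mxM xQ map_mxZ.
by rewrite map_mx_eq0.
Qed.

(** Pairing with a positive right eigenvector bounds every eigenvalue. *)
Lemma eigenvalue_dominated Q (u : 'cV[R]_n) (t : R) (z : complex R) :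
  (forall i j, 0 <= Q i j) -> (forall j, 0 < u j 0) -> Q *m u = t *: u ->
  eigenvalue (map_mx (real_complex R) Q) z -> `|z| <= real_complex R t.
Proof.
move=> Q0 u0 Qu /eigenvalueP[x xQ xn0].
pose c := real_complex R.
have c_ge0 a : 0 <= a -> 0 <= c a by move=> a0; rewrite /c lecR.
pose S := \sum_j `|x 0 j| * c (u j 0).
have S0 : 0 < S.
  rewrite lt_neqAle sumr_ge0 ?andbT; last first.
    by move=> j _; rewrite mulr_ge0// c_ge0// ltW.
  apply: contraNneq xn0 => /esym/eqP.
  rewrite psumr_eq0 => [/allP h|j _]; last by rewrite mulr_ge0// c_ge0// ltW.
  apply/eqP/rowP => j; rewrite mxE; apply/eqP.
  have := h j (mem_index_enum _); rewrite mulf_eq0 normr_eq0 => /orP[//|].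
  by rewrite /c fmorph_eq0 gt_eqF.
rewrite -(ler_pM2r S0) /S !mulr_sumr.
apply: (@le_trans _ _ (\sum_j \sum_i `|x 0 i| * c (Q i j) * c (u j 0))).
  apply: ler_sum => j _; rewrite mulrA -normrM -mulr_suml.
  apply: ler_wpM2r; first by rewrite c_ge0// ltW.
  have -> : z * x 0 j = \sum_i x 0 i * c (Q i j).
    have := congr1 (fun m : 'rV_n => m 0 j) xQ; rewrite !mxE => <-.
    by apply: eq_bigr => i _; rewrite mxE.
  apply: (le_trans (ler_norm_sum _ _ _)); apply: ler_sum => i _.
  by rewrite normrM [X in _ * X]ger0_norm// c_ge0.
rewrite exchange_big /=; apply: ler_sum => i _.
have : c ((Q *m u) i 0) = c t * c (u i 0) by rewrite Qu mxE /c rmorphM.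
rewrite mxE /c rmorph_sum /= => h.
rewrite mulrCA -h mulr_sumr le_eqVlt; apply/orP; left; apply/eqP.
by apply: eq_bigr => j _; rewrite rmorphM mulrA.
Qed.

(** A dominant real eigenvalue and [t] dominate each other. *)
Lemma perron_frobenius_unique Q (u : 'cV[R]_n) (v : 'rV[R]_n) (t : R) :
  (0 < n)%N -> (forall i j, 0 <= Q i j) -> (forall j, 0 < u j 0) ->
  (forall j, 0 < v 0 j) -> Q *m u = t *: u -> v *m Q = t *: v ->
  perron_frobenius Q = t.
Proof.
move=> n0 Q0 u0 v0 Qu vQ.
have et : eigenvalue Q t.
  apply/eigenvalueP; exists v => //; apply/eqP => v00.
  by have := v0 (Ordinal n0); rewrite v00 mxE ltxx.
apply: xget_unique.
  by split=> // z; exact: eigenvalue_dominated.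
move=> y [ey ydom].
have yt := eigenvalue_dominated Q0 u0 Qu (eigenvalue_real_complex ey).
have ty := ydom _ (eigenvalue_real_complex et).
have cnorm (a : R) : real_complex R a <= `|real_complex R a|.
  by rewrite normc_def /= expr0n addr0 sqrtr_sqr lecR ler_norm.
apply/eqP; rewrite eq_le; apply/andP; split.
  by rewrite -lecR (le_trans _ yt)// cnorm.
by rewrite -lecR (le_trans _ ty)// cnorm.
Qed.

End NonnegativeMatrices.

Section Dissipativity.
Variables (R : realType) (n : nat) (Q : 'M[R]_n) (mu : R).
Variables (u : 'cV[R]_n) (v : 'rV[R]_n).
Hypotheses (Q_ge0 : forall i j, 0 <= Q i j).
Hypotheses (u_gt0 : forall j, 0 < u j 0) (v_gt0 : forall j, 0 < v 0 j).
Hypotheses (Qu : Q *m u = mu *: u) (vQ : v *m Q = mu *: v).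
Hypothesis vu : v *m u = 1%:M.

Let prob j : R := v 0 j * u j 0.

Definition dirichlet (f : 'I_n -> R) : R :=
  \sum_i \sum_j v 0 i * Q i j * u j 0 * (f i - f j) ^+ 2.

Let term_ge0 f i j : 0 <= v 0 i * Q i j * u j 0 * (f i - f j) ^+ 2.
Proof. by rewrite mulr_ge0 ?sqr_ge0// mulr_ge0 ?(ltW (u_gt0 _))// mulr_ge0 ?(ltW (v_gt0 _)). Qed.

Lemma dirichlet_ge0 f : 0 <= dirichlet f.
Proof. by apply: sumr_ge0 => i _; apply: sumr_ge0 => j _; exact: term_ge0. Qed.

(** Symmetrising the form uses both eigenvector equations, one for each index of
    the double sum. *)
Lemma wform_dirichlet x :
  wform (perron_weight u v) x (mu%:M - Q) = 2^-1 * dirichlet (fun j => x 0 j / v 0 j).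
Proof.
set f := fun j => _.
have xf j : x 0 j = v 0 j * f j by rewrite /f mulrC divfK// gt_eqF.
have e1 : wform (perron_weight u v) x (mu%:M - Q) =
    mu * (\sum_j v 0 j * u j 0 * f j ^+ 2) -
    \sum_i \sum_j v 0 i * Q i j * u j 0 * (f i * f j).
  rewrite exchange_big mulr_sumr -sumrB; apply: eq_bigr => j _ /=.
  rewrite mulmxBr mul_mx_scalar !mxE /perron_weight xf.
  have -> : \sum_i v 0 i * Q i j * u j 0 * (f i * f j) =
      u j 0 * f j * \sum_i x 0 i * Q i j.
    by rewrite mulr_sumr; apply: eq_bigr => i _; rewrite xf; ring.
  by field; rewrite gt_eqF.
have e2 : \sum_i \sum_j v 0 i * Q i j * u j 0 * f i ^+ 2 =
    mu * (\sum_j v 0 j * u j 0 * f j ^+ 2).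
  rewrite mulr_sumr; apply: eq_bigr => i _.
  have := congr1 (fun m : 'cV_n => m i 0) Qu; rewrite !mxE => h.
  rewrite (_ : mu * _ = v 0 i * f i ^+ 2 * (mu * u i 0)); last by ring.
  by rewrite -h mulr_sumr; apply: eq_bigr => j _; ring.
have e3 : \sum_i \sum_j v 0 i * Q i j * u j 0 * f j ^+ 2 =
    mu * (\sum_j v 0 j * u j 0 * f j ^+ 2).
  rewrite exchange_big mulr_sumr; apply: eq_bigr => j _ /=.
  have := congr1 (fun m : 'rV_n => m 0 j) vQ; rewrite !mxE => h.
  rewrite (_ : mu * _ = u j 0 * f j ^+ 2 * (mu * v 0 j)); last by ring.
  by rewrite -h mulr_sumr; apply: eq_bigr => i _; ring.
have e4 : dirichlet f = \sum_i \sum_j v 0 i * Q i j * u j 0 * f i ^+ 2 +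
    \sum_i \sum_j v 0 i * Q i j * u j 0 * f j ^+ 2 -
    2 * \sum_i \sum_j v 0 i * Q i j * u j 0 * (f i * f j).
  rewrite mulr_sumr -big_split /= -sumrB; apply: eq_bigr => i _.
  rewrite mulr_sumr -big_split /= -sumrB; apply: eq_bigr => j _; ring.
by rewrite e1 e4 e2 e3; field.
Qed.

(** A path of positive entries of [Q] leads from [i] to [j], and the squared
    differences of [f] add up along it. *)
Lemma dirichlet_path m i j : 0 < (Q ^+ m) i j ->
  exists2 c, 0 <= c & forall f, (f i - f j) ^+ 2 <= c * dirichlet f.
Proof.
elim: m i => [|m IH] i.
  rewrite expr0 mxE; case: eqP => [-> _|_]; last by rewrite ltxx.
  by exists 0 => // f; rewrite subrr expr0n mul0r.
rewrite exprS mxE => h.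
have [l /andP[Ql Qm]] : exists l, (0 < Q i l) && (0 < (Q ^+ m) l j).
  apply/existsP; apply: contraLR h; rewrite negb_exists => /forallP h.
  rewrite -leNgt big1// => l _; have := h l.
  rewrite negb_and -!leNgt => /orP[Ql|Ql].
    by rewrite (@le_anti _ _ (Q i l) 0) ?mul0r// Ql Q_ge0.
  by rewrite (@le_anti _ _ ((Q ^+ m) l j) 0) ?mulr0// Ql mxpow_ge0.
have [c c0 cP] := IH _ Qm.
pose q := v 0 i * Q i l * u l 0.
have q0 : 0 < q by rewrite !mulr_gt0.
exists (2 * q^-1 + 2 * c) => [|f].
  by rewrite addr_ge0 ?mulr_ge0 ?invr_ge0 ?(ltW q0).
have h1 : (f i - f l) ^+ 2 <= q^-1 * dirichlet f.
  rewrite -ler_pdivrMl ?invr_gt0// invrK.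
  rewrite /dirichlet (bigD1 i)//= (bigD1 l)//= -/q -addrA lerDl.
  apply: addr_ge0; apply: sumr_ge0 => k _; first exact: term_ge0.
  by apply: sumr_ge0 => k' _; exact: term_ge0.
have h2 := cP f.
have : (f i - f j) ^+ 2 <= 2 * (f i - f l) ^+ 2 + 2 * (f l - f j) ^+ 2.
  have := sqr_ge0 (f i - 2 * f l + f j); lra.
lra.
Qed.

(** The gap is a Poincare inequality: by [dirichlet_path] the Dirichlet form bounds
    all the squared differences of [f], hence the variance of [f] under [prob]. *)
Lemma perron_pairP : irreducible_mx Q -> perron_pair Q mu u v.
Proof.
move=> irr; split => //.
  by move=> x; rewrite wform_dirichlet mulr_ge0 ?invr_ge0// dirichlet_ge0.
have /choice[c cP] : forall ij : 'I_n * 'I_n, exists c, 0 <= c /\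
    forall f, (f ij.1 - f ij.2) ^+ 2 <= c * dirichlet f.
  move=> [i j] /=; have [m _ Qm] := irr i j.
  by have [c c0 cP] := dirichlet_path Qm; exists c.
have p0 i : 0 <= prob i by rewrite mulr_ge0// ltW.
have p1 : \sum_i prob i = 1.
  have := congr1 (fun m : 'M[R]_1 => m 0 0) vu; rewrite !mxE eqxx mulr1n => <-.
  by [].
exists (\sum_i \sum_j prob i * prob j * c (i, j)).
  apply: sumr_ge0 => i _; apply: sumr_ge0 => j _.
  have [cij _] := cP (i, j).
  by apply: mulr_ge0 => //; exact: mulr_ge0.
move=> x; rewrite wform_dirichlet; pose f j := x 0 j / v 0 j; rewrite -/f.
have xf j : x 0 j = v 0 j * f j by rewrite /f mulrC divfK// gt_eqF.
have -> : (x *m u) 0 0 = \sum_j prob j * f j.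
  by rewrite mxE; apply: eq_bigr => j _; rewrite xf /prob; ring.
have -> : wsq (perron_weight u v) x = \sum_j prob j * f j ^+ 2.
  apply: eq_bigr => j _; rewrite xf /perron_weight /prob.
  by field; rewrite gt_eqF.
set m := \sum_j prob j * f j; set s := \sum_j prob j * f j ^+ 2.
have var : \sum_i \sum_j prob i * prob j * (f i - f j) ^+ 2 = 2 * s - 2 * m ^+ 2.
  have e i : \sum_j prob i * prob j * (f i - f j) ^+ 2 =
     prob i * f i ^+ 2 * (\sum_j prob j) + prob i * s - 2 * (prob i * f i) * m.
    rewrite /s /m !mulr_sumr.
    rewrite -big_split /= -sumrB; apply: eq_bigr => j _; ring.
  rewrite (eq_bigr _ (fun i _ => e i)) sumrB big_split /= -!mulr_suml -mulr_sumr p1.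
  by rewrite -/m -/s; ring.
have : \sum_i \sum_j prob i * prob j * (f i - f j) ^+ 2 <=
    (\sum_i \sum_j prob i * prob j * c (i, j)) * dirichlet f.
  rewrite mulr_suml; apply: ler_sum => i _.
  rewrite mulr_suml; apply: ler_sum => j _.
  have [_ /(_ f)/= h] := cP (i, j).
  have := ler_wpM2l (mulr_ge0 (p0 i) (p0 j)) h; lra.
rewrite var; lra.
Qed.

End Dissipativity.

Lemma irreducible_perron_pair (R : realType) n (Q : 'M[R]_n) :
  (0 < n)%N -> (forall i j, 0 <= Q i j) -> irreducible_mx Q ->
  0 < character Q /\ exists u v, perron_pair Q (character Q) u v.
Proof.
move=> n0 Q0 irr.
have [v0 [mu [v0P mu0 vQ]]] := perron_eigenvector n0 Q0 irr.
have QT0 i j : 0 <= Q^T i j by rewrite mxE.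
have [y [nu [y0 _ yQ]]] := perron_eigenvector n0 QT0 (irreducible_mx_tr irr).
have u0 j : 0 < y^T j 0 by rewrite mxE.
have Qu : Q *m y^T = nu *: y^T.
  by apply: trmx_inj; rewrite trmx_mul !trmxK yQ linearZ /= trmxK.
pose t := (v0 *m y^T) 0 0.
have t0 : 0 < t.
  rewrite /t mxE (bigD1 (Ordinal n0))//= ltr_pwDl ?mulr_gt0//.
  by apply: sumr_ge0 => i _; rewrite mulr_ge0 ?ltW.
have numu : nu = mu.
  have : (v0 *m Q *m y^T) 0 0 = (v0 *m (Q *m y^T)) 0 0 by rewrite mulmxA.
  rewrite vQ Qu -scalemxAl -scalemxAr !mxE -/t.
  have -> : \sum_j v0 0 j * y^T j 0 = t by rewrite /t mxE.
  have tn0 : t != 0 by rewrite gt_eqF.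
  by move=> /(mulIf tn0).
have v1P j : 0 < (t^-1 *: v0) 0 j by rewrite mxE mulr_gt0 ?invr_gt0.
have v1Q : (t^-1 *: v0) *m Q = mu *: (t^-1 *: v0).
  by rewrite -scalemxAl vQ !scalerA mulrC.
have v1u : (t^-1 *: v0) *m y^T = 1%:M.
  apply/matrixP => i j; rewrite !ord1 -scalemxAl mxE -/t mulVf ?gt_eqF//.
  by rewrite mxE eqxx.
rewrite numu in Qu.
have charE : character Q = mu.
  rewrite /character; case: asboolP => // _.
  exact: (perron_frobenius_unique n0 Q0 u0 v0P Qu vQ).
rewrite charE; split => //; exists y^T, (t^-1 *: v0).
exact: perron_pairP.
Qed.

Lemma zero_perron_pair (R : realType) : perron_pair (0 : 'M[R]_1) 0 1%:M 1%:M.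
Proof.
split.
- by move=> j; rewrite ord1 mxE eqxx.
- by move=> j; rewrite ord1 mxE eqxx.
- by rewrite mul0mx scale0r.
- by rewrite mulmx0 scale0r.
- by rewrite mulmx1.
- move=> x; rewrite /wform big1// => j _.
  by rewrite subr0 mul_mx_scalar scale0r mxE mulr0 mul0r.
- exists 0 => // x; rewrite mul0r add0r mulmx1 /wsq big_ord1.
  by rewrite /perron_weight !mxE eqxx mulr1n divr1 mul1r.
Qed.

Lemma character_zero (R : realType) : character (0 : 'M[R]_1) = 0.
Proof.
rewrite /character; case: asboolP => // irr.
have [m m1] := irr 0 0; rewrite expr0n gtn_eqF//= mxE.
by rewrite ltxx.
Qed.

(** * The rate pairs *)

Section RateRecursion.
Variables (R : realType) (K : nat) (d : 'I_K.+1 -> nat).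
Variable A : 'M[R]_(\sum_k d k).
Hypothesis d_gt0 : forall k, (0 < d k)%N.
Hypothesis A_ge0 : forall i j, 0 <= A i j.
Hypothesis A_diag : forall k : 'I_K.+1,
  irreducible_mx (submxblock A k k) \/ (d k = 1%N /\ submxblock A k k = 0).

Lemma diagonal_perron k : 0 <= character (submxblock A k k) /\
  exists u v, perron_pair (submxblock A k k) (character (submxblock A k k)) u v.
Proof.
case: (A_diag k) => [irr|[dk ->]].
  have [|mu0 uv] := irreducible_perron_pair (d_gt0 k) _ irr.
    by move=> i j; rewrite mxE.
  by split=> //; exact: ltW.
rewrite dk character_zero; split => //.
by do 2 exists 1%:M; exact: zero_perron_pair.
Qed.

Lemma diagonal_character0 k :
  character (submxblock A k k) = 0 -> submxblock A k k = 0.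
Proof.
case: (A_diag k) => [irr|[_ ->]//].
have [|mu0 _ mu00] := irreducible_perron_pair (d_gt0 k) _ irr.
  by move=> i j; rewrite mxE.
by rewrite mu00 ltxx in mu0.
Qed.

Definition feeds (m k : 'I_K.+1) := (m < k)%N && (submxblock A m k != 0).

Definition rate_exp k : R := fine (rate A k).1.
Definition rate_log k : nat := absz (rate A k).2.

Definition lex_le (a' : R) (b' : nat) (a : R) (b : nat) :=
  (a' < a) || ((a' == a) && (b' <= b)%N).

(** The three cases in the definition of [beta_k], with the case of an incoming
    rate [-oo] set apart; [m] is a feeding block of lexicographically largest
    rate. *)
Variant rate_case (k : 'I_K.+1) : Prop :=
| Isolated of (forall m, ~~ feeds m k) &
    rate_exp k = character (submxblock A k k) & rate_log k = 0%N
| Autonomous m of feeds m k &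
    (forall l, feeds l k ->
      lex_le (rate_exp l) (rate_log l) (rate_exp m) (rate_log m)) &
    rate_exp m < character (submxblock A k k) &
    rate_exp k = character (submxblock A k k) & rate_log k = 0%N
| Resonant m of feeds m k &
    (forall l, feeds l k ->
      lex_le (rate_exp l) (rate_log l) (rate_exp m) (rate_log m)) &
    rate_exp m = character (submxblock A k k) &
    rate_exp k = character (submxblock A k k) & rate_log k = (rate_log m).+1
| Driven m of feeds m k &
    (forall l, feeds l k ->
      lex_le (rate_exp l) (rate_log l) (rate_exp m) (rate_log m)) &
    character (submxblock A k k) < rate_exp m &
    rate_exp k = rate_exp m & rate_log k = rate_log m.

Lemma previous_rate_isolated k : (forall m, ~~ feeds m k) ->
  previous_rate A (rate A) k = (-oo%E, 0).
Proof.
by move=> nofeed; rewrite /previous_rate big_pred0// => m; apply/negbTE/nofeed.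
Qed.

(** The neutral element [(-oo, 0)] never wins against a rate. *)
Lemma previous_rate_max k m0 : feeds m0 k -> exists2 m, feeds m k &
  previous_rate A (rate A) k = rate A m /\
  forall l, feeds l k -> (rate A l <= rate A m)%O.
Proof.
move=> fm0.
have := @bigmax_eq_arg _ (rate_pairs R) _ (-oo%E, 0) m0 (fun m => feeds m k) (rate A) fm0.
rewrite -[bigop _ _ _]/(previous_rate A (rate A) k) => ->.
  by case: arg_maxP => //= m fm mP; exists m.
move=> i _; have := rate_gtNy A i; case: (rate A i) => a b /= a0.
by rewrite lexi_pair (ltW a0) /= leNgt a0.
Qed.

Lemma rateP k : rate A k = ((rate_exp k)%:E, (rate_log k)%:Z) /\
  0 <= rate_exp k /\ rate_case k.
Proof.
suff H n : forall k : 'I_K.+1, (k < n)%N ->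
    rate A k = ((rate_exp k)%:E, (rate_log k)%:Z) /\ 0 <= rate_exp k /\ rate_case k.
  by apply: (H K.+1).
elim: n => // n IH {}k kn.
have [mu0 _] := diagonal_perron k.
set mu := character (submxblock A k k) in mu0.
have rE := rateE A k.
have [nofeed|] := pselect (forall m, ~~ feeds m k).
  rewrite /rate_step (previous_rate_isolated nofeed) ltNyr -/mu in rE.
  rewrite (max_idPr (leNye _)) in rE.
  have e1 : rate_exp k = mu by rewrite /rate_exp rE.
  have e2 : rate_log k = 0%N by rewrite /rate_log rE.
  by rewrite e1 e2 rE; split=> //; split=> //; apply: Isolated.
move=> /existsNP[m0 /negP]; rewrite negbK => fm0.
have [m fm [pm mP]] := previous_rate_max fm0.
have IHm l : feeds l k -> rate A l = ((rate_exp l)%:E, (rate_log l)%:Z) /\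
    0 <= rate_exp l.
  move=> /andP[lk _]; have [|h1 [h2 _]] := IH l; last by split.
  exact: leq_trans lk _.
have [rm rm0] := IHm _ fm.
have lexP l : feeds l k ->
    lex_le (rate_exp l) (rate_log l) (rate_exp m) (rate_log m).
  move=> fl; have [rl _] := IHm _ fl; have := mP _ fl.
  rewrite rl rm lexi_pair !lee_fin lez_nat /lex_le.
  by case: (ltrgtP (rate_exp l) (rate_exp m)).
rewrite /rate_step pm rm -/mu in rE.
rewrite lte_fin eqe -EFin_max in rE.
have [mlt|mgt|meq] := ltrgtP (rate_exp m) mu.
- rewrite mlt (max_idPr (ltW mlt)) in rE.
  have e1 : rate_exp k = mu by rewrite /rate_exp rE.
  have e2 : rate_log k = 0%N by rewrite /rate_log rE.
  by rewrite e1 e2 rE; split=> //; split=> //; apply: (Autonomous fm).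
- rewrite ltNge (ltW mgt) /= (lt_eqF mgt) (max_idPl (ltW mgt)) in rE.
  have e1 : rate_exp k = rate_exp m by rewrite {1}/rate_exp rE.
  have e2 : rate_log k = rate_log m by rewrite {1}/rate_log rE.
  by rewrite e1 e2 rE; split=> //; split=> //; apply: (Driven fm).
- rewrite meq ltxx eqxx maxxx in rE.
  have e1 : rate_exp k = mu by rewrite /rate_exp rE.
  have e2 : rate_log k = (rate_log m).+1 by rewrite {1}/rate_log rE /= addn1.
  by rewrite e1 e2 rE; split; [rewrite -addn1 PoszD|split=> //; apply: (Resonant fm)].
Qed.

Lemma rate_exp_ge0 k : 0 <= rate_exp k.
Proof. by have [_ []] := rateP k. Qed.

End RateRecursion.

(** * Dynamics of all the blocks *)

Definition urn_rec (R : realType) D (A : 'M[R]_D) (c xi : nat -> 'rV[R]_D) :=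
  forall N, c N.+1 = c N + step R N *: (c N *m A) + xi N.

Section BlockDynamics.
Variables (R : realType) (K : nat) (d : 'I_K.+1 -> nat).
Variable A : 'M[R]_(\sum_k d k).
Hypothesis d_gt0 : forall k, (0 < d k)%N.
Hypothesis A_ge0 : forall i j, 0 <= A i j.
Hypothesis A_upper : forall k l : 'I_K.+1, (l < k)%N -> submxblock A k l = 0.
Hypothesis A_diag : forall k : 'I_K.+1,
  irreducible_mx (submxblock A k k) \/ (d k = 1%N /\ submxblock A k k = 0).

Implicit Types (c xi : nat -> 'rV[R]_(\sum_k d k)) (k m : 'I_K.+1).

Let ra := rate_exp A.
Let rb := rate_log A.
Let ra_ge0 k : 0 <= ra k. Proof. exact: rate_exp_ge0. Qed.

Definition block c k N : 'rV[R]_(d k) := submxrow (c N) k.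

Definition inflow c k N : 'rV[R]_(d k) :=
  \sum_(m | feeds A m k) block c m N *m submxblock A m k.

Definition normed_block c k N := normed (rate_exp A k) (rate_log A k) (block c k) N.

Definition block_noise xi k N : 'rV[R]_(d k) :=
  noise_sum (normed_noise (rate_exp A k) (rate_log A k) (block xi k)) N.

Lemma submxrow_mulmx_upper (x : 'rV[R]_(\sum_k d k)) k :
  submxrow (x *m A) k = submxrow x k *m submxblock A k k +
    \sum_(m | feeds A m k) submxrow x m *m submxblock A m k.
Proof.
rewrite -{1}(submxrowK x) -{1}(submxblockK A) mul_mxrow_mxblock mxrowK.
rewrite (bigD1 k)//=; congr (_ + _).
rewrite [LHS](bigID (fun m => feeds A m k)) /= [X in _ + X]big1 ?addr0.
  apply: eq_bigl => m; case fm : (feeds A m k); rewrite ?andbF// andbT.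
  by move: fm => /andP[mk _]; apply: contraTneq mk => ->; rewrite ltnn.
move=> m /andP[mk]; rewrite negb_and -leqNgt negbK => /orP[km|/eqP ->].
  by rewrite A_upper ?mulmx0// ltn_neqAle km andbT eq_sym.
by rewrite mulmx0.
Qed.

Lemma submxrowZ (s : R) (x : 'rV[R]_(\sum_k d k)) k :
  submxrow (s *: x) k = s *: submxrow x k.
Proof. by apply/rowP => j; rewrite !mxE. Qed.

Lemma block_recP c xi k : urn_rec A c xi ->
  block_rec (submxblock A k k) (block c k) (inflow c k) (block xi k).
Proof.
move=> cS N; rewrite /block cS !submxrowD submxrowZ.
by rewrite submxrow_mulmx_upper.
Qed.

Lemma normed_inflow c k (a : R) b N : normed a b (inflow c k) N =
  \sum_(m | feeds A m k) (norming (ra m) (rb m) N / norming a b N) *: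
    (normed_block c m N *m submxblock A m k).
Proof.
rewrite /normed /inflow scaler_sumr; apply: eq_bigr => m _.
rewrite /normed_block /normed -scalemxAl scalerA mulrAC divff ?mul1r//.
by rewrite gt_eqF// norming_gt0// ra_ge0.
Qed.

(** Each feeding block contributes at most the order [(a, b)], because the quotient
    of two normings converges when the pairs are lexicographically ordered. *)
Lemma inflow_bound k (a : R) b :
    (forall m, feeds A m k -> lex_le (ra m) (rb m) a b) ->
    (forall m, feeds A m k -> exists2 C : R, 0 <= C & forall c xi M, 0 <= M ->
       urn_rec A c xi -> row_bound M (c 0%N) ->
       (forall k N, row_bound M (block_noise xi k N)) ->
       forall N, row_bound (C * M) (normed_block c m N)) ->
  exists2 C : R, 0 <= C & forall c xi M, 0 <= M ->
       urn_rec A c xi -> row_bound M (c 0%N) ->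
       (forall k N, row_bound M (block_noise xi k N)) ->
       forall N, row_bound (C * M) (normed a b (inflow c k) N).
Proof.
move=> lexm IH.
have /choice[C CP] : forall m, exists C : R, 0 <= C /\ (feeds A m k ->
    forall c xi M, 0 <= M ->
       urn_rec A c xi -> row_bound M (c 0%N) ->
       (forall k N, row_bound M (block_noise xi k N)) ->
       forall N, row_bound (C * M)
         ((norming (ra m) (rb m) N / norming a b N) *:
            (normed_block c m N *m submxblock A m k))).
  move=> m; case: (boolP (feeds A m k)) => [fm|_]; last by exists 0.
  have [C C0 CP] := IH _ fm.
  have [l rl] := norming_ratio_cvg (ra_ge0 m) (lexm _ fm).
  have [D D0 DP] := cvg_abs_bound rl.
  exists (D * (entry_sum (submxblock A m k) * C)); split.
    by rewrite mulr_ge0// mulr_ge0// entry_sum_ge0.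
  move=> _ c xi M M0 cS c0 SM N.
  have h := row_bound_mulmx (submxblock A m k) (mulr_ge0 C0 M0) (CP _ _ _ M0 cS c0 SM N).
  apply: row_bound_le (row_boundZ _ h); rewrite -[leRHS]mulrA -[in leRHS]mulrA.
  apply: ler_wpM2r; last exact: DP.
  by rewrite mulr_ge0 ?entry_sum_ge0// mulr_ge0.
exists (\sum_m C m); first by apply: sumr_ge0 => m _; have [] := CP m.
move=> c xi M M0 cS c0 SM N j; rewrite normed_inflow summxE.
apply: (le_trans (ler_norm_sum _ _ _)); rewrite mulr_suml.
rewrite [leRHS](bigID (fun m => feeds A m k)) /= ler_wpDr//.
  by apply: sumr_ge0 => m _; have [Cm _] := CP m; rewrite mulr_ge0.
by apply: ler_sum => m fm; have [_ Cm] := CP m; exact: (Cm fm _ _ _ M0 cS c0 SM N).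
Qed.

Lemma inflow_cvg c k (a : R) b :
    (forall m, feeds A m k -> lex_le (ra m) (rb m) a b) ->
    (forall m, feeds A m k -> exists l, row_cvg (normed_block c m) l) ->
  exists l, row_cvg (normed a b (inflow c k)) l.
Proof.
move=> lexm IH.
have /choice[l lP] : forall m, exists l : 'rV[R]_(d k), feeds A m k ->
    row_cvg (fun N => (norming (ra m) (rb m) N / norming a b N) *:
            (normed_block c m N *m submxblock A m k)) l.
  move=> m; case: (boolP (feeds A m k)) => [fm|_]; last by exists 0.
  have [l lP] := IH _ fm.
  have [s sP] := norming_ratio_cvg (ra_ge0 m) (lexm _ fm).
  exists (s *: (l *m submxblock A m k)) => _.
  by apply: row_cvgZ => //; exact: row_cvg_mulmx.
exists (\sum_(m | feeds A m k) l m) => j; rewrite summxE.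
rewrite (_ : (fun N => _) = fun N => \sum_(m | feeds A m k)
  ((norming (ra m) (rb m) N / norming a b N) *:
            (normed_block c m N *m submxblock A m k)) 0 j).
  by apply: cvg_sumr => m fm; exact: lP.
by apply/funext => N; rewrite normed_inflow summxE.
Qed.

Lemma isolated_inflow c k N : (forall m, ~~ feeds A m k) -> inflow c k N = 0.
Proof. by move=> nf; rewrite /inflow big1// => m fm; have := nf m; rewrite fm. Qed.

Lemma gap_ratio (a a' : R) b' : 0 <= a' -> a' < a ->
  let r N := norming a' b' N / norming a 0 N in
  [/\ forall N, 0 <= r N, r N @[N --> \oo] --> 0 &
    exists C, forall n, \sum_(N < n) step R N * r N <= C].
Proof.
move=> a'0 aa r; have a0 : 0 <= a := le_trans a'0 (ltW aa).
have r0 N : 0 <= r N by rewrite divr_ge0// ltW// norming_gt0.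
have [c c01 [N0 N0P]] := norming_ratio_decay 0 b' a'0 aa.
split => //; first exact: (decay_cvg0 r0 c01 N0P).
by have /andP[c0 _] := c01; exact: (decay_summable r0 c0 N0P).
Qed.

Let normed_shift (a a' : R) b b' n (g : nat -> 'rV[R]_n) N : 0 <= a' ->
  normed a b g N = (norming a' b' N / norming a b N) *: normed a' b' g N.
Proof.
move=> a'0; rewrite /normed scalerA mulrAC divff ?mul1r//.
by rewrite gt_eqF// norming_gt0.
Qed.

(** As the constant is the same for all trajectories, the bound serves twice: for
    the mean counts, without noise, and for the random counts. *)
Theorem block_dynamics_bound k : exists2 C : R, 0 <= C & forall c xi M, 0 <= M ->
    urn_rec A c xi -> row_bound M (c 0%N) ->
    (forall k N, row_bound M (block_noise xi k N)) ->
  forall N, row_bound (C * M) (normed_block c k N).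
Proof.
suff H n : forall k : 'I_K.+1, (k < n)%N -> exists2 C : R, 0 <= C & forall c xi M,
    0 <= M -> urn_rec A c xi -> row_bound M (c 0%N) ->
    (forall k N, row_bound M (block_noise xi k N)) ->
  forall N, row_bound (C * M) (normed_block c k N).
  by apply: (H K.+1).
elim: n => // n IH {}k kn.
have IHf m : feeds A m k -> exists2 C : R, 0 <= C & forall c xi M, 0 <= M ->
       urn_rec A c xi -> row_bound M (c 0%N) ->
       (forall k N, row_bound M (block_noise xi k N)) ->
       forall N, row_bound (C * M) (normed_block c m N).
  by move=> /andP[mk _]; apply: IH; exact: leq_trans mk _.
have [mu0 [u [v uv]]] := diagonal_perron d_gt0 A_ge0 A_diag k.
have c0k c M : row_bound M (c 0%N) -> row_bound M (block c k 0).
  by move=> cM j; rewrite mxE.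
have [_ [_ [nf ek lk|m fm lexm gapm ek lk|m fm lexm gapm ek lk|m fm lexm gapm ek lk]]] :=
  rateP d_gt0 A_ge0 A_diag k.
- have [|||C C0 CP] := @block_autonomous_bound _ _ _ _ _ _ uv mu0 (fun=> 0) 0.
  + by [].
  + exact: cvg_cst.
  + by move=> m; rewrite big1// => i _; rewrite mulr0.
  exists C => // c xi M M0 cS c0 SM.
  rewrite /normed_block ek lk; apply: (CP _ _ _ M M0 (block_recP k cS)).
  + exact: c0k.
  + by move=> N; rewrite /normed isolated_inflow// scaler0 mulr0 => j; rewrite mxE normr0.
  + by move=> N; have := SM k N; rewrite /block_noise ek lk.
- have [r0 rc [Cr rs]] := gap_ratio (rb m) (ra_ge0 m) gapm.
  have [C C0 CP] := block_autonomous_bound uv mu0 r0 rc rs.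
  have [G G0 GP] := inflow_bound lexm IHf.
  exists (C * (1 + G)); first by rewrite mulr_ge0// addr_ge0.
  move=> c xi M M0 cS c0 SM N.
  have MG : M <= (1 + G) * M by rewrite ler_peMl// lerDl.
  rewrite /normed_block ek lk -mulrA.
  apply: (CP _ _ _ ((1 + G) * M) _ (block_recP k cS)).
  + by rewrite mulr_ge0// addr_ge0.
  + by apply: row_bound_le MG _; exact: c0k.
  + move=> i; rewrite (normed_shift _ _ (rb m) _ _ (ra_ge0 m)).
    have h := row_boundZ (norming (ra m) (rb m) i / norming (character (submxblock A k k)) 0 i)
      (GP _ _ _ M0 cS c0 SM i).
    apply: row_bound_le h; rewrite ger0_norm ?r0// mulrC ler_wpM2r ?r0//.
    by rewrite ler_wpM2r// lerDr.
  + by move=> i; apply: row_bound_le MG _; have := SM k i; rewrite /block_noise ek lk.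
- have [C C0 CP] := block_resonant_bound uv mu0 (rb m).
  have [G G0 GP] := inflow_bound lexm IHf.
  exists (C * (1 + G)); first by rewrite mulr_ge0// addr_ge0.
  move=> c xi M M0 cS c0 SM N.
  have MG : M <= (1 + G) * M by rewrite ler_peMl// lerDl.
  rewrite /normed_block ek lk -mulrA.
  apply: (CP _ _ _ ((1 + G) * M) _ (block_recP k cS)).
  + by rewrite mulr_ge0// addr_ge0.
  + by apply: row_bound_le MG _; exact: c0k.
  + move=> i; rewrite -gapm; apply: row_bound_le (GP _ _ _ M0 cS c0 SM i).
    by rewrite ler_wpM2r// lerDr.
  + by move=> i; apply: row_bound_le MG _; have := SM k i; rewrite /block_noise ek lk.
- have [C C0 CP] := block_driven_bound uv mu0 (rb m) gapm.
  have [G G0 GP] := inflow_bound lexm IHf.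
  exists (C * (1 + G)); first by rewrite mulr_ge0// addr_ge0.
  move=> c xi M M0 cS c0 SM N.
  have MG : M <= (1 + G) * M by rewrite ler_peMl// lerDl.
  rewrite /normed_block ek lk -mulrA.
  apply: (CP _ _ _ ((1 + G) * M) _ (block_recP k cS)).
  + by rewrite mulr_ge0// addr_ge0.
  + by apply: row_bound_le MG _; exact: c0k.
  + move=> i; apply: row_bound_le (GP _ _ _ M0 cS c0 SM i).
    by rewrite ler_wpM2r// lerDr.
  + by move=> i; apply: row_bound_le MG _; have := SM k i; rewrite /block_noise ek lk.
Qed.

Theorem block_dynamics_cvg c xi k : urn_rec A c xi ->
    (forall k, exists r, row_cvg (block_noise xi k) r) ->
  exists l, row_cvg (normed_block c k) l.
Proof.
move=> cS Sc.
suff H n : forall k : 'I_K.+1, (k < n)%N -> exists l, row_cvg (normed_block c k) l.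
  by apply: (H K.+1).
elim: n => // n IH {}k kn.
have IHf m : feeds A m k -> exists l, row_cvg (normed_block c m) l.
  by move=> /andP[mk _]; apply: IH; exact: leq_trans mk _.
have [mu0 [u [v uv]]] := diagonal_perron d_gt0 A_ge0 A_diag k.
have [s sP] := Sc k; rewrite /block_noise in sP.
have [_ [_ [nf ek lk|m fm lexm gapm ek lk|m fm lexm gapm ek lk|m fm lexm gapm ek lk]]] :=
  rateP d_gt0 A_ge0 A_diag k; rewrite /normed_block ek lk in sP *.
- apply: (@block_autonomous_cvg _ _ _ _ _ _ uv mu0 (fun=> 0) 0 _ _ _ _ _ _ 0 s
    (lexx _) (block_recP k cS)) => //.
  + exact: cvg_cst.
  + by move=> m; rewrite big1// => i _; rewrite mulr0.
  + by move=> N; rewrite /normed isolated_inflow// scaler0 mulr0 => j; rewrite mxE normr0.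
- have [r0 rc [Cr rs]] := gap_ratio (rb m) (ra_ge0 m) gapm.
  have [G GP] := inflow_cvg lexm IHf.
  have /choice[D DP] : forall j, exists D : R, 0 <= D /\
      forall N, `|normed (ra m) (rb m) (inflow c k) N 0 j| <= D.
    by move=> j; have [D D0 DP] := cvg_abs_bound (GP j); exists D.
  have D0 : 0 <= \sum_j D j by apply: sumr_ge0 => j _; have [] := DP j.
  apply: (block_autonomous_cvg uv mu0 r0 rc rs D0 (block_recP k cS) _ sP) => N.
  rewrite (normed_shift _ _ (rb m) _ _ (ra_ge0 m)).
  have h : row_bound (\sum_j D j) (normed (ra m) (rb m) (inflow c k) N).
    move=> j; apply: (le_trans ((DP j).2 N)).
    by rewrite (bigD1 j)//= lerDl sumr_ge0// => i _; have [] := DP i.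
  have := row_boundZ (norming (ra m) (rb m) N / norming (character (submxblock A k k)) 0 N) h.
  by apply: row_bound_le; rewrite ger0_norm ?r0// mulrC.
- have [G GP] := inflow_cvg lexm IHf; rewrite gapm in GP.
  exact: (block_resonant_cvg uv mu0 (block_recP k cS) GP sP).
- have [G GP] := inflow_cvg lexm IHf.
  exact: (block_driven_cvg uv mu0 gapm (block_recP k cS) GP sP).
Qed.

End BlockDynamics.

(** * Martingales along the trials *)

Section Histories.
Variables (R : realType) (D : nat).
Variables (disp : measure_display) (Omega : measurableType disp).
Variables (P : probability Omega R) (sel : nat -> Omega -> 'I_D).
Hypothesis msel : forall n i, measurable [set w | sel n w = i].

(** Measurability with respect to the past, stated pointwise: as the past takes
    finitely many values, this amounts to measurability, and it makes the closure
    properties immediate. *)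
Definition adapted (T : Type) N (X : Omega -> T) := forall w w',
  (forall n, (n < N)%N -> sel n w = sel n w') -> X w = X w'.

Lemma adapted_le (T : Type) N N' (X : Omega -> T) : (N <= N')%N ->
  adapted N X -> adapted N' X.
Proof. by move=> NN aX w w' ww; apply: aX => n nN; apply: ww; exact: leq_trans NN. Qed.

Lemma adapted_comp (T U : Type) N (X : Omega -> T) (f : T -> U) :
  adapted N X -> adapted N (fun w => f (X w)).
Proof. by move=> aX w w' ww; rewrite (aX w w'). Qed.

Lemma adapted_comp2 (T U V : Type) N (X : Omega -> T) (Y : Omega -> U) (f : T -> U -> V) :
  adapted N X -> adapted N Y -> adapted N (fun w => f (X w) (Y w)).
Proof. by move=> aX aY w w' ww; rewrite (aX w w')// (aY w w'). Qed.

Lemma adapted_sum (I : Type) (r : seq I) (Q : pred I) N (X : I -> Omega -> R) :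
  (forall i, Q i -> adapted N (X i)) ->
  adapted N (fun w => \sum_(i <- r | Q i) X i w).
Proof. by move=> aX w w' ww; apply: eq_bigr => i Qi; exact: aX. Qed.

Lemma adapted_sel N : adapted N.+1 (sel N).
Proof. by move=> w w' ww; exact: ww. Qed.

Definition history N (w : Omega) : {ffun 'I_N -> 'I_D} := [ffun n : 'I_N => sel n w].

Definition cylinder N (h : {ffun 'I_N -> 'I_D}) : set Omega :=
  [set w | history N w = h].

Lemma adapted_history N (X : Omega -> R) : adapted N X ->
  exists F : {ffun 'I_N -> 'I_D} -> R, forall w, X w = F (history N w).
Proof.
move=> aX.
exists (fun h => if pselect (exists w, history N w = h) is left e
                 then X (projT1 (cid e)) else 0).
move=> w; case: pselect => [e|]; last by case; exists w.
case: cid => w' /= ww'; apply: aX => n nN.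
have := congr1 (fun h : {ffun 'I_N -> 'I_D} => h (Ordinal nN)) ww'.
by rewrite !ffunE.
Qed.

Lemma cylinder_past N h : past sel N (@cylinder N h).
Proof.
have -> : @cylinder N h = \bigcap_(n in [set: 'I_N]) [set w | sel n w = h n].
  apply/seteqP; split=> w /=.
    by move=> <- n _ /=; rewrite ffunE.
  by move=> wh; apply/ffunP => n; rewrite ffunE; exact: wh.
apply: (@fin_bigcap_measurable _ (g_sigma_algebraType
  [set E | exists n i, (n < N)%N /\ E = [set w | sel n w = i]])).
  exact: finite_finset.
move=> n _; apply: sub_sigma_algebra.
by exists n, (h n).
Qed.

Lemma measurable_past N E : past sel N E -> measurable E.
Proof.
apply: smallest_sub; first exact: sigma_algebra_measurable.
by move=> _ [n [i [_ ->]]]; exact: msel.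
Qed.

(** Functions of the past are finite combinations of indicators of cylinders, to
    which the hypothesis on the urn applies. *)
Lemma history_sum N (F : {ffun 'I_N -> 'I_D} -> R) w :
  F (history N w) = \sum_h F h * \1_(cylinder h) w.
Proof.
rewrite (bigD1 (history N w))//= indicE mem_set// mulr1 big1 ?addr0// => h hw.
rewrite indicE memNset ?mulr0// => /= e.
by rewrite e eqxx in hw.
Qed.

Lemma measurable_cylinder N (h : {ffun 'I_N -> 'I_D}) : measurable (cylinder h).
Proof. exact: measurable_past (@cylinder_past N h). Qed.

Lemma adapted_measurable N (X : Omega -> R) : adapted N X -> measurable_fun setT X.
Proof.
move=> /adapted_history[F XF].
rewrite (_ : X = fun w => \sum_h F h * \1_(cylinder h) w); last first.
  by apply/funext => w; rewrite XF history_sum.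
apply: measurable_sum => h; apply: measurable_funM; first exact: measurable_cst.
exact/measurable_indic/measurable_cylinder.
Qed.

Lemma adapted_integrable N (X : Omega -> R) : adapted N X ->
  P.-integrable setT (EFin \o X).
Proof.
move=> aX; apply: measurable_bounded_integrable.
- exact: measurableT.
- by rewrite -ge0_fin_numE// fin_num_measure.
- exact: adapted_measurable aX.
have [F XF] := adapted_history aX.
exists (\sum_h `|F h|); split; first exact: num_real.
move=> M /ltW FM w _ /=; apply: le_trans FM; rewrite XF.
by rewrite (bigD1 (history N w))//= lerDl sumr_ge0.
Qed.

Definition expect (X : Omega -> R) : R := Rintegral P setT X.

Lemma expectD N X Y : adapted N X -> adapted N Y ->
  expect (fun w => X w + Y w) = expect X + expect Y.
Proof. by move=> aX aY; apply: RintegralD => //; apply: adapted_integrable; eauto. Qed.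

Lemma expectZ N (a : R) X : adapted N X -> expect (fun w => a * X w) = a * expect X.
Proof. by move=> aX; apply: RintegralZl => //; exact: adapted_integrable aX. Qed.

Lemma expect_cst (a : R) : expect (fun=> a) = a.
Proof.
rewrite /expect Rintegral_cst// -[RHS]mulr1; congr (_ * _).
exact: (congr1 fine (probability_setT P)).
Qed.

Lemma expect_sum N (I : Type) (r : seq I) (Q : pred I) (X : I -> Omega -> R) :
  (forall i, Q i -> adapted N (X i)) ->
  expect (fun w => \sum_(i <- r | Q i) X i w) = \sum_(i <- r | Q i) expect (X i).
Proof.
move=> aX; elim: r => [|i r IH].
  rewrite big_nil; under eq_fun do rewrite big_nil.
  exact: expect_cst.
rewrite big_cons; under eq_fun do rewrite big_cons.
case: ifPn => // Qi; rewrite (@expectD N) ?IH//; first exact: aX.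
exact: adapted_sum.
Qed.

Lemma expect_le N X Y : adapted N X -> adapted N Y ->
  (forall w, X w <= Y w) -> expect X <= expect Y.
Proof.
by move=> aX aY XY; apply: le_Rintegral => //; apply: adapted_integrable; eauto.
Qed.

Lemma expectB N X Y : adapted N X -> adapted N Y ->
  expect (fun w => X w - Y w) = expect X - expect Y.
Proof. by move=> aX aY; apply: RintegralB => //; apply: adapted_integrable; eauto. Qed.

Lemma expect_EFin N X : adapted N X -> (\int[P]_w (X w)%:E = (expect X)%:E)%E.
Proof.
move=> aX; rewrite /expect /Rintegral fineK//.
exact: integrable_fin_num (adapted_integrable aX).
Qed.

(** Doob's maximal inequality in L2, by a pathwise inequality between the
    running maximum, the terminal value and a martingale transform. *)
Section Doob.
Variable zeta : nat -> Omega -> R.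
Hypothesis zeta_adapted : forall N, adapted N.+1 (zeta N).
Hypothesis zeta_mart : forall N X, adapted N X ->
  expect (fun w => X w * zeta N w) = 0.

Definition psum n w : R := \sum_(N < n) zeta N w.

Fixpoint run_max n w : R :=
  if n is n'.+1 then Num.max (run_max n' w) (psum n w) else 0.

Lemma psum_adapted n : adapted n (psum n).
Proof.
move=> w w' ww; apply: eq_bigr => N _; apply: zeta_adapted => m mN.
by apply: ww; rewrite (leq_trans mN).
Qed.

Lemma run_max_adapted n : adapted n (run_max n).
Proof.
elim: n => [//|n IH] w w' ww /=; rewrite (psum_adapted ww) (IH w w')// => m mn.
by apply: ww; rewrite ltnS ltnW.
Qed.

Lemma run_max_ge0 n w : 0 <= run_max n w.
Proof. by elim: n => [//|n IH] /=; rewrite le_max IH. Qed.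

Lemma run_max_ge n m w : (m <= n)%N -> psum m w <= run_max n w.
Proof.
elim: n => [|n IH].
  by rewrite leqn0 => /eqP ->; rewrite /psum big_ord0.
rewrite leq_eqVlt => /orP[/eqP ->|]; first by rewrite /= le_max lexx orbT.
by rewrite ltnS => /IH mn; rewrite /= le_max mn.
Qed.

Lemma run_max_nd n m w : (n <= m)%N -> run_max n w <= run_max m w.
Proof.
move=> nm; rewrite -(subnKC nm); elim: (m - n)%N => [|l IH]; first by rewrite addn0.
by rewrite addnS /= le_max IH.
Qed.

(** The last sum is a martingale transform, hence of mean zero.  The induction
    proves a sharper form, which is summation by parts up to half the squared
    increments of the maximum. *)
Lemma run_max_pathwise n w : run_max n w ^+ 2 <=
  4 * psum n w ^+ 2 - 4 * \sum_(i < n) run_max i w * zeta i w.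
Proof.
have : 2^-1 * run_max n w ^+ 2 <=
    run_max n w * psum n w - \sum_(i < n) run_max i w * zeta i w.
  elim: n => [|n IH]; first by rewrite /psum !big_ord0 /= expr0n !mulr0 subr0.
  rewrite big_ord_recr /=.
  have -> : psum n.+1 w = psum n w + zeta n w by rewrite /psum big_ord_recr.
  move: IH; set s := run_max n w; set m := psum n w; set z := zeta n w.
  set S := \sum_(i < n) _ => IH.
  case: (leP s (m + z)) => [smz|smz]; last lra.
  have := sqr_ge0 (m + z - s); lra.
have := sqr_ge0 (run_max n w - 2 * psum n w); lra.
Qed.

(** Martingale differences are orthogonal. *)
Lemma psum_second_moment n :
  expect (fun w => psum n w ^+ 2) = \sum_(N < n) expect (fun w => zeta N w ^+ 2).
Proof.
elim: n => [|n IH].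
  rewrite big_ord0 -(expect_cst 0); congr expect; apply/funext => w.
  by rewrite /psum big_ord0 expr0n.
rewrite big_ord_recr /= -IH.
have aS := adapted_le (leqnSn n) (@psum_adapted n).
have -> : (fun w => psum n.+1 w ^+ 2) = (fun w => (psum n w ^+ 2 +
    (2 * (psum n w * zeta n w))) + zeta n w ^+ 2).
  by apply/funext => w; rewrite /psum big_ord_recr /=; ring.
have a1 : adapted n.+1 (fun w => psum n w * zeta n w).
  by apply: adapted_comp2 => //; exact: zeta_adapted.
rewrite (@expectD n.+1); last 2 first.
- apply: (adapted_comp2 (fun x y : R => x + y)); first exact: (adapted_comp (fun x : R => x ^+ 2)).
  exact: (adapted_comp (fun x : R => 2 * x)).
- exact: (adapted_comp (fun x : R => x ^+ 2)).
rewrite (@expectD n.+1); last 2 first.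
- exact: (adapted_comp (fun x : R => x ^+ 2)).
- exact: (adapted_comp (fun x : R => 2 * x)).
rewrite (expectZ _ a1) zeta_mart ?mulr0 ?addr0//.
exact: psum_adapted.
Qed.

Lemma doob_l2 n : expect (fun w => run_max n w ^+ 2) <=
  4 * \sum_(N < n) expect (fun w => zeta N w ^+ 2).
Proof.
rewrite -psum_second_moment.
have a1 : adapted n (fun w => psum n w ^+ 2).
  by apply: (adapted_comp (fun x : R => x ^+ 2)); exact: psum_adapted.
have a2 : adapted n (fun w => \sum_(i < n) run_max i w * zeta i w).
  apply: adapted_sum => i _; apply: (adapted_comp2 (fun x y : R => x * y)).
    exact: (adapted_le (ltnW (ltn_ord i)) (@run_max_adapted i)).
  exact: (adapted_le (ltn_ord i) (@zeta_adapted i)).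
apply: (@le_trans _ _ (expect (fun w => 4 * psum n w ^+ 2 -
    4 * \sum_(i < n) run_max i w * zeta i w))).
  apply: (@expect_le n); last by move=> w; exact: run_max_pathwise.
    by apply: (adapted_comp (fun x : R => x ^+ 2)); exact: run_max_adapted.
  by apply: (adapted_comp2 (fun x y : R => 4 * x - 4 * y)).
rewrite (@expectB n); last 2 first.
- exact: (adapted_comp (fun x : R => 4 * x)).
- exact: (adapted_comp (fun x : R => 4 * x)).
rewrite (expectZ _ a1) (expectZ _ a2) (@expect_sum n).
  rewrite big1 ?mulr0 ?subr0// => i _; apply: zeta_mart; exact: run_max_adapted.
move=> i _; apply: (adapted_comp2 (fun x y : R => x * y)).
  exact: (adapted_le (ltnW (ltn_ord i)) (@run_max_adapted i)).
exact: (adapted_le (ltn_ord i) (@zeta_adapted i)).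
Qed.

End Doob.
Lemma psum_neg (zeta : nat -> Omega -> R) n w :
  psum (fun N w => - zeta N w) n w = - psum zeta n w.
Proof. by rewrite /psum sumrN. Qed.

(** Doob's inequality for [zeta] and for [- zeta] controls the positive and the
    negative excursions; monotone convergence passes to infinite time. *)
Lemma martingale_maximal (zeta : nat -> Omega -> R) (V : R) :
    (forall N, adapted N.+1 (zeta N)) ->
    (forall N X, adapted N X -> expect (fun w => X w * zeta N w) = 0) ->
    (forall n, \sum_(N < n) expect (fun w => zeta N w ^+ 2) <= V) ->
  exists D : Omega -> \bar R, [/\ measurable_fun setT D, forall w, (0 <= D w)%E,
    (\int[P]_w D w <= (8 * V)%:E)%E &
    forall n w, ((psum zeta n w ^+ 2)%:E <= D w)%E].
Proof.
move=> za zm zV.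
pose zN N w := - zeta N w.
have zNa N : adapted N.+1 (zN N) by exact: (adapted_comp (fun x : R => - x)).
have zNm N X : adapted N X -> expect (fun w => X w * zN N w) = 0.
  move=> aX; rewrite -(zm N (fun w => - X w)); last exact: (adapted_comp (fun x : R => - x)).
  by congr expect; apply/funext => w; rewrite /zN mulrN mulNr.
pose h n w := run_max zeta n w ^+ 2 + run_max zN n w ^+ 2.
pose g n w := (h n w)%:E.
have ha1 n : adapted n (fun w => run_max zeta n w ^+ 2).
  by apply: (adapted_comp (fun x : R => x ^+ 2)); exact: run_max_adapted.
have ha2 n : adapted n (fun w => run_max zN n w ^+ 2).
  by apply: (adapted_comp (fun x : R => x ^+ 2)); exact: run_max_adapted.
have ha n : adapted n (h n) by exact: (adapted_comp2 (fun x y : R => x + y)).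
have mg n : measurable_fun setT (g n) by apply/measurable_EFinP/adapted_measurable/ha.
have g0 n w : setT w -> (0 <= g n w)%E by move=> _; rewrite lee_fin addr_ge0 ?sqr_ge0.
have gnd w : setT w -> nondecreasing_seq (g^~ w).
  move=> _ n m nm; rewrite lee_fin; apply: lerD;
    by rewrite lerXn2r ?nnegrE ?run_max_ge0 ?run_max_nd.
have gV n : (\int[P]_w g n w <= (8 * V)%:E)%E.
  rewrite (expect_EFin (ha n)) lee_fin (expectD (ha1 n) (ha2 n)).
  have e : \sum_(N < n) expect (fun w => zN N w ^+ 2) =
           \sum_(N < n) expect (fun w => zeta N w ^+ 2).
    by apply: eq_bigr => N _; congr expect; apply/funext => w; rewrite sqrrN.
  have := doob_l2 za zm n; have := doob_l2 zNa zNm n; rewrite e.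
  have := zV n; lra.
exists (fun w => limn (g^~ w)); split.
- apply: (emeasurable_fun_cvg g) => // w _; exact/ereal_nondecreasing_is_cvgn/gnd.
- move=> w; apply: lime_ge; first exact/ereal_nondecreasing_is_cvgn/gnd.
  by apply: nearW => n; exact: g0.
- rewrite (monotone_convergence _ _ mg g0 gnd)//.
  apply: lime_le; last exact: nearW.
  apply: ereal_nondecreasing_is_cvgn => n m nm.
  by apply: ge0_le_integral => // w Dw; [exact: g0|exact: gnd].
- move=> n w; apply: lime_ge; first exact/ereal_nondecreasing_is_cvgn/gnd.
  exists n => // m /= nm; rewrite lee_fin /h.
  have h1 := run_max_ge zeta w nm; have h2 := run_max_ge zN w nm.
  rewrite psum_neg in h2.
  have r1 := run_max_ge0 zeta m w; have r2 := run_max_ge0 zN m w.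
  have [p0|p0] := leP 0 (psum zeta n w).
    apply: (@le_trans _ _ (run_max zeta m w ^+ 2)); last by rewrite lerDl sqr_ge0.
    by rewrite lerXn2r ?nnegrE.
  apply: (@le_trans _ _ (run_max zN m w ^+ 2)); last by rewrite lerDr sqr_ge0.
  by rewrite -sqrrN lerXn2r ?nnegrE// oppr_ge0 ltW.
Qed.

(** The maximal inequality applied to the increments after time [m] makes the
    oscillation of the partial sums beyond [m] vanish in mean as [m] grows. *)
Lemma martingale_cvg (zeta : nat -> Omega -> R) (v : nat -> R) (V : R) :
    (forall N, adapted N.+1 (zeta N)) ->
    (forall N X, adapted N X -> expect (fun w => X w * zeta N w) = 0) ->
    (forall N, expect (fun w => zeta N w ^+ 2) <= v N) ->
    (forall n, \sum_(N < n) v N <= V) ->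
  {ae P, forall w, exists l : R, psum zeta n w @[n --> \oo] --> l}.
Proof.
move=> za zm zv vV.
have za2 N : adapted N.+1 (fun w => zeta N w ^+ 2).
  exact: (adapted_comp (fun x : R => x ^+ 2)).
have v0 N : 0 <= v N.
  apply: le_trans (zv N); rewrite -(expect_cst 0).
  by apply: (expect_le _ (za2 N)) => // w; exact: sqr_ge0.
pose s n := \sum_(N < n) v N.
have snd : nondecreasing_seq s.
  apply/nondecreasing_seqP => n; by rewrite /s big_ord_recr /= lerDl.
have scv : cvgn s.
  by apply: nondecreasing_is_cvgn => //; exists V => _ [n _ <-]; exact: vV.
pose S := limn s.
have sS n : s n <= S by exact: nondecreasing_cvgn_le.
pose zt m N w := (m <= N)%N%:R * zeta N w.
have zta m N : adapted N.+1 (zt m N).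
  exact: (adapted_comp (fun x : R => (m <= N)%N%:R * x)).
have ztm m N X : adapted N X -> expect (fun w => X w * zt m N w) = 0.
  move=> aX; rewrite -(zm N (fun w => (m <= N)%N%:R * X w)); last first.
    exact: (adapted_comp (fun x : R => (m <= N)%N%:R * x)).
  by congr expect; apply/funext => w; rewrite /zt mulrCA mulrA.
have ztv m n : \sum_(N < n) expect (fun w => zt m N w ^+ 2) <= S - s m.
  apply: (@le_trans _ _ (\sum_(N < n) (m <= N)%N%:R * v N)).
    apply: ler_sum => N _; rewrite (_ : (fun w => _) =
      fun w => (m <= N)%N%:R * zeta N w ^+ 2).
      by rewrite (expectZ _ (za2 N)) ler_wpM2l.
    by apply/funext => w; rewrite /zt exprMn; case: (m <= N)%N; rewrite ?expr1n ?expr0n.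
  apply: (@le_trans _ _ (\sum_(N < m + n) (m <= N)%N%:R * v N)).
    rewrite [in leRHS]addnC big_split_ord /= lerDl sumr_ge0// => i _.
    by rewrite mulr_ge0.
  rewrite big_split_ord /= big1 ?add0r; last by move=> i _; rewrite leqNgt ltn_ord mul0r.
  have := sS (m + n)%N; rewrite /s big_split_ord /= lerBrDl => h.
  apply: le_trans h; rewrite lerD2l; apply: ler_sum => i _.
  by rewrite leq_addr mul1r.
have /choice[W WP] : forall m, exists Z : Omega -> \bar R, [/\ measurable_fun setT Z,
    forall w, (0 <= Z w)%E, (\int[P]_w Z w <= (8 * (S - s m))%:E)%E &
    forall n w, ((psum (zt m) n w ^+ 2)%:E <= Z w)%E].
  by move=> m; exact: (martingale_maximal (zta m) (ztm m) (ztv m)).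
pose f w := einfs (W^~ w) 0.
have mW m : measurable_fun setT (W m) by have [] := WP m.
have mf : measurable_fun setT f by exact: measurable_fun_einfs.
have f0 w : (0 <= f w)%E.
  by apply: le_ereal_inf_tmp => _ [m _ <-]; have [_ D0 _ _] := WP m.
have fW m w : (f w <= W m w)%E by apply: ereal_inf_lbound; exists m.
have intf : (\int[P]_w `|f w| = 0)%E.
  under eq_integral do rewrite gee0_abs//.
  apply/eqP; rewrite eq_le integral_ge0 ?andbT//.
  apply/lee_addgt0Pr => e e0; rewrite add0e.
  have e8 : 0 < e / 8 by rewrite divr_gt0.
  have /cvgrPdist_le/(_ _ e8) [m _ mP] := scv.
  have [_ D0 Dm _] := WP m.
  apply: (@le_trans _ _ (\int[P]_w W m w)%E).
    by apply: ge0_le_integral => //; move=> w _; exact: fW.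
  apply: (le_trans Dm); rewrite lee_fin.
  have h : S - s m <= e / 8.
    by apply: le_trans (mP m (leqnn m)); rewrite /= ler_norm.
  lra.
apply: filterS (proj1 (ae_eq_integral_abs P measurableT mf) intf) => w /(_ I) fw0.
suff : cvgn (psum zeta ^~ w) by move=> /cvg_ex.
apply/cauchy_cvgP/cauchy_exP => e e0.
have fE : f w = ereal_inf (range (W^~ w)).
  rewrite /f /einfs /sdrop /=; congr (ereal_inf _).
  by apply/seteqP; split => x [m _ <-]; exists m.
have : (f w < (e ^+ 2)%:E)%E by rewrite fw0 lte_fin exprn_gt0.
rewrite fE.
move=> /ereal_inf_lt[_ [m _ <-] De].
exists (psum zeta m w); exists m => // n /= mn.
rewrite /ball /= distrC -(ltr_pXn2r (n := 2))// ?nnegrE ?(ltW e0)//.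
rewrite real_normK ?num_real// -lte_fin; apply: le_lt_trans De.
have [_ _ _ /(_ n w)] := WP m; congr (_ <= _)%E; congr (_ ^+ 2)%:E.
rewrite -(subnKC mn) /psum !big_split_ord /= [X in _ = X - _]addrC addrK.
rewrite big1 ?add0r; last by move=> i _; rewrite /zt leqNgt ltn_ord mul0r.
by apply: eq_bigr => i _; rewrite /zt leq_addr mul1r.
Qed.

End Histories.

(** * From almost sure to mean square limits *)

Section L2Limits.
Variables (R : realType) (disp : measure_display) (Omega : measurableType disp).
Variable P : probability Omega R.

Lemma ae_forall_fin (I : finType) (Q : I -> Omega -> Prop) :
  (forall i, {ae P, forall w, Q i w}) -> {ae P, forall w, forall i, Q i w}.
Proof.
move=> aeQ.
have : {ae P, forall w, forall n, forall i : I, enum_rank i = n :> nat -> Q i w}.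
  apply: ae_foralln => n.
  have [[i0 i0n]|no] := pselect (exists i : I, enum_rank i = n :> nat); last first.
    by apply: aeW => w i ni; case: no; exists i.
  apply: filterS (aeQ i0) => w Qw i ni.
  suff -> : i = i0 by [].
  by apply: enum_rank_inj; apply: val_inj; rewrite /= ni i0n.
by apply: filterS => w Qw i; exact: (Qw (enum_rank i)).
Qed.

Lemma cvg0_poweR_half (u : nat -> \bar R) : (forall n, (0 <= u n)%E) ->
  (u n @[n --> \oo] --> 0)%E -> ((u n) `^ 2^-1 @[n --> \oo] --> 0)%E.
Proof.
move=> u0 ucv; rewrite (_ : (fun n => _) = fun n => sqrte (u n)); last first.
  by apply/funext => n; rewrite poweR12_sqrt.
have /fine_cvgP[ufin fcv] := ucv.
apply/fine_cvgP; split.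
  by apply: filterS ufin => n /=; case: (u n).
have : Num.sqrt (fine (u n)) @[n --> \oo] --> (0 : R).
  rewrite -[X in _ --> X]sqrtr0; apply: continuous_cvg => //.
  exact: sqrt_continuous.
apply: cvg_trans; apply: near_eq_cvg.
by apply: filterS ufin => n /=; case: (u n).
Qed.

(** Both [Y N ^+ 2] and the square of the limit are at most [B], so
    [(Y N - X) ^+ 2 <= 4 * B]. *)
Lemma l2_dominated_limit (Y : nat -> Omega -> R) (B : Omega -> \bar R) :
    (forall N, measurable_fun setT (Y N)) ->
    P.-integrable setT B ->
    {ae P, forall w, forall N, ((Y N w ^+ 2)%:E <= B w)%E} ->
    {ae P, forall w, exists l : R, Y N w @[N --> \oo] --> l} ->
  exists X : {RV P >-> R}, [/\ {ae P, forall w, Y N w @[N --> \oo] --> X w},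
    (X : Omega -> R) \in Lfun P 2%:E &
    (Lnorm P 2%:E (fun w => (Y N w - X w)%:E) @[N --> \oo] --> 0)%E].
Proof.
move=> mY iB YB Ycv.
pose f w := fine (limn_esup (fun N => (Y N w)%:E)).
have mf : measurable_fun setT f.
  apply: measurableT_comp => //; apply: measurable_fun_limn_esup => N.
  exact/measurable_EFinP.
have Yf : {ae P, forall w, Y N w @[N --> \oo] --> f w}.
  apply: filterS Ycv => w [l Yl].
  have El : (fun N => (Y N w)%:E) @ \oo --> l%:E by apply/fine_cvgP; split => //; exact: nearW.
  rewrite /f is_cvg_limn_esupE; last by apply/cvg_ex; exists l%:E.
  by rewrite (cvg_lim _ El).
have fB : {ae P, forall w, ((f w ^+ 2)%:E <= B w)%E}.
  apply: filterS2 YB Yf => w wB wf.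
  have c2 : (Y N w ^+ 2)%:E @[N --> \oo] --> (f w ^+ 2)%:E.
    apply/fine_cvgP; split; first exact: nearW.
    by rewrite /comp /=; under eq_fun do rewrite expr2; rewrite expr2; exact: cvgM.
  rewrite -(cvg_lim _ c2)//; apply: lime_le; first by apply/cvg_ex; exists (f w ^+ 2)%:E.
  exact: nearW.
have norm2 (g : Omega -> R) w : (`|(g w)%:E| `^ 2 = (g w ^+ 2)%:E)%E.
  by rewrite poweR_EFin powR_mulrn// real_normK// num_real.
pose X : {RV P >-> R} := mfun_Sub (mem_set mf).
have XE : (X : Omega -> R) = f by exact: mfun_valP.
exists X; rewrite XE; split => //.
  rewrite inE /=; apply/andP; split; first exact: mem_set.
  apply: mem_set; rewrite /= /finite_norm unlock; apply: poweR_lty.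
  under eq_integral do rewrite norm2.
  have [mB iBy] := integrableP _ _ _ iB.
  apply: le_lt_trans iBy; apply: ae_ge0_le_integral => //.
  - by move=> w _; rewrite lee_fin sqr_ge0.
  - by apply/measurable_EFinP; exact: measurable_funX.
  - exact: measurableT_comp.
  - by apply: filterS fB => w wB _; exact: le_trans wB (lee_abs _).
have mg N : measurable_fun setT (fun w => ((Y N w - f w) ^+ 2)%:E).
  by apply/measurable_EFinP; apply: measurable_funX; exact: measurable_funB.
have i4B : P.-integrable setT (fun w => 4%:E * B w)%E by exact: integrableZl.
have [] := @dominated_convergence _ _ _ P setT measurableT
  (fun N w => ((Y N w - f w) ^+ 2)%:E) (cst 0%E) (fun w => 4%:E * B w)%E mg _ _ i4B _.
- exact: measurable_cst.
- apply: filterS Yf => w wf _; apply/fine_cvgP; split; first exact: nearW.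
  rewrite /comp /=; rewrite -[X in _ --> X](mulr0 0) -(subrr (f w)).
  under eq_fun do rewrite expr2.
  by apply: cvgM; apply: cvgB => //; exact: cvg_cst.
- apply: filterS2 YB fB => w wY wf N _.
  rewrite gee0_abs ?lee_fin ?sqr_ge0//.
  have := wY N; case: (B w) wf => [b| |]; last 2 first.
  + by move=> _ _; rewrite mulry gtr0_sg// mul1e leey.
  + by rewrite leeNy_eq.
  rewrite -EFinM !lee_fin => h1 h2.
  have := sqr_ge0 (Y N w + f w); lra.
move=> _ cv0 _.
rewrite (_ : (fun N => _) = fun N =>
  ((\int[P]_w ((Y N w - f w) ^+ 2)%:E) `^ 2^-1)%E); last first.
  by apply/funext => N; rewrite unlock; under eq_integral do
    rewrite (norm2 (fun w => Y N w - f w)).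
apply: cvg0_poweR_half.
  by move=> N; apply: integral_ge0 => w _; rewrite lee_fin sqr_ge0.
rewrite (_ : (fun N => _) = (fun N =>
  \int[P]_w `|((Y N w - f w) ^+ 2)%:E - (cst 0 w)|)%E)//.
apply/funext => N; apply: eq_integral => w _.
by rewrite /cst sube0 gee0_abs// lee_fin sqr_ge0.
Qed.

End L2Limits.

(** * Comparison of the normings with powers and logarithms *)

Section NormingAsymptotics.
Variable R : realType.

(** The quotient decreases in [N], by [ln (1 - s) <= - s] and [1 + t <= expR t]. *)
Lemma growth_powR_cvg (a : R) : 0 <= a ->
  exists l : R, growth a N / (N%:R `^ a) @[N --> \oo] --> l.
Proof.
move=> a0; pose q N := growth a N.+1 / (N.+1%:R `^ a).
have q0 N : 0 <= q N by rewrite divr_ge0 ?powR_ge0// ltW// growth_gt0.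
have qS N : q N.+1 <= q N.
  have s0 := step_gt0 R N.+1; have s1 : step R N.+1 <= 2^-1.
    by rewrite lef_pV2 ?posrE ?ltr0n// ler_nat.
  rewrite /q growthS; set g := growth a N.+1.
  rewrite ler_pdivrMr ?powR_gt0 ?ltr0n// mulrAC ler_pdivlMr ?powR_gt0 ?ltr0n//.
  rewrite -mulrA ler_pM2l ?growth_gt0//.
  have -> : N.+1%:R = N.+2%:R * (1 - step R N.+1) :> R.
    by rewrite mulrBr mulr1 divff ?pnatr_eq0// -[N.+2%:R]natr1 addrK.
  rewrite powRM ?ler0n//; last lra.
  rewrite mulrCA ler_piMr ?powR_ge0//.
  rewrite /powR gt_eqF; last lra.
  have h1 : ln (1 - step R N.+1) <= - step R N.+1 by apply: le_ln1Dx; lra.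
  have h2 : a * ln (1 - step R N.+1) <= - (a * step R N.+1).
    by rewrite -mulrN ler_wpM2l.
  apply: (@le_trans _ _ (expR (a * step R N.+1) * expR (- (a * step R N.+1)))).
    apply: ler_pM => //.
    - by rewrite ltW// growth_factor_gt0.
    - exact: expR_ge1Dx.
    - by rewrite ler_expR.
  by rewrite -expRD subrr expR0.
have : cvgn q.
  apply: nonincreasing_is_cvgn; first exact/nonincreasing_seqP.
  by exists 0 => _ [N _ <-].
by move=> /cvg_ex[l ql]; exists l; rewrite -(cvg_shiftS (fun N => growth a N / N%:R `^ a)).
Qed.

(** The difference [harm N - ln N] stays between zero and two. *)
Lemma harm_ln_cvg : harm R N / ln (N%:R : R) @[N --> \oo] --> (1 : R).
Proof.
have lny : ln (N%:R : R) @[N --> \oo] --> +oo by apply: cvg_ln_pinfty; exact: cvgr_idn.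
have up N : (1 <= N)%N -> harm R N <= 2 + ln (N%:R : R).
  elim: N => // -[_ _|N IH _].
    by rewrite ln1 addr0 /harm big_ord_recr big_ord0 /= add0r /step invr1.
  rewrite harmS; apply: (le_trans (lerD (IH _) (lexx _))) => //.
  rewrite -addrA lerD2l.
  have s1 : step R N.+1 <= 2^-1 by rewrite lef_pV2 ?posrE ?ltr0n// ler_nat.
  have s0 := step_gt0 R N.+1.
  have -> : N.+1%:R = N.+2%:R * (1 - step R N.+1) :> R.
    by rewrite mulrBr mulr1 divff ?pnatr_eq0// -[N.+2%:R]natr1 addrK.
  have h1 : ln (1 - step R N.+1) <= - step R N.+1 by apply: le_ln1Dx; lra.
  rewrite lnM ?posrE ?ltr0n//; lra.
have h : 1 + 2 * (ln (N%:R : R))^-1 @[N --> \oo] --> (1 : R).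
  rewrite -[X in _ --> X]addr0 -(mulr0 2); apply: cvgD; first exact: cvg_cst.
  apply: cvgMl_tmp; apply/gtr0_cvgV0 => //.
  by have /cvgryPgt/(_ 0) := lny; apply: filterS.
apply: (squeeze_cvgr _ (cvg_cst (1 : R)) h).
exists 2%N => // N /= N2.
have l0 : 0 < ln (N%:R : R) by rewrite ln_gt0// ltr1n.
rewrite ler_pdivlMr// mul1r ler_pdivrMr// mulrDl mul1r divfK ?gt_eqF//.
rewrite [ln _ + 2]addrC up ?(ltnW N2)// andbT.
apply: le_trans (harm_ge_ln R N); rewrite ler_ln ?posrE ?ltr0n ?ler_nat//.
exact: ltnW.
Qed.

Lemma norming_asymptotics (a : R) b : 0 <= a ->
  exists l : R, norming a b N / (N%:R `^ a * ln (N%:R : R) ^+ b) @[N --> \oo] --> l.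
Proof.
move=> a0; have [l gl] := growth_powR_cvg a0; exists (l * 1 ^+ b).
rewrite (_ : (fun N => _) = fun N => growth a N / (N%:R `^ a) *
  (harm R N / ln (N%:R : R)) ^+ b); last first.
  by apply/funext => N; rewrite /norming invfM expr_div_n mulrACA.
apply: cvgM => //; elim: b => [|b IH]; first exact: cvg_cst.
under eq_fun do rewrite exprS; rewrite exprS; apply: cvgM => //.
exact: harm_ln_cvg.
Qed.

Lemma norming00 N : norming (0 : R) 0 N = 1.
Proof. by rewrite /norming /growth big1 ?mulr1// => i _; rewrite mul0r addr0. Qed.

Lemma norming0b b N : norming (0 : R) b N = harm R N ^+ b.
Proof. by rewrite /norming /growth big1 ?mul1r// => i _; rewrite mul0r addr0. Qed.

Lemma norming_leS (a : R) b N : 0 <= a -> norming a b N <= norming a b N.+1.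
Proof.
move=> a0; rewrite /norming growthS harmS; have s0 := step_gt0 R N.
have H0 := harm_gt0 R N; have g0 := growth_gt0 N a0.
apply: ler_pM; rewrite ?exprn_ge0 ?(ltW g0) ?(ltW H0)//.
  by rewrite ler_peMr ?(ltW g0)// lerDl mulr_ge0// ltW.
have H1 : harm R N <= harm R N + step R N by rewrite lerDl ltW.
by rewrite lerXn2r ?nnegrE ?(ltW H0)// (le_trans (ltW H0)).
Qed.

Lemma sum_step_norming (a : R) b : 0 < a -> exists C : R, forall n,
  \sum_(N < n) step R N * (norming a b N)^-1 <= C.
Proof.
move=> a0; have [c /andP[c0 _] [N0 N0P]] := norming_ratio_decay b 0 (lexx 0) a0.
apply: (@decay_summable _ (fun N => (norming a b N)^-1) c N0) => //.
  by move=> N; rewrite invr_ge0 ltW// norming_gt0// ltW.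
by move=> N /N0P; rewrite !norming00 !mul1r.
Qed.

(** The terms are dominated by the decrements of [(harm N)^-1]. *)
Lemma sum_step_harm n : \sum_(N < n) step R N / harm R N.+1 ^+ 2 <= 1.
Proof.
suff : \sum_(N < n) step R N / harm R N.+1 ^+ 2 <= 1 - (harm R n)^-1.
  by move=> /le_trans; apply; rewrite gerBl invr_ge0 ltW// harm_gt0.
elim: n => [|n IH]; first by rewrite big_ord0 /harm big_ord0 addr0 invr1 subrr.
rewrite big_ord_recr /=; apply: (le_trans (lerD IH (lexx _))).
have H0 := harm_gt0 R n; have H1 := harm_gt0 R n.+1; have s0 := step_gt0 R n.
have : step R n / harm R n.+1 ^+ 2 <= step R n / (harm R n * harm R n.+1).
  rewrite ler_pM2l// lef_pV2 ?posrE ?mulr_gt0 ?exprn_gt0//.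
  by rewrite expr2 ler_pM2r// harmS lerDl ltW.
have -> : step R n / (harm R n * harm R n.+1) = (harm R n)^-1 - (harm R n.+1)^-1.
  have -> : step R n = harm R n.+1 - harm R n by rewrite harmS addrC addKr.
  by field; rewrite !gt_eqF.
lra.
Qed.

End NormingAsymptotics.

(** * The noise of the urn *)

Section UrnMartingale.
Variables (R : realType) (D : nat) (C0 : 'rV[R]_D) (A : 'M[R]_D).
Variables (disp : measure_display) (Omega : measurableType disp).
Variables (P : probability Omega R) (sel : nat -> Omega -> 'I_D).
Hypothesis A_ge0 : forall i j, 0 <= A i j.
Hypothesis A_balanced : forall i, \sum_j A i j = 1.
Hypothesis C0_ge0 : forall i, 0 <= C0 0 i.
Hypothesis urn : urn_process C0 A P sel.

Let msel : forall n i, measurable [set w | sel n w = i].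
Proof. by have [] := urn. Qed.

Let C := color_count C0 A sel.
Let E := expect P.

Lemma color_count_adapted N : adapted sel N (C N).
Proof.
elim: N => [//|N IH] w w' ww; rewrite /C /= -/C.
by rewrite (IH w w') ?ww// => n nN; apply: ww; rewrite ltnS ltnW.
Qed.

Let count_adapted N j : adapted sel N (fun w => C N w 0 j).
Proof. exact: (adapted_comp (fun x : 'rV[R]_D => x 0 j) (@color_count_adapted N)). Qed.

Lemma color_count_ge0 N w j : 0 <= C N w 0 j.
Proof.
elim: N => [|N IH] //=; rewrite /C /= mxE addr_ge0//.
by rewrite mxE.
Qed.

Let drift N (phi : 'I_D -> R) w : R := \sum_i phi i * (C N w 0 i * step R N).

Let drift_adapted N phi : adapted sel N (drift N phi).
Proof.
apply: adapted_sum => i _.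
exact: (adapted_comp (fun x : R => phi i * (x * step R N)) (@count_adapted N i)).
Qed.

Let sel_adapted N (phi : 'I_D -> R) : adapted sel N.+1 (fun w => phi (sel N w)).
Proof. exact: (adapted_comp phi (@adapted_sel _ _ _ sel N)). Qed.

Let ind_adapted N (h : {ffun 'I_N -> 'I_D}) :
  adapted sel N (fun w => \1_(cylinder sel h) w : R).
Proof.
move=> w w' ww; rewrite !indicE; congr (_%:R); congr (nat_of_bool _).
have e : history sel N w = history sel N w'.
  by apply/ffunP => n; rewrite !ffunE ww.
by apply/idP/idP; rewrite !inE /cylinder /= e.
Qed.

Let cylinder_selection N (h : {ffun 'I_N -> 'I_D}) i :
  E (fun w => \1_(cylinder sel h) w * (sel N w == i)%:R) =
  E (fun w => \1_(cylinder sel h) w * (C N w 0 i * step R N)).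
Proof.
have [_ /(_ N i _ (cylinder_past h)) h1] := urn.
transitivity (fine (P (cylinder sel h `&` [set w | sel N w = i]))).
  rewrite /E /expect /Rintegral; congr fine.
  rewrite -[X in _ = P X]setIT -integral_indic//; last first.
    by apply: measurableI => //; exact: measurable_cylinder.
  apply: eq_integral => w _; rewrite indicI /=; congr (_ * _)%:E.
  by rewrite indicE; congr (_%:R); congr nat_of_bool; apply/eqP/idP; rewrite inE.
rewrite h1 -/(Rintegral P (cylinder sel h) (fun w => C N w 0 i / N.+1%:R)).
rewrite Rintegral_mkcond /E /expect; congr (Rintegral P setT); apply/funext => w.
rewrite patchE indicE; case: (w \in _); first by rewrite mul1r.
by rewrite mul0r.
Qed.

(** The selection rule extends from the events of the past to the functions of
    the past by linearity. *)
Lemma expect_selection N X (phi : 'I_D -> R) : adapted sel N X ->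
  E (fun w => X w * phi (sel N w)) = E (fun w => X w * drift N phi w).
Proof.
move=> aX; have [F XF] := adapted_history aX.
have ai (h : {ffun 'I_N -> 'I_D}) : adapted sel N.+1 (fun w => \1_(cylinder sel h) w : R).
  exact: adapted_le (leqnSn N) (@ind_adapted N h).
have as_ i : adapted sel N.+1 (fun w => (sel N w == i)%:R : R).
  exact: (sel_adapted (fun l => (l == i)%:R)).
have ac i : adapted sel N.+1 (fun w => C N w 0 i).
  exact: adapted_le (leqnSn N) (@count_adapted N i).
have a1 (h : {ffun 'I_N -> 'I_D}) i : adapted sel N.+1
    (fun w => F h * phi i * (\1_(cylinder sel h) w * (sel N w == i)%:R)).
  exact: (adapted_comp2 (fun x y : R => F h * phi i * (x * y))).
have a2 (h : {ffun 'I_N -> 'I_D}) i : adapted sel N.+1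
    (fun w => F h * phi i * (\1_(cylinder sel h) w * (C N w 0 i * step R N))).
  exact: (adapted_comp2 (fun x y : R => F h * phi i * (x * (y * step R N)))).
transitivity (\sum_(h : {ffun 'I_N -> 'I_D}) \sum_i E (fun w =>
    F h * phi i * (\1_(cylinder sel h) w * (sel N w == i)%:R))).
  rewrite (_ : (fun w => _) = fun w => \sum_(h : {ffun 'I_N -> 'I_D}) \sum_i
      F h * phi i * (\1_(cylinder sel h) w * (sel N w == i)%:R)).
    rewrite /E (expect_sum P msel (N := N.+1)); last by move=> h _; exact: adapted_sum.
    by apply: eq_bigr => h _; rewrite (expect_sum P msel (N := N.+1)).
  apply/funext => w; rewrite XF history_sum mulr_suml; apply: eq_bigr => h _.
  rewrite (bigD1 (sel N w))//= eqxx mulr1 big1 ?addr0 => [|i iN]; first by ring.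
  by rewrite eq_sym (negbTE iN) !mulr0.
transitivity (\sum_(h : {ffun 'I_N -> 'I_D}) \sum_i E (fun w =>
    F h * phi i * (\1_(cylinder sel h) w * (C N w 0 i * step R N)))).
  apply: eq_bigr => h _; apply: eq_bigr => i _.
  rewrite /E (expectZ P msel (N := N.+1)); last first.
    exact: (adapted_comp2 (fun x y : R => x * y)).
  rewrite (expectZ P msel (N := N.+1)); last first.
    exact: (adapted_comp2 (fun x y : R => x * (y * step R N))).
  by congr (_ * _); exact: cylinder_selection.
rewrite (_ : (fun w => X w * _) = fun w => \sum_(h : {ffun 'I_N -> 'I_D}) \sum_i
    F h * phi i * (\1_(cylinder sel h) w * (C N w 0 i * step R N))).
  rewrite /E (expect_sum P msel (N := N.+1)); last by move=> h _; exact: adapted_sum.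
  by apply: eq_bigr => h _; rewrite (expect_sum P msel (N := N.+1)).
apply/funext => w; rewrite XF history_sum mulr_suml; apply: eq_bigr => h _.
by rewrite /drift mulr_sumr; apply: eq_bigr => i _; ring.
Qed.

Definition urn_noise N w : 'rV[R]_D := row (sel N w) A - step R N *: (C N w *m A).

Lemma color_count_rec w : urn_rec A (fun N => C N w) (fun N => urn_noise N w).
Proof. by move=> N; rewrite /C /= -/C /urn_noise -addrA [X in _ = _ + X]addrC subrK. Qed.

Let noiseE N w j : urn_noise N w 0 j = A (sel N w) j - drift N (A^~ j) w.
Proof.
have -> : drift N (A^~ j) w = step R N * (C N w *m A) 0 j.
  by rewrite mxE mulr_sumr; apply: eq_bigr => i _; ring.
by rewrite /urn_noise; move: (C N w *m A) => y; rewrite !mxE.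
Qed.

Lemma urn_noise_adapted N j : adapted sel N.+1 (fun w => urn_noise N w 0 j).
Proof.
rewrite (_ : (fun w => _) = fun w => A (sel N w) j - drift N (A^~ j) w).
  apply: (adapted_comp2 (fun x y : R => x - y)); first exact: (sel_adapted (A^~ j)).
  exact: adapted_le (leqnSn N) (@drift_adapted N _).
by apply/funext => w; exact: noiseE.
Qed.

Lemma urn_noise_mart N j X : adapted sel N X -> E (fun w => X w * urn_noise N w 0 j) = 0.
Proof.
move=> aX; have aX' := adapted_le (leqnSn N) aX.
rewrite (_ : (fun w => _) = fun w => X w * A (sel N w) j - X w * drift N (A^~ j) w).
  rewrite /E (expectB P msel (N := N.+1)).
  - by rewrite -/E (expect_selection (A^~ j) aX) subrr.
  - exact: (adapted_comp2 (fun x y : R => x * y) aX' (sel_adapted (A^~ j))).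
  - apply: (adapted_comp2 (fun x y : R => x * y) aX').
    exact: adapted_le (leqnSn N) (@drift_adapted N _).
by apply/funext => w; rewrite noiseE mulrBr.
Qed.

Definition mean_count N : 'rV[R]_D := \row_j E (fun w => C N w 0 j).

Let drift_mean N (phi : 'I_D -> R) :
  E (drift N phi) = step R N * \sum_i phi i * mean_count N 0 i.
Proof.
rewrite /drift /E (expect_sum P msel (N := N)) => [|i _]; last first.
  exact: (adapted_comp (fun x : R => phi i * (x * step R N)) (@count_adapted N i)).
rewrite mulr_sumr; apply: eq_bigr => i _.
rewrite (_ : (fun w => _) = fun w => (phi i * step R N) * C N w 0 i).
  by rewrite (expectZ P msel _ (@count_adapted N i)) mxE /E; ring.
by apply/funext => w; ring.
Qed.

Lemma mean_count_rec : urn_rec A mean_count (fun=> 0).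
Proof.
move=> N; rewrite addr0; apply/rowP => j.
rewrite [LHS]mxE [RHS]mxE.
rewrite (_ : (fun w => _) = fun w => C N w 0 j + 1 * A (sel N w) j); last first.
  by apply/funext => w; rewrite /C /= !mxE mul1r.
rewrite /E (expectD P msel (N := N.+1)); last 2 first.
- exact: adapted_le (leqnSn N) (@count_adapted N j).
- exact: (adapted_comp (fun x : R => 1 * x) (sel_adapted (A^~ j))).
have a1 : adapted sel N (fun=> 1 : R) by [].
rewrite -/E (expect_selection (A^~ j) a1).
rewrite (_ : (fun w => 1 * _) = drift N (A^~ j)); last by apply/funext => w; rewrite mul1r.
rewrite drift_mean; congr (_ + _); first by rewrite mxE.
rewrite [RHS]mxE; congr (_ * _); rewrite [RHS]mxE.
by apply: eq_bigr => i _; rewrite mulrC.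
Qed.

(** A conditional variance is at most the conditional second moment, and
    [A i j ^+ 2 <= A i j] since the rows of [A] sum to one. *)
Lemma urn_noise_variance N j :
  E (fun w => urn_noise N w 0 j ^+ 2) <= step R N * (mean_count N *m A) 0 j.
Proof.
pose m := drift N (A^~ j).
have am : adapted sel N m by exact: drift_adapted.
have am' := adapted_le (leqnSn N) am.
have aA : adapted sel N.+1 (fun w => A (sel N w) j) by exact: (sel_adapted (A^~ j)).
have a1 : adapted sel N.+1 (fun w => m w * A (sel N w) j).
  exact: (adapted_comp2 (fun x y : R => x * y)).
have a2 : adapted sel N (fun w => m w * m w) by exact: (adapted_comp2 (fun x y : R => x * y)).
have aS : adapted sel N.+1 (fun w => A (sel N w) j ^+ 2).
  exact: (sel_adapted (fun i => A i j ^+ 2)).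
have a2' := adapted_le (leqnSn N) a2.
have -> : E (fun w => urn_noise N w 0 j ^+ 2) =
    E (fun w => A (sel N w) j ^+ 2) - E (fun w => m w * m w).
  rewrite (_ : (fun w => _) = fun w => (A (sel N w) j ^+ 2 -
     2 * (m w * A (sel N w) j)) + m w * m w); last first.
    by apply/funext => w; rewrite noiseE -/m; ring.
  rewrite /E (expectD P msel _ a2'); last first.
    by apply: (adapted_comp2 (fun x y : R => x - 2 * y)).
  rewrite (expectB P msel aS); last exact: (adapted_comp (fun x : R => 2 * x)).
  rewrite (expectZ P msel _ a1) -/E (expect_selection (A^~ j) am) -/m.
  ring.
have Am1 i : A i j <= 1.
  by rewrite -(A_balanced i) (bigD1 j)//= lerDl sumr_ge0.
apply: (@le_trans _ _ (E (fun w => A (sel N w) j ^+ 2))).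
  rewrite gerBl /E -(expect_cst P (0 : R)).
  apply: (expect_le P msel (N := N)) => // w; exact: sqr_ge0.
rewrite (_ : (fun w => _) = fun w => 1 * A (sel N w) j ^+ 2); last first.
  by apply/funext => w; rewrite mul1r.
have a0 : adapted sel N (fun=> 1 : R) by [].
rewrite (expect_selection (fun i => A i j ^+ 2) a0).
rewrite (_ : (fun w => _) = drift N (fun i => A i j ^+ 2)); last first.
  by apply/funext => w; rewrite mul1r.
rewrite drift_mean mxE ler_pM2l ?step_gt0//; apply: ler_sum => i _.
rewrite [leRHS]mulrC ler_wpM2r//.
  rewrite mxE /E -(expect_cst P (0 : R)).
  by apply: (expect_le P msel (N := N)) => // w; exact: color_count_ge0.
by rewrite expr2 ler_piMl.
Qed.

End UrnMartingale.

(** * Convergence of the counts *)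

Section UrnBlocks.
Variables (R : realType) (K : nat) (d : 'I_K.+1 -> nat).
Variables (A : 'M[R]_(\sum_k d k)) (C0 : 'rV[R]_(\sum_k d k)).
Variables (disp : measure_display) (Omega : measurableType disp).
Variables (P : probability Omega R) (sel : nat -> Omega -> 'I_(\sum_k d k)).
Hypothesis d_gt0 : forall k, (0 < d k)%N.
Hypothesis A_ge0 : forall i j, 0 <= A i j.
Hypothesis A_balanced : forall i, \sum_j A i j = 1.
Hypothesis A_upper : forall k l : 'I_K.+1, (l < k)%N -> submxblock A k l = 0.
Hypothesis A_diag : forall k : 'I_K.+1,
  irreducible_mx (submxblock A k k) \/ (d k = 1%N /\ submxblock A k k = 0).
Hypothesis C0_ge0 : forall i, 0 <= C0 0 i.
Hypothesis C0_sum : \sum_i C0 0 i = 1.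
Hypothesis urn : urn_process C0 A P sel.

Let ra := rate_exp A.
Let rb := rate_log A.
Let nk k N := norming (ra k) (rb k) N.

Let ra_ge0 k : 0 <= ra k. Proof. exact: rate_exp_ge0. Qed.

Let nk_gt0 k N : 0 < nk k N. Proof. exact: norming_gt0. Qed.

Lemma rate_mono m k : feeds A m k -> lex_le (ra m) (rb m) (ra k) (rb k).
Proof.
move=> fm; have [_ [_ [nf _ _|l fl lex gap ek lk|l fl lex gap ek lk|l fl lex gap ek lk]]] :=
  rateP d_gt0 A_ge0 A_diag k; rewrite /ra /rb.
- by have := nf m; rewrite fm.
- rewrite /lex_le ek lk; apply/orP; left; apply: le_lt_trans gap.
  by have /orP[/ltW//|/andP[/eqP -> _]] := lex _ fm.
- rewrite ek lk -gap; have /orP[ml|/andP[/eqP -> bb]] := lex _ fm.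
    by rewrite /lex_le ml.
  by rewrite /lex_le eqxx (leq_trans bb)// orbT.
- by rewrite ek lk; exact: lex.
Qed.

(** The inflow into block [k] is at most of the order of its norming, so the terms
    are of order [step N / norming], which is summable if [rate_exp A k] is
    positive.  If it is zero, the block does not feed itself, and the inflow
    carries one power of [harm] less than the norming, so the terms are at most of
    order [step N / harm N ^+ 2]. *)
Lemma variance_summable (e : nat -> 'rV[R]_(\sum_k d k)) k j :
    urn_rec A e (fun=> 0) -> row_bound 1 (e 0%N) ->
  exists V : R, forall n, \sum_(N < n)
    (nk k N.+1)^-1 ^+ 2 * (step R N * submxrow (e N *m A) k 0 j) <= V.
Proof.
move=> eS e0.
have no_noise k' N : row_bound 1 (block_noise A (fun=> 0) k' N).
  move=> l; rewrite /block_noise /noise_sum big1 ?mxE ?normr0// => i _.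
  by rewrite /normed_noise /block submxrow0 scaler0.
pose bd m := block_dynamics_bound d_gt0 A_ge0 A_upper A_diag m.
have [C C0' CP] := bd k.
have eC N := CP _ _ _ ler01 eS e0 no_noise N; rewrite mulr1 in eC.
have le_sum (u : nat -> R) (D : R) : (forall N, submxrow (e N *m A) k 0 j <= D * u N) ->
    forall n, \sum_(N < n) (nk k N.+1)^-1 ^+ 2 * (step R N * submxrow (e N *m A) k 0 j) <=
      D * \sum_(N < n) (nk k N.+1)^-1 ^+ 2 * (step R N * u N).
  move=> h n; rewrite mulr_sumr; apply: ler_sum => N _.
  by rewrite [leRHS]mulrCA ler_wpM2l ?sqr_ge0// [leRHS]mulrCA ler_pM2l ?step_gt0.
have [a0|a_le0] := ltP 0 (ra k).
  have [G G0 GP] := inflow_bound d_gt0 A_ge0 A_diag (@rate_mono^~ k) (fun m _ => bd m).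
  have eG N := GP _ _ _ ler01 eS e0 no_noise N; rewrite mulr1 in eG.
  pose D := entry_sum (submxblock A k k) * C + G.
  have D0 : 0 <= D by rewrite addr_ge0// mulr_ge0// entry_sum_ge0.
  have h N : submxrow (e N *m A) k 0 j <= D * nk k N.
    rewrite -ler_pdivrMr// mulrC; apply: le_trans (ler_norm _) _.
    have -> : (nk k N)^-1 * submxrow (e N *m A) k 0 j =
       (normed_block A e k N *m submxblock A k k + normed (ra k) (rb k) (inflow A e k) N) 0 j.
      rewrite submxrow_mulmx_upper// /normed_block /normed -scalemxAl -scalerDr.
      by rewrite [RHS]mxE.
    by apply: row_boundD; [exact: row_bound_mulmx | exact: eG].
  have [V VP] := sum_step_norming (rb k) a0.
  exists (D * V) => n; apply: (le_trans (le_sum _ _ h n)); rewrite ler_wpM2l//.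
  apply: le_trans (VP n); apply: ler_sum => N _.
  rewrite mulrCA ler_pM2l ?step_gt0//.
  have n0 := nk_gt0 k N; have n1 := nk_gt0 k N.+1.
  rewrite -ler_pdivlMr// -invfM exprVn lef_pV2 ?posrE ?(mulr_gt0 n0) ?exprn_gt0//.
  by rewrite expr2; apply: ler_pM; rewrite ?(ltW n0)// norming_leS.
have a0 : ra k = 0 by apply/eqP; rewrite eq_le a_le0 ra_ge0.
have [mu0 _] := diagonal_perron d_gt0 A_ge0 A_diag k.
have [_ [_ [nf ek lk|m fm lex gap ek lk|m fm lex gap ek lk|m fm lex gap ek lk]]] :=
  rateP d_gt0 A_ge0 A_diag k.
- have Q0 : submxblock A k k = 0.
    by apply: diagonal_character0 => //; rewrite -ek.
  exists 0 => n; rewrite big1// => N _.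
  rewrite submxrow_mulmx_upper// Q0 mulmx0 add0r big1 ?mxE ?mulr0// => m fm.
  by have := nf m; rewrite fm.
- by have := ra_ge0 m; rewrite leNgt /ra (lt_le_trans gap) -?ek.
- have Q0 : submxblock A k k = 0.
    by apply: diagonal_character0 => //; rewrite -ek.
  have am : rate_exp A m = 0 by rewrite gap -ek.
  have [G G0 GP] := inflow_bound d_gt0 A_ge0 A_diag lex (fun m _ => bd m).
  have eG N := GP _ _ _ ler01 eS e0 no_noise N; rewrite mulr1 am in eG.
  have h N : submxrow (e N *m A) k 0 j <= G * harm R N ^+ rate_log A m.
    rewrite -norming0b -ler_pdivrMr ?norming_gt0// mulrC.
    apply: le_trans (ler_norm _) _.
    rewrite submxrow_mulmx_upper// Q0 mulmx0 add0r.
    by have := eG N j; rewrite /normed /inflow mxE.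
  exists (G * 1) => n; apply: (le_trans (le_sum _ _ h n)); rewrite ler_wpM2l//.
  apply: le_trans (sum_step_harm R n); apply: ler_sum => N _.
  rewrite mulrCA ler_pM2l ?step_gt0// /nk a0 norming0b /rb lk.
  have H0 := harm_gt0 R N; have H1 := harm_gt0 R N.+1.
  have HH : harm R N <= harm R N.+1 by rewrite harmS lerDl ltW// step_gt0.
  set b := rate_log A m.
  apply: (@le_trans _ _ ((harm R N.+1 ^+ b.+1)^-1 ^+ 2 * harm R N.+1 ^+ b ^+ 2)).
    rewrite ler_wpM2l ?sqr_ge0//.
    apply: (@le_trans _ _ (harm R N.+1 ^+ b)).
      by rewrite lerXn2r ?nnegrE ?(ltW H0) ?(ltW H1).
    by rewrite expr2 ler_peMr ?exprn_ge0 ?(ltW H1)// exprn_ege1// harm_ge1.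
  suff -> : (harm R N.+1 ^+ b.+1)^-1 ^+ 2 * harm R N.+1 ^+ b ^+ 2 =
      (harm R N.+1 ^+ 2)^-1 by [].
  have Hb : harm R N.+1 ^+ b != 0 by rewrite expf_neq0// gt_eqF.
  have H2 : harm R N.+1 != 0 by rewrite gt_eqF.
  rewrite [_ ^+ b.+1]exprS; move: (harm R N.+1) (harm R N.+1 ^+ b) Hb H2 => x y y0 x0.
  by rewrite invfM exprMn -mulrA -exprMn mulVf// expr1n mulr1 exprVn.
- by move: gap; rewrite -ek -/ra a0 ltNge mu0.
Qed.

Let C := color_count C0 A sel.
Let xi N w := urn_noise C0 A sel N w.

Let msel : forall n i, measurable [set w | sel n w = i].
Proof. by have [] := urn. Qed.

Let C0_bound : row_bound 1 C0.
Proof.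
by move=> i; rewrite ger0_norm// -C0_sum (bigD1 i)//= lerDl sumr_ge0.
Qed.

Let zeta k (j : 'I_(d k)) N w : R := (nk k N.+1)^-1 * submxrow (xi N w) k 0 j.

Let zeta_adapted k j N : adapted sel N.+1 (@zeta k j N).
Proof.
rewrite (_ : @zeta k j N = fun w => (nk k N.+1)^-1 * xi N w 0 (tagnat.Rank k j)).
  apply: (adapted_comp (fun x : R => (nk k N.+1)^-1 * x)).
  exact: urn_noise_adapted.
by apply/funext => w; rewrite /zeta mxE.
Qed.

Let zeta_mart k j N X : adapted sel N X -> expect P (fun w => X w * @zeta k j N w) = 0.
Proof.
move=> aX.
rewrite (_ : (fun w => _) = fun w => ((nk k N.+1)^-1 * X w) *
    xi N w 0 (tagnat.Rank k j)); last first.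
  by apply/funext => w; rewrite /zeta mxE mulrCA mulrA.
apply: (urn_noise_mart urn).
exact: (adapted_comp (fun x : R => (nk k N.+1)^-1 * x)).
Qed.

Let variance k j N : R := (nk k N.+1)^-1 ^+ 2 *
  (step R N * submxrow (mean_count C0 A P sel N *m A) k 0 j).

Let zeta_variance k j N : expect P (fun w => @zeta k j N w ^+ 2) <= @variance k j N.
Proof.
have aN : adapted sel N.+1 (fun w => xi N w 0 (tagnat.Rank k j) ^+ 2).
  by apply: (adapted_comp (fun x : R => x ^+ 2)); exact: urn_noise_adapted.
rewrite (_ : (fun w => _) = fun w => (nk k N.+1)^-1 ^+ 2 *
    xi N w 0 (tagnat.Rank k j) ^+ 2); last first.
  by apply/funext => w; rewrite /zeta mxE exprMn.
rewrite (expectZ P msel _ aN) /variance ler_wpM2l ?sqr_ge0// [in leRHS]mxE.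
exact: urn_noise_variance.
Qed.

Let variance_bound k j : exists V : R, forall n, \sum_(N < n) @variance k j N <= V.
Proof.
apply: variance_summable; first exact: mean_count_rec.
by move=> i; rewrite mxE expect_cst; exact: C0_bound.
Qed.

Let noise_psum k j N w :
  block_noise A (fun n => xi n w) k N 0 j = psum (@zeta k j) N w.
Proof.
rewrite /block_noise /noise_sum summxE; apply: eq_bigr => i _.
by rewrite /normed_noise mxE.
Qed.

Let noise_cvg : {ae P, forall w, forall k,
  exists r, row_cvg (block_noise A (fun n => xi n w) k) r}.
Proof.
apply: ae_forall_fin => k.
have : {ae P, forall w, forall j : 'I_(d k),
    exists l : R, psum (@zeta k j) n w @[n --> \oo] --> l}.
  apply: ae_forall_fin => j; have [V VP] := @variance_bound k j.
  exact: (martingale_cvg msel (@zeta_adapted k j) (@zeta_mart k j) (@zeta_variance k j) VP).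
apply: filterS => w /choice[l lP]; exists (\row_j l j) => j.
by rewrite mxE; under eq_fun do rewrite noise_psum; exact: lP.
Qed.

Let noise_maximal k : exists B : Omega -> \bar R, [/\ P.-integrable setT B,
  forall w, (0 <= B w)%E & forall N w j,
  ((block_noise A (fun n => xi n w) k N 0 j ^+ 2)%:E <= B w)%E].
Proof.
have /choice[B BP] : forall j : 'I_(d k), exists B : Omega -> \bar R,
   [/\ P.-integrable setT B, forall w, (0 <= B w)%E &
    forall N w, ((psum (@zeta k j) N w ^+ 2)%:E <= B w)%E].
  move=> j; have [V VP] := @variance_bound k j.
  have zV n : \sum_(N < n) expect P (fun w => @zeta k j N w ^+ 2) <= V.
    by apply: le_trans (VP n); apply: ler_sum => N _; exact: zeta_variance.
  have [B [mB B0 iB pB]] :=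
    martingale_maximal msel (@zeta_adapted k j) (@zeta_mart k j) zV.
  exists B; split => //; apply/integrableP; split => //.
  under eq_integral do rewrite gee0_abs//.
  by apply: le_lt_trans iB _; rewrite ltry.
have B0 j w : (0 <= B j w)%E by have [] := BP j.
exists (fun w => \sum_j B j w)%E; split.
- by apply: integrable_sum => // j _; have [] := BP j.
- by move=> w; apply: sume_ge0.
- move=> N w j; rewrite noise_psum; have [_ _ h] := BP j.
  apply: (le_trans (h N w)); rewrite (bigD1 j)//= leeDl//.
  by apply: sume_ge0.
Qed.

(** Almost every trajectory falls under [block_dynamics_cvg].  The majorant for the
    mean square limit comes from [block_dynamics_bound], applied to each trajectory
    with [M] the square root of [B1]. *)
Theorem urn_rate_pair k :
  is_rate_pair P (fun N w => submxrow (C N w) k) (ra k) (rb k).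
Proof.
have /choice[B BP] := noise_maximal.
(* dominates the squares of all the noise sums and of the initial counts *)
pose B1 w : \bar R := (1 + \sum_l B l w)%E.
have iB1 : P.-integrable setT B1.
  apply: integrableD => //; last by apply: integrable_sum => // l _; have [] := BP l.
  exact: finite_measure_integrable_cst.
have B0 l w : (0 <= B l w)%E by have [] := BP l.
have [D D0 DP] := block_dynamics_bound d_gt0 A_ge0 A_upper A_diag k.
have [l lP] := norming_asymptotics (rb k) (ra_ge0 k).
have [E E0 EP] := cvg_abs_bound lP.
pose Y j N w : R := submxrow (C N w) k 0 j / (N%:R `^ ra k * ln (N%:R : R) ^+ rb k).
have YE j N w : Y j N w = norming (ra k) (rb k) N / (N%:R `^ ra k * ln (N%:R : R) ^+ rb k) *
    normed_block A (fun n => C n w) k N 0 j.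
  rewrite /Y /normed_block /normed [X in _ = _ * X]mxE /block.
  have n0 : norming (ra k) (rb k) N != 0 by apply: lt0r_neq0; exact: nk_gt0.
  by rewrite mulrACA divff// mul1r mulrC.
have cS w := color_count_rec C0 A sel w.
have mY j N : measurable_fun setT (Y j N).
  apply: (adapted_measurable msel (N := N)); rewrite /Y.
  apply: (adapted_comp (fun x : 'rV[R]_(\sum_k d k) =>
    submxrow x k 0 j / (N%:R `^ ra k * ln (N%:R : R) ^+ rb k))).
  exact: color_count_adapted.
have Ycv j : {ae P, forall w, exists l : R, Y j N w @[N --> \oo] --> l}.
  apply: filterS noise_cvg => w Sw.
  have [r rP] := block_dynamics_cvg d_gt0 A_ge0 A_upper A_diag k (cS w) Sw.
  exists (l * r 0 j); under eq_fun do rewrite YE.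
  by apply: cvgM => //; exact: rP.
have YB j : {ae P, forall w, forall N, ((Y j N w ^+ 2)%:E <= ((E * D) ^+ 2)%:E * B1 w)%E}.
  have := integrable_ae measurableT iB1; apply: filterS => w /(_ I) Bfin N.
  pose M := Num.sqrt (fine (B1 w)).
  have BE : B1 w = (M ^+ 2)%:E.
    rewrite /M sqr_sqrtr ?fineK// fine_ge0// adde_ge0//; exact: sume_ge0.
  have M1 : 1 <= M.
    rewrite -(ler_pXn2r (n := 2)) ?nnegrE ?sqrtr_ge0// expr1n -lee_fin -BE.
    by rewrite leeDl//; exact: sume_ge0.
  have M0 : 0 <= M := le_trans ler01 M1.
  have SM k' n : row_bound M (block_noise A (fun n => xi n w) k' n).
    move=> i; rewrite -(ler_pXn2r (n := 2)) ?nnegrE// real_normK ?num_real//.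
    rewrite -lee_fin -BE; have [_ _ h] := BP k'; apply: (le_trans (h n w i)).
    rewrite /B1 (bigD1 k')//= addeA addeAC leeDr// adde_ge0//.
    exact: sume_ge0.
  have h := DP _ _ _ M0 (cS w) (row_bound_le M1 C0_bound) SM N j.
  rewrite BE -EFinM lee_fin -exprMn -[leLHS]real_normK ?num_real//.
  rewrite lerXn2r ?nnegrE ?mulr_ge0// YE normrM -[leRHS]mulrA.
  by apply: ler_pM => //; exact: EP.
have /choice[X XP] : forall j, exists X : {RV P >-> R},
   [/\ {ae P, forall w, Y j N w @[N --> \oo] --> X w},
    (X : Omega -> R) \in Lfun P 2%:E &
    (Lnorm P 2%:E (fun w => (Y j N w - X w)%:E) @[N --> \oo] --> 0)%E].
  move=> j; apply: (l2_dominated_limit (mY j) _ (YB j) (Ycv j)).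
  exact: integrableZl.
exists X; split.
- by apply: ae_forall_fin => j; have [] := XP j.
- by move=> j; have [] := XP j.
- by move=> j; have [] := XP j.
Qed.

End UrnBlocks.

Theorem theorem3p1 (R : realType) (K : nat) (d : 'I_K.+1 -> nat)
  (A : 'M[R]_(\sum_k d k)) (C0 : 'rV[R]_(\sum_k d k))
  (disp : measure_display) (Omega : measurableType disp)
  (P : probability Omega R) (sel : nat -> Omega -> 'I_(\sum_k d k))
  (d_gt0 : forall k, (0 < d k)%N)
  (A_ge0 : forall i j, 0 <= A i j)
  (A_balanced : forall i, \sum_j A i j = 1)
  (A_upper : forall k l : 'I_K.+1, (l < k)%N -> submxblock A k l = 0)
  (A_diag : forall k : 'I_K.+1,
     irreducible_mx (submxblock A k k) \/
     (d k = 1%N /\ submxblock A k k = 0))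
  (C0_gt0 : forall i, 0 < C0 0 i)
  (C0_sum : \sum_i C0 0 i = 1)
  (urn : urn_process C0 A P sel)
  (k : 'I_K.+1) :
  exists (a : R) (b : nat),
    [/\ 0 <= a,
        rate A k = (a%:E, b%:Z)
      & is_rate_pair P
          (fun N w => submxrow (color_count C0 A sel N w) k) a b].
Proof.
have [rE [a0 _]] := rateP d_gt0 A_ge0 A_diag k.
exists (rate_exp A k), (rate_log A k); split => //.
by apply: urn_rate_pair => // i; exact: ltW.
Qed.
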